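(* Let $D>1$ be a squarefree integer and $K=\mathbb{Q}(\sqrt D)$. For every $\varepsilon>0$ there is a constant $C_\varepsilon>0$ depending only on $\varepsilon$ such that $$\max\left(\frac{M_D}{\kappa s},\; C_\varepsilon M^*_{D,\varepsilon}\right)\leq m_{\mathrm{diag}}(D)\leq 8M_D,$$ where $\kappa=2$ if $s$ is odd and $\kappa=1$ if $s$ is even.
   Context: $\mathcal{O}_K$ is the ring of integers of $K$. An element $\alpha\in K$ is totally positive if $\alpha>0$ and its conjugate $\alpha'>0$. A diagonal quadratic form $Q(x_1,\dots,x_m)=a_1x_1^2+\dots+a_mx_m^2$ with all $a_i$ totally positive elements of $\mathcal{O}_K$ is universal if every totally positive $\alpha\in\mathcal{O}_K$ equals $Q(x_1,\dots,x_m)$ for some $x_i\in\mathcal{O}_K$. $m_{\mathrm{diag}}(D)$ is the smallest $m$ for which such an $m$-ary universal form exists over $K$. Let $\omega_D=\sqrt D$ if $D\equiv 2,3\pmod 4$ and $\omega_D=\frac{1+\sqrt D}{2}$ if $D\equiv 1\pmod 4$, and write the periodic continued fraction $\omega_D=[u_0;\overline{u_1,u_2,\dots,u_s}]$ with minimal period $s$. Define $M_D=u_1+u_3+\dots+u_{s-1}$ if $s$ is even; $M_D=2u_0+u_1+u_2+\dots+u_{s-1}$ if $s$ is odd and $D\equiv 2,3\pmod 4$; $M_D=2u_0+u_1+\dots+u_{s-1}-1$ if $s$ is odd and $D\equiv1\pmod 4$. For $\varepsilon>0$, $M^*_{D,\varepsilon}$ denotes the same sum as in the definition of $M_D$, but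 ranging only over those coefficients $u_i$ with $u_i\geq D^{1/8+\varepsilon}$. *)

(* Defs.v *)
From HB Require Import structures.
From mathcomp Require Import all_boot all_order all_algebra.
From mathcomp Require Import all_classical all_reals all_analysis.
From mathcomp Require Import Rstruct.
Set Implicit Arguments. Unset Strict Implicit. Unset Printing Implicit Defensive.
Import Order.TTheory GRing.Theory Num.Theory.
Local Open Scope ring_scope.

Definition squarefree (D : nat) : Prop :=
  forall p : nat, prime p -> ~~ (p * p %| D)%N.

Definition D1mod4 (D : nat) : bool := (D %% 4 == 1)%N.

Definition omega (D : nat) : Rdefinitions.R :=
  if D1mod4 D then (1 + Num.sqrt (D%:R : Rdefinitions.R)) / 2 else Num.sqrt (D%:R : Rdefinitions.R).
Definition omega' (D : nat) : Rdefinitions.R :=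
  if D1mod4 D then (1 - Num.sqrt (D%:R : Rdefinitions.R)) / 2 else - Num.sqrt (D%:R : Rdefinitions.R).

(** Elements of O_K = Z[omega_D]: the pair (a, b) stands for a + b omega_D. *)
Definition OK := (int * int)%type.

Definition ok0 : OK := (0, 0).
Definition okadd (x y : OK) : OK := (x.1 + y.1, x.2 + y.2).
(* omega^2 = omega + (D-1)/4 if D = 1 mod 4, omega^2 = D otherwise *)
Definition okmul (D : nat) (x y : OK) : OK :=
  if D1mod4 D then
    (x.1 * y.1 + x.2 * y.2 * ((D - 1) %/ 4)%N%:Z,
     x.1 * y.2 + x.2 * y.1 + x.2 * y.2)
  else
    (x.1 * y.1 + x.2 * y.2 * D%:Z, x.1 * y.2 + x.2 * y.1).

Definition emb1 (D : nat) (x : OK) : Rdefinitions.R := x.1%:~R + x.2%:~R * omega D.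
Definition emb2 (D : nat) (x : OK) : Rdefinitions.R := x.1%:~R + x.2%:~R * omega' D.

Definition totpos (D : nat) (x : OK) : Prop := 0 < emb1 D x /\ 0 < emb2 D x.

Definition diag_form (D m : nat) (a x : 'I_m -> OK) : OK :=
  \big[okadd/ok0]_(i < m) okmul D (a i) (okmul D (x i) (x i)).

Definition diag_universal (D m : nat) (a : 'I_m -> OK) : Prop :=
  (forall i, totpos D (a i)) /\
  (forall alpha : OK, totpos D alpha ->
     exists x : 'I_m -> OK, alpha = diag_form D a x).

Definition has_diag_universal (D m : nat) : Prop :=
  exists a : 'I_m -> OK, diag_universal D a.

Definition is_mdiag (D m : nat) : Prop :=
  has_diag_universal D m /\ (forall m', has_diag_universal D m' -> (m <= m')%N).

Fixpoint cf_x (D : nat) (n : nat) : Rdefinitions.R :=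
  match n with
  | 0 => omega D
  | n'.+1 => (cf_x D n' - (Num.floor (cf_x D n'))%:~R)^-1
  end.
Definition cf_u (D : nat) (n : nat) : int := Num.floor (cf_x D n).

Definition is_period (D s : nat) : Prop :=
  (0 < s)%N /\ forall i, (1 <= i)%N -> cf_u D (i + s) = cf_u D i.
Definition is_min_period (D s : nat) : Prop :=
  is_period D s /\ forall t, is_period D t -> (s <= t)%N.

Definition M_gen (D s : nat) (P : int -> bool) : int :=
  if ~~ odd s then
    \sum_(1 <= i < s | odd i && P (cf_u D i)) cf_u D i
  else
    (if P (cf_u D 0) then 2 * cf_u D 0 else 0)
    + \sum_(1 <= i < s | P (cf_u D i)) cf_u D i.

Definition M_D (D s : nat) : int :=
  M_gen D s predT - (if odd s && D1mod4 D then 1 else 0).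

(** M*_{D,eps}: only coefficients u_i >= D^(1/8+eps) (the constant -1 is not
    a coefficient and is dropped). *)
Definition Mstar (D s : nat) (eps : Rdefinitions.R) : int :=
  M_gen D s (fun u => (D%:R : Rdefinitions.R) `^ (8^-1 + eps) <= u%:~R).

Definition kappa (s : nat) : nat := if odd s then 2 else 1.

(* Main.v *)
(** Let [v] have negative first and positive second embedding, and let [g] be
    totally positive with [wd g v = 1], where [wd x y] is the determinant of the
    coordinates of [x] and [y]. The form [wd _ v] is integral, additive and
    positive on totally positive elements, so every totally positive point [g +
    r v] of the strip of [v] is indecomposable: a universal diagonal form
    represents it by a single term [a x^2]. At most two points of a strip share
    the same coefficient [a], and the strip of the convergent [cc k.+1] ([k]
    odd) contains [u_k] points, so [u_k <= 2 m]; this is the first lower bound.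
    For the upper bound, the points of the strips with [k < 2 T] ([T] the even
    period) are consecutive unimodular vectors joining [1] to the totally
    positive unit [eta^2], so each totally positive element is, up to a squared
    unit, [e y + f y'] with [y], [y'] consecutive and [e], [f] natural numbers,
    which are sums of four squares.

For the second lower bound write each [cc k.+1] as [w z^2] with [w] square-free.
    The strip of [w] has length at least [u_k N(z)^2], and at most [4 tau(n)]
    classes of [z] have norm [n], so it suffices to bound the total length of
    the strips of pairwise non-associated square-free [w]. In a strip of length
    [U >= D^(1/8 + eps)], a sieve over the quadratic values [nm (g + r w)] shows
    that at least [U / 100] points are good: each square divisor [x^2] of them
    has [x] a unit or of prime norm [p] with [p > U / 100] and [p] prime to [N
    w]. If the coefficient representing a good point is not the point itself up
    to units, replace [(g + r w, w)] by [(g + r w) / pi] or [(g + r w) / pi^2]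
    or [pi' w], which lies on another strip and is square-free, hence is a
    coefficient up to a unit. The coefficient, the kind of replacement and the
    prime [p], one of at most seven large prime divisors of the norm of the
    coefficient, determine [w] and [r]; so there are at most [32 m] good points
    altogether. *)

Require Import Defs.
From HB Require Import structures.
From mathcomp Require Import all_boot all_order all_algebra.
From mathcomp Require Import all_classical all_reals all_analysis.
From mathcomp Require Import Rstruct ring lra zify.
Import Order.TTheory GRing.Theory Num.Theory.
Local Open Scope ring_scope.

Set Implicit Arguments. Unset Strict Implicit. Unset Printing Implicit Defensive.
Local Notation R := Rdefinitions.R.

(** * Counting lemmas *)

(** A choice of witnesses is an injection from X to Y. The relational form lets [P] carry
    existential data, such as an unspecified square factor, in the counts below. *)
Lemma card_inj_rel (A B : finType) (X : {set A}) (Y : {set B}) (P : A -> B -> Prop) :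
  (forall a, a \in X -> exists2 b, b \in Y & P a b) ->
  (forall a a' b, a \in X -> a' \in X -> P a b -> P a' b -> a = a') -> (#|X| <= #|Y|)%N.
Proof.
move=> ex inj; have [->|[a0 Xa0]] := set_0Vmem X; first by rewrite cards0.
have [b0 _ _] := ex _ Xa0.
have /choice [f fP] : forall a, exists b, a \in X -> b \in Y /\ P a b.
  by move=> a; case Xa : (a \in X); [case: (ex _ Xa) => b h1 h2; exists b | exists b0].
rewrite -(@card_in_imset _ _ f).
  by apply/subset_leq_card/fintype.subsetP => _ /imsetP[a Xa ->]; case: (fP a Xa).
move=> a a' Xa Xa' e; apply: (inj a a' (f a)) => //; first by case: (fP a Xa).
by rewrite e; case: (fP a' Xa').
Qed.

Lemma card_congr_set (U q : nat) (X : {set 'I_U}) : (0 < q)%N ->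
  (forall r t : 'I_U, r \in X -> t \in X -> (r %% q = t %% q)%N) -> (#|X| <= U %/ q + 1)%N.
Proof.
move=> q0 h; rewrite addn1 -[X in (_ <= X)%N]card_ord -cardsT.
apply: (card_inj_rel (P := fun (r : 'I_U) (b : 'I_(U %/ q).+1) => (r %/ q)%N = b)).
  move=> r _; have lt : (r %/ q < (U %/ q).+1)%N.
    by rewrite ltnS leq_div2r // ltnW.
  by exists (Ordinal lt); rewrite ?inE.
move=> r t b Xr Xt e1 e2; apply: val_inj => /=.
by rewrite (divn_eq r q) (divn_eq t q) e1 e2 (h r t).
Qed.

Lemma prod_primes_dvd (s : seq nat) (n : nat) : uniq s ->
  (forall p, p \in s -> prime p /\ (p %| n)%N) -> (\prod_(p <- s) p %| n)%N.
Proof.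
elim: s => [|p s IH] /=; first by rewrite big_nil dvd1n.
case/andP=> ps us h; rewrite big_cons.
have hs q : q \in s -> prime q /\ (q %| n)%N by move=> qs; apply: h; rewrite inE qs orbT.
have [pp pn] := h p (mem_head _ _).
rewrite Gauss_dvd; first by rewrite pn IH.
rewrite prime_coprime //; apply/negP.
elim: s ps us hs {IH h} => [|q s IH]; first by rewrite big_nil dvdn1 => *; move: pp; case: eqP => // ->.
rewrite inE negb_or big_cons Euclid_dvdM // /= => /andP[pq ps] /andP[_ us] hs /orP[|].
  have [pq' _] := hs q (mem_head _ _).
  by rewrite dvdn_prime2 // (negPf pq).
by apply: IH => // r rs; apply: hs; rewrite inE rs orbT.
Qed.

(** The prime divisors of n beyond the eighth root of W; with W = 4 D this is the threshold behind
    the exponent 1/8. *)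
Definition big_primes (W n : nat) := [seq p <- primes n | (W < p ^ 8)%N].

(** Eight such primes would have a product above W, yet their product divides n. *)
Lemma size_big_primes (W n : nat) : (0 < n <= W)%N -> (size (big_primes W n) < 8)%N.
Proof.
case/andP=> n0 nW; set s := big_primes W n.
have dv : (\prod_(p <- s) p %| n)%N.
  apply: prod_primes_dvd; first by rewrite filter_uniq // primes_uniq.
  by move=> p; rewrite mem_filter mem_primes => /andP[_ /and3P[]].
have le : (\prod_(p <- s) p <= n)%N by apply: dvdn_leq.
have ge : (W.+1 ^ size s <= (\prod_(p <- s) p) ^ 8)%N.
  have : all (fun p => W < p ^ 8)%N s by apply/allP => p; rewrite mem_filter => /andP[].
  elim: (s) => [|p t IH] /=; first by rewrite big_nil exp1n.
  by case/andP=> h1 /IH h2; rewrite big_cons expnMn expnS leq_mul.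
rewrite ltnNge; apply/negP => s8.
have : (W.+1 ^ 8 <= W ^ 8)%N.
  apply: leq_trans (_ : (W.+1 ^ size s <= _)%N); first by rewrite leq_pexp2l.
  by apply: leq_trans ge _; rewrite leq_exp2r // (leq_trans le).
by rewrite leq_exp2r // ltnn.
Qed.

Lemma mem_big_primes W n p : (0 < n)%N -> prime p -> (p %| n)%N -> (W < p ^ 8)%N ->
  p \in big_primes W n.
Proof. by move=> n0 pp pn Wp; rewrite mem_filter Wp mem_primes pp n0 pn. Qed.

(** * Divisor sums and sums of inverse squares *)

Lemma sum_dvd_multiples (V : nmodType) (g : nat -> V) (d X : nat) : (0 < d)%N ->
  \sum_(1 <= n < X.+1 | (d %| n)%N) g n = \sum_(1 <= k < (X %/ d).+1) g (d * k)%N.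
Proof.
move=> d0; elim: X => [|X IH]; first by rewrite div0n !big_geq.
rewrite big_mkcond big_nat_recr //= -big_mkcond /= IH divnS //.
case: (boolP (d %| X.+1)%N) => dX; last by rewrite addr0 add0n.
rewrite add1n [RHS]big_nat_recr //=; congr (_ + g _).
by rewrite -[LHS](divnK dX) divnS // dX mulnC.
Qed.

Lemma size_divisors_sum (n X : nat) : (0 < n <= X)%N ->
  size (divisors n) = (\sum_(1 <= d < X.+1) (d %| n))%N.
Proof.
case/andP=> n0 nX.
transitivity (\sum_(1 <= d < X.+1 | (d %| n)%N) 1)%N; last first.
  by rewrite big_mkcond; apply: eq_bigr => d _; case: (_ %| _)%N.
rewrite sum1_count -size_filter; apply/perm_size/uniq_perm.
- exact: divisors_uniq.
- by rewrite filter_uniq // iota_uniq.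
move=> d; rewrite -dvdn_divisors // mem_filter mem_index_iota ltnS.
case dn : (d %| n)%N => //=; rewrite (dvdn_gt0 n0 dn) /=.
by apply/esym; apply: leq_trans nX; apply: dvdn_leq.
Qed.

(** Each dyadic block from 2^k to 2^(k+1) has 2^k terms, none above Y / 2^k, so it contributes at
    most Y. *)
Lemma sum_divn_le (Y k : nat) : (\sum_(1 <= d < 2 ^ k) (Y %/ d) <= k * Y)%N.
Proof.
elim: k => [|k IH]; first by rewrite big_geq.
rewrite (big_cat_nat (n := 2 ^ k)) ?expn_gt0 ?leq_exp2l //= mulSn addnC leq_add //.
apply: leq_trans (_ : (\sum_(2 ^ k <= d < 2 ^ k.+1) (Y %/ 2 ^ k) <= _)%N).
  rewrite big_nat [X in (_ <= X)%N]big_nat; apply: leq_sum => d /andP[h _].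
  by rewrite leq_div2l // expn_gt0.
rewrite sum_nat_const_nat expnS mul2n -addnn addnK mulnC leq_trunc_div //.
Qed.

Lemma sum_size_divisors (Y : nat) :
  (\sum_(1 <= n < Y.+1) size (divisors n) <= Y * (trunc_log 2 Y).+1)%N.
Proof.
rewrite big_nat (eq_bigr (fun n => \sum_(1 <= d < Y.+1) (d %| n))%N); last first.
  by move=> n /andP[n0 nY]; apply: size_divisors_sum; rewrite n0.
rewrite -big_nat exchange_big_nat /=.
rewrite big_nat (eq_bigr (fun d => Y %/ d)%N); last first.
  move=> d /andP[d0 _]; rewrite -big_mkcond /=.
  have := @sum_dvd_multiples nat (fun=> 1%N) d Y d0; rewrite /GRing.add /= => ->.
  by rewrite sum_nat_const_nat subn1 muln1.
rewrite -big_nat mulnC; apply: leq_trans (sum_divn_le Y (trunc_log 2 Y).+1).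
have lt : (Y.+1 <= 2 ^ (trunc_log 2 Y).+1)%N by apply: trunc_log_ltn.
by rewrite [X in (_ <= X)%N](big_cat_nat (n := Y.+1)) //= leq_addr.
Qed.

Section Field.
Variable F : realFieldType.

Lemma sum_inv_sqr_le (X : nat) : \sum_(1 <= k < X.+1) (k%:R ^+ 2)^-1 <= 2 :> F.
Proof.
(* The strengthened bound telescopes: 1/(a+1)^2 is less than 1/a - 1/(a+1). *)
have h Y : \sum_(1 <= k < Y.+2) (k%:R ^+ 2)^-1 <= 2 - (Y.+1%:R)^-1 :> F.
  elim: Y => [|Y IH]; first by rewrite big_nat1 expr1n invr1; lra.
  rewrite big_nat_recr //=; have a0 : 0 < Y.+1%:R :> F by [].
  have -> : Y.+2%:R = Y.+1%:R + 1 :> F by rewrite -natr1.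
  move: IH; move: (\sum_(_ <= _ < _) _) (Y.+1%:R) a0 => S a a0 IH.
  apply: (@le_trans _ _ (2 - a^-1 + ((a + 1) ^+ 2)^-1)); first by rewrite lerD2r.
  rewrite -subr_ge0.
  have -> : 2 - (a + 1)^-1 - (2 - a^-1 + ((a + 1) ^+ 2)^-1) = (a * (a + 1) ^+ 2)^-1.
    by field; rewrite !gt_eqF // addr_gt0.
  by rewrite invr_ge0 mulr_ge0 ?sqr_ge0 // ltW.
case: X => [|X]; first by rewrite big_geq.
by apply: le_trans (h X) _; rewrite gerDl oppr_le0 invr_ge0.
Qed.

(** Writing n = d k bounds the sum by the square of the sum of 1/k^2, and that sum is at most 2. *)
Lemma sum_divisors_inv_sqr (X : nat) :
  \sum_(1 <= n < X.+1) (size (divisors n))%:R / n%:R ^+ 2 <= 4 :> F.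
Proof.
have -> : \sum_(1 <= n < X.+1) (size (divisors n))%:R / n%:R ^+ 2 =
    \sum_(1 <= d < X.+1) \sum_(1 <= n < X.+1 | (d %| n)%N) (n%:R ^+ 2)^-1 :> F.
  transitivity (\sum_(1 <= n < X.+1) \sum_(1 <= d < X.+1) (d %| n)%:R / n%:R ^+ 2 : F).
    rewrite big_nat [RHS]big_nat; apply: eq_bigr => n /andP[n0 nX].
    by rewrite (@size_divisors_sum n X) ?n0 // natr_sum mulr_suml.
  rewrite exchange_big_nat /=; apply: eq_bigr => d _.
  rewrite [RHS]big_mkcond /=; apply: eq_bigr => n _.
  by case: (_ %| _)%N; rewrite ?mul1r ?mul0r.
set S : F := \sum_(1 <= k < X.+1) (k%:R ^+ 2)^-1.
have S2 : S <= 2 := sum_inv_sqr_le X.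
have S0 : 0 <= S by apply: sumr_ge0 => k _; rewrite invr_ge0 sqr_ge0.
apply: (@le_trans _ _ (\sum_(1 <= d < X.+1) (d%:R ^+ 2)^-1 * S)).
  rewrite big_nat [X in _ <= X]big_nat; apply: ler_sum => d /andP[d0 dX].
  rewrite sum_dvd_multiples // mulr_sumr.
  have le : (X %/ d < X.+1)%N by rewrite ltnS leq_div.
  rewrite [X in _ <= X](big_cat_nat (n := (X %/ d).+1)) //=.
  apply: (@le_trans _ _ (\sum_(1 <= k < (X %/ d).+1) (d%:R ^+ 2)^-1 * (k%:R ^+ 2)^-1 : F)).
    by apply: ler_sum => k _; rewrite natrM exprMn invfM.
  rewrite lerDl; apply: sumr_ge0 => k _; by rewrite mulr_ge0 // invr_ge0 sqr_ge0.
rewrite -mulr_suml -/S; nra.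
Qed.

Lemma sum_odd_inv_sqr (K : nat) :
  \sum_(1 <= k < K.+1) ((2 * k + 1)%:R ^+ 2)^-1 <= 17 / 72 :> F.
Proof.
(* Equality holds for the first term, 1/9 = 17/72 - 1/8, and 1/(2a+1)^2 is below 1/(4a) -
   1/(4(a+1)). *)
have h Y : \sum_(1 <= k < Y.+2) ((2 * k + 1)%:R ^+ 2)^-1 <= 17 / 72 - (4 * Y.+2%:R)^-1 :> F.
  elim: Y => [|Y IH].
    rewrite big_nat1 -natrX -natrM (_ : ((2 * 1 + 1) ^ 2 = 9)%N) // (_ : (4 * 2 = 8)%N) //; lra.
  rewrite big_nat_recr //=; have a0 : 0 < Y.+2%:R :> F by [].
  have -> : Y.+3%:R = Y.+2%:R + 1 :> F by rewrite -natr1.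
  have -> : (2 * Y.+2 + 1)%:R = 2 * Y.+2%:R + 1 :> F by rewrite natrD natrM.
  move: IH; move: (\sum_(_ <= _ < _) _) (Y.+2%:R) a0 => S a a0 IH.
  apply: (@le_trans _ _ (17 / 72 - (4 * a)^-1 + ((2 * a + 1) ^+ 2)^-1)); first by rewrite lerD2r.
  rewrite -subr_ge0.
  have p : 0 < 2 * a + 1 by lra.
  have -> : 17 / 72 - (4 * (a + 1))^-1 - (17 / 72 - (4 * a)^-1 + ((2 * a + 1) ^+ 2)^-1) =
     (4 * a * (a + 1) * (2 * a + 1) ^+ 2)^-1.
    by field; rewrite !gt_eqF // ?addr_gt0 //.
  by rewrite invr_ge0 !mulr_ge0 ?sqr_ge0 //; lra.
case: K => [|K]; first by rewrite big_geq // divr_ge0.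
by apply: le_trans (h K) _; rewrite gerDl oppr_le0 invr_ge0 mulr_ge0.
Qed.
End Field.

(** * Sums of four squares *)

Definition sum4 (n : int) := exists a b c d : int, n = a ^+ 2 + b ^+ 2 + c ^+ 2 + d ^+ 2.

Lemma sum4M m n : sum4 m -> sum4 n -> sum4 (m * n).
Proof.
move=> [a [b [c [d ->]]]] [e [f [g [h ->]]]].
exists (a * e + b * f + c * g + d * h), (a * f - b * e + c * h - d * g),
  (a * g - b * h - c * e + d * f), (a * h + b * g - c * f - d * e); ring.
Qed.

(** Pigeonhole in the field with p elements: for x, y at most (p-1)/2, the (p+1)/2 squares x^2 and
    the (p+1)/2 values -1 - y^2 cannot be disjoint. *)
Lemma prime_dvd_sum2 p : prime p -> odd p ->
  exists x y, (p %| x ^ 2 + y ^ 2 + 1)%N /\ (x ^ 2 + y ^ 2 + 1 < p * p)%N.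
Proof.
move=> pp op; set h := (p./2).
have ph : p = (h.*2 + 1)%N by rewrite /h -[LHS]odd_double_half op addnC.
have p2 := prime_gt1 pp.
pose sq (x : 'I_h.+1) : 'F_p := (x : nat)%:R ^+ 2.
have zeroE (n : nat) : (n%:R == 0 :> 'F_p) = (p %| n)%N.
  by rewrite -(dvdn_pcharf (pchar_Fp pp)).
have sq_inj : injective sq.
  move=> x y /eqP; rewrite /sq -subr_eq0 subr_sqr mulf_eq0 => /orP[].
    have [xy|xy] := leqP y x.
      rewrite -natrB // zeroE => /dvdnP[k e]; apply: val_inj => /=.
      have := ltn_ord x; have := ltn_ord y; case: k e => [|k] e; lia.
    rewrite -opprB oppr_eq0 -natrB ?(ltnW xy) // zeroE => /dvdnP[k e]; apply: val_inj => /=.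
    have := ltn_ord x; have := ltn_ord y; case: k e => [|k] e; lia.
  rewrite -natrD zeroE => /dvdnP[k e]; apply: val_inj => /=.
  have := ltn_ord x; have := ltn_ord y; case: k e => [|k] e; lia.
pose S1 := [set sq x | x : 'I_h.+1]; pose S2 := [set - 1 - sq x | x : 'I_h.+1].
have c1 : #|S1| = h.+1 by rewrite card_imset // card_ord.
have c2 : #|S2| = h.+1.
  by rewrite card_imset ?card_ord // => x y /addrI /oppr_inj; exact: sq_inj.
have [z] : exists z, z \in S1 :&: S2.
  apply/set0Pn; rewrite -cards_eq0 -lt0n.
  have := cardsUI S1 S2; rewrite c1 c2 => e.
  have : (#|S1 :|: S2| <= p)%N by rewrite -[X in (_ <= X)%N](card_Fp pp) max_card.
  lia.
rewrite inE => /andP[/imsetP[x _ ->] /imsetP[y _]] /eqP.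
move=> /eqP e.
exists (x : nat), (y : nat); split.
  by rewrite -zeroE !natrD !natrX -[x%:R ^+ 2]/(sq x) e /sq; apply/eqP; ring.
have := ltn_ord x; have := ltn_ord y; rewrite ph; nia.
Qed.

Lemma centered_residue (a : int) (m : nat) : (0 < m)%N ->
  exists k a' : int, [/\ a = a' + m%:Z * k, - m%:Z < 2 * a' & 2 * a' <= m%:Z].
Proof.
move=> m0; have mz : m%:Z != 0 by lia.
have e := divz_eq a m; have r0 := modz_ge0 a mz.
have r1 : (a %% m)%Z < m by rewrite ltz_pmod.
have [h|h] := leP (2 * (a %% m)%Z) m%:Z.
  exists (a %/ m)%Z, (a %% m)%Z; split => //; [by rewrite {1}e; ring | lia].
exists ((a %/ m)%Z + 1), ((a %% m)%Z - m%:Z); split; [by rewrite {1}e; ring | lia | lia].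
Qed.

Lemma sqr_half_le (m z : int) : - m < 2 * z -> 2 * z <= m ->
  4 * z ^+ 2 <= m ^+ 2 /\ (4 * z ^+ 2 = m ^+ 2 -> 2 * z = m).
Proof.
move=> h1 h2; have e : m ^+ 2 - 4 * z ^+ 2 = (m - 2 * z) * (m + 2 * z) by ring.
split; first by rewrite -subr_ge0 e mulr_ge0 //; lia.
by move=> e'; move: e; rewrite e' subrr => /esym/eqP; rewrite mulf_eq0 => /orP[] /eqP; lia.
Qed.

(** Euler's descent: the centered residues modulo m have squares summing to m K; multiplying both
    sums by Euler's identity and dividing by m^2 gives a representation of K p. *)
Lemma sum4_descent (p m : nat) : prime p -> (1 < m < p)%N -> sum4 (m%:Z * p%:Z) ->
  exists2 r : nat, (0 < r < m)%N & sum4 (r%:Z * p%:Z).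
Proof.
move=> pp /andP[m1 mp] [a [b [c [d e]]]].
have m0 : (0 < m)%N by lia.
have [ka [a' [ea a1 a2]]] := centered_residue a m0.
have [kb [b' [eb b1 b2]]] := centered_residue b m0.
have [kc [c' [ec c1 c2]]] := centered_residue c m0.
have [kd [d' [ed d1 d2]]] := centered_residue d m0.
pose K := p%:Z - 2 * (a' * ka + b' * kb + c' * kc + d' * kd)
   - m%:Z * (ka ^+ 2 + kb ^+ 2 + kc ^+ 2 + kd ^+ 2).
have sr : a' ^+ 2 + b' ^+ 2 + c' ^+ 2 + d' ^+ 2 = m%:Z * K.
  have : m%:Z * K = m%:Z * p%:Z - m%:Z * (2 * (a' * ka + b' * kb + c' * kc + d' * kd)
   + m%:Z * (ka ^+ 2 + kb ^+ 2 + kc ^+ 2 + kd ^+ 2)) by rewrite /K; ring.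
  by rewrite e ea eb ec ed => ->; ring.
have nodiv : ~~ (m %| p)%N.
  by apply/negP => /(prime_nt_dvdP pp) h; move: mp; rewrite h ?ltnn // gtn_eqF.
have K0 : 0 <= K.
  have : 0 <= m%:Z * K by rewrite -sr !addr_ge0 ?sqr_ge0.
  by rewrite pmulr_rge0; lia.
have [sa ta] := sqr_half_le a1 a2; have [sb tb] := sqr_half_le b1 b2.
have [sc tc] := sqr_half_le c1 c2; have [sd td] := sqr_half_le d1 d2.
have mz0 : 0 < m%:Z by lia.
have Km : K <= m%:Z.
  rewrite -(ler_pM2l mz0) -sr -expr2; clear -sa sb sc sd.
  by move: (a' ^+ 2) (b' ^+ 2) (c' ^+ 2) (d' ^+ 2) (m%:Z ^+ 2) sa sb sc sd => *; lia.
(* K = 0 would make m divide all four numbers, hence p. *)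
have Kn0 : K <> 0.
  move=> Kz; move: sr; rewrite Kz mulr0 => sr.
  have z0 (z : int) : 0 <= z ^+ 2 by rewrite sqr_ge0.
  have := z0 a'; have := z0 b'; have := z0 c'; have := z0 d' => hd hc hb ha.
  have /eqP : a' ^+ 2 = 0 by move: sr ha hb hc hd; clear; lra.
  have /eqP : b' ^+ 2 = 0 by move: sr ha hb hc hd; clear; lra.
  have /eqP : c' ^+ 2 = 0 by move: sr ha hb hc hd; clear; lra.
  have /eqP : d' ^+ 2 = 0 by move: sr ha hb hc hd; clear; lra.
  rewrite !sqrf_eq0 => /eqP da /eqP ca /eqP ba /eqP aa; case/negP: nodiv.
  have : p%:Z = m%:Z * (ka ^+ 2 + kb ^+ 2 + kc ^+ 2 + kd ^+ 2).
    by rewrite -[LHS]subr0 -Kz /K aa ba ca da; ring.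
  move=> ep; have : (m%:Z %| p%:Z)%Z by rewrite ep dvdz_mulr.
  by rewrite dvdzE.
(* K = m is the extremal case in which every residue equals m / 2, and again m divides p. *)
have Knm : K <> m%:Z.
  move=> Kz; rewrite Kz in sr.
  rewrite -expr2 in sr.
  have {}ta : 2 * a' = m%:Z.
    apply: ta; move: sr sa sb sc sd; clear; move: (a' ^+ 2) (b' ^+ 2) (c' ^+ 2) (d' ^+ 2) (m%:Z ^+ 2) => *; lia.
  have {}tb : 2 * b' = m%:Z.
    apply: tb; move: sr sa sb sc sd; clear; move: (a' ^+ 2) (b' ^+ 2) (c' ^+ 2) (d' ^+ 2) (m%:Z ^+ 2) => *; lia.
  have {}tc : 2 * c' = m%:Z.
    apply: tc; move: sr sa sb sc sd; clear; move: (a' ^+ 2) (b' ^+ 2) (c' ^+ 2) (d' ^+ 2) (m%:Z ^+ 2) => *; lia.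
  have {}td : 2 * d' = m%:Z.
    apply: td; move: sr sa sb sc sd; clear; move: (a' ^+ 2) (b' ^+ 2) (c' ^+ 2) (d' ^+ 2) (m%:Z ^+ 2) => *; lia.
  case/negP: nodiv.
  have ep : p%:Z = m%:Z * (1 + (ka + kb + kc + kd) + (ka ^+ 2 + kb ^+ 2 + kc ^+ 2 + kd ^+ 2)).
    transitivity (2 * a' * ka + 2 * b' * kb + 2 * c' * kc + 2 * d' * kd
      + m%:Z * (ka ^+ 2 + kb ^+ 2 + kc ^+ 2 + kd ^+ 2) + K); first by rewrite /K; ring.
    by rewrite Kz ta tb tc td; ring.
  have : (m%:Z %| p%:Z)%Z by rewrite ep dvdz_mulr.
  by rewrite dvdzE.
exists `|K|%N.
  by move: (K) K0 Km Kn0 Knm => k; clear; lia.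
have -> : `|K|%N%:Z = K by rewrite gez0_abs.
pose w1 := K + (ka * a' + kb * b' + kc * c' + kd * d').
pose w2 := ka * b' - kb * a' + kc * d' - kd * c'.
pose w3 := ka * c' - kb * d' - kc * a' + kd * b'.
pose w4 := ka * d' + kb * c' - kc * b' - kd * a'.
exists w1, w2, w3, w4.
have mz : m%:Z ^+ 2 != 0 by rewrite expf_neq0 //; lia.
apply: (mulfI mz).
have h1 : a * a' + b * b' + c * c' + d * d' = m%:Z * w1.
  by rewrite /w1 mulrDr -sr ea eb ec ed; ring.
have h2 : a * b' - b * a' + c * d' - d * c' = m%:Z * w2 by rewrite /w2 ea eb ec ed; ring.
have h3 : a * c' - b * d' - c * a' + d * b' = m%:Z * w3 by rewrite /w3 ea eb ec ed; ring.
have h4 : a * d' + b * c' - c * b' - d * a' = m%:Z * w4 by rewrite /w4 ea eb ec ed; ring.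
transitivity ((m%:Z * p%:Z) * (m%:Z * K)); first by ring.
rewrite e -sr.
transitivity ((m%:Z * w1) ^+ 2 + (m%:Z * w2) ^+ 2 + (m%:Z * w3) ^+ 2 + (m%:Z * w4) ^+ 2); last by ring.
by rewrite -h1 -h2 -h3 -h4; ring.
Qed.

Lemma sum4_prime p : prime p -> sum4 p.
Proof.
move=> pp; have [op|ep] := boolP (odd p); last first.
  by case/even_prime: pp ep => [->|->//] _; exists 1, 1, 0, 0.
have [x [y [/dvdnP[m em] lt]]] := prime_dvd_sum2 pp op.
have p0 := prime_gt0 pp.
have : sum4 (m%:Z * p%:Z) by exists x, y, 1, 0; lia.
have mp : (0 < m < p)%N.
  rewrite -[(m < p)%N](ltn_pmul2r p0) -em lt andbT; case: m em {lt} => // e.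
  by move: e; rewrite mul0n addn1.
elim/ltn_ind: m mp {em} => m IH mp s4.
have [m1|m1] := eqVneq m 1%N; first by move: s4; rewrite m1 mul1r.
have [|r r1 s4r] := sum4_descent (m := m) pp _ s4; first lia.
by apply: (IH r) => //; lia.
Qed.

Theorem lagrange_sum4 (n : nat) : sum4 n.
Proof.
elim/ltn_ind: n => n IH.
have [n1|n1] := leqP n 1.
  by exists n, 0, 0, 0; case: n n1 {IH} => [|[|]].
have pp := pdiv_prime n1; have /dvdnP[k e] := pdiv_dvd n.
rewrite {1}e PoszM; apply: sum4M; last exact: sum4_prime.
apply: IH; have := prime_gt1 pp; nia.
Qed.

(** * The ring of integers *)

(** Here omega^2 = qt omega + qn, so [qt] is the trace of omega and [qn] is minus its norm. *)
Definition qt (D : nat) : int := if D1mod4 D then 1 else 0.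
Definition qn (D : nat) : int := if D1mod4 D then ((D - 1) %/ 4)%N%:Z else D%:Z.
Definition disc (D : nat) : int := qt D ^+ 2 + 4 * qn D.

Lemma okmulE D (x y : OK) :
  okmul D x y = (x.1 * y.1 + qn D * (x.2 * y.2), x.1 * y.2 + x.2 * y.1 + qt D * (x.2 * y.2)).
Proof. by rewrite /okmul /qn /qt; case: ifP => _ /=; congr pair; ring. Qed.

(** The synonym carries D, so that the ring structure placed on it may depend on D. *)
Definition QI (D : nat) : Type := OK.

Section Ring.
Variable D : nat.
HB.instance Definition _ := GRing.Zmodule.copy (QI D) (int * int)%type.

Let mulA : associative (okmul D : QI D -> QI D -> QI D).
Proof. by move=> [a b] [c d] [e f]; rewrite !okmulE /=; congr pair; ring. Qed.
Let mulC : commutative (okmul D : QI D -> QI D -> QI D).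
Proof. by move=> [a b] [c d]; rewrite !okmulE /=; congr pair; ring. Qed.
Let mul1 : left_id ((1, 0) : QI D) (okmul D).
Proof. by move=> [a b]; rewrite !okmulE /=; congr pair; ring. Qed.
Let mulD : left_distributive (okmul D : QI D -> QI D -> QI D) +%R.
Proof. by move=> [a b] [c d] [e f]; rewrite !okmulE /=; congr pair => /=; ring. Qed.
Let one_neq0 : ((1, 0) : QI D) != 0. Proof. by []. Qed.
HB.instance Definition _ :=
  GRing.Zmodule_isComNzRing.Build (QI D) mulA mulC mul1 mulD one_neq0.

Implicit Types (x y z a b : QI D).

Lemma qmulE x y :
  x * y = (x.1 * y.1 + qn D * (x.2 * y.2), x.1 * y.2 + x.2 * y.1 + qt D * (x.2 * y.2)).
Proof. exact: okmulE. Qed.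
Lemma qaddE x y : x + y = (x.1 + y.1, x.2 + y.2). Proof. by []. Qed.
Lemma qoppE x : - x = (- x.1, - x.2). Proof. by []. Qed.
Lemma qintE (m : int) : m%:~R = (m, 0) :> QI D.
Proof.
have natE (n : nat) : n%:R = (n%:Z, 0) :> QI D.
  by elim: n => // n IH; rewrite -addn1 natrD IH qaddE /= PoszD; congr pair.
by case: m => n; rewrite ?NegzE ?mulrNz -pmulrn natE // qoppE.
Qed.

Definition om : QI D := (0, 1).
Definition conj x : QI D := (x.1 + qt D * x.2, - x.2).
Definition nm x : int := x.1 ^+ 2 + qt D * x.1 * x.2 - qn D * x.2 ^+ 2.
Definition tr x : int := 2 * x.1 + qt D * x.2.
Definition wd x y : int := x.2 * y.1 - x.1 * y.2.

Let E := (qmulE, qaddE, qoppE, qintE).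

Lemma conjK : involutive conj.
Proof. by case=> a b; rewrite /conj /=; congr pair; ring. Qed.
Lemma conjM x y : conj (x * y) = conj x * conj y.
Proof. by case: x y => a b [c d]; rewrite !E /conj /=; congr pair; ring. Qed.
Lemma conjN x : conj (- x) = - conj x.
Proof. by case: x => a b; rewrite !E /conj /=; congr pair; ring. Qed.
Lemma conj_int (m : int) : conj m%:~R = m%:~R.
Proof. by rewrite !E /conj /=; congr pair; ring. Qed.
Lemma mul_conj x : x * conj x = (nm x)%:~R.
Proof. by case: x => a b; rewrite !E /conj /nm /=; congr pair; ring. Qed.
Lemma nmM x y : nm (x * y) = nm x * nm y.
Proof. by case: x y => a b [c d]; rewrite !E /nm /=; ring. Qed.
Lemma nmX x n : nm (x ^+ n) = nm x ^+ n.
Proof. by elim: n => [|n IH]; rewrite ?exprS ?nmM ?IH // /nm /=; ring. Qed.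
Lemma nmN x : nm (- x) = nm x.
Proof. by case: x => a b; rewrite !E /nm /=; ring. Qed.
Lemma nm_conj x : nm (conj x) = nm x.
Proof. by case: x => a b; rewrite /conj /nm /=; ring. Qed.
Lemma nm_int (m : int) : nm m%:~R = m ^+ 2.
Proof. by rewrite !E /nm /=; ring. Qed.
Lemma nm1 : nm 1 = 1. Proof. by rewrite -[1]/(1%:~R) nm_int. Qed.
Lemma wdC x y : wd x y = - wd y x. Proof. by rewrite /wd; ring. Qed.
Lemma wdxx x : wd x x = 0. Proof. by rewrite /wd; ring. Qed.
Lemma wdDl x y z : wd (x + y) z = wd x z + wd y z. Proof. by rewrite /wd /=; ring. Qed.
Lemma wdDr x y z : wd x (y + z) = wd x y + wd x z. Proof. by rewrite /wd /=; ring. Qed.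
Lemma wdNl x y : wd (- x) y = - wd x y. Proof. by rewrite /wd /=; ring. Qed.
Lemma wdNr x y : wd x (- y) = - wd x y. Proof. by rewrite /wd /=; ring. Qed.
Lemma wd0l x : wd 0 x = 0. Proof. by rewrite /wd /=; ring. Qed.
Lemma wdZl (m : int) x y : wd (m%:~R * x) y = m * wd x y.
Proof. by case: x y => a b [c d]; rewrite !E /wd /=; ring. Qed.
Lemma wdZr (m : int) x y : wd x (m%:~R * y) = m * wd x y.
Proof. by case: x y => a b [c d]; rewrite !E /wd /=; ring. Qed.
(** Multiplication by a and by its conjugate are adjoint for [wd]; this is what moves factors
    between a point and the direction of its strip. *)
Lemma wd_adj a x y : wd (a * x) y = wd x (conj a * y).
Proof. by case: a x y => e f [a b] [c d]; rewrite !E /conj /wd /=; ring. Qed.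
Lemma wdM a x y : wd (a * x) (a * y) = nm a * wd x y.
Proof. by case: a x y => e f [a b] [c d]; rewrite !E /nm /wd /=; ring. Qed.
(** For t = x y' this is Tr(t)^2 = (t - t')^2 + 4 N(t), as t - t' is [wd x y] times the square root
    of the discriminant. *)
Lemma tr_disc x y : tr (x * conj y) ^+ 2 = disc D * wd x y ^+ 2 + 4 * (nm x * nm y).
Proof. by case: x y => a b [c d]; rewrite !E /conj /nm /wd /tr /disc /=; ring. Qed.
Lemma wd_sqr x y : wd (x ^+ 2) (y ^+ 2) = wd x y * tr (x * conj y).
Proof. by case: x y => a b [c d]; rewrite !expr2 !E /conj /wd /tr /=; ring. Qed.
Lemma plucker x y z : x * (wd y z)%:~R + y * (wd z x)%:~R + z * (wd x y)%:~R = 0.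
Proof. by case: x y z => a b [c d] [e f]; rewrite !E /wd /=; congr pair; ring. Qed.
Lemma nmD x y : nm (x + y) = nm x + tr (x * conj y) + nm y.
Proof. by case: x y => a b [c d]; rewrite !E /conj /nm /tr /=; ring. Qed.
Lemma trZr x y (m : int) : tr (x * conj (m%:~R * y)) = m * tr (x * conj y).
Proof. by case: x y => a b [c d]; rewrite !E /conj /tr /=; ring. Qed.
Lemma nmZ (m : int) x : nm (m%:~R * x) = m ^+ 2 * nm x.
Proof. by rewrite nmM nm_int. Qed.

Lemma basis_exp w y x : wd w y = 1 -> x = w * (wd x y)%:~R + y * (wd w x)%:~R.
Proof.
move=> h; have := plucker w y x; rewrite h mulr1 [wd x w]wdC [wd y x]wdC !mulrNz.
by move=> e; rewrite -[RHS]addr0 -e; ring.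
Qed.

(** * Divisibility, associates and primitive elements *)

Definition qdvd a x := exists h, x = a * h.
Definition qunit x := `|nm x|%N = 1%N.
Definition assoc x y := exists2 h, qunit h & x = h * y.
Definition prim x := exists y, wd y x = 1.

Lemma qdvdxx a : qdvd a a. Proof. by exists 1; rewrite mulr1. Qed.
Lemma qdvdMr a x y : qdvd a x -> qdvd a (x * y).
Proof. by case=> h ->; exists (h * y); rewrite mulrA. Qed.
Lemma qdvdMl a x y : qdvd a x -> qdvd a (y * x).
Proof. by rewrite mulrC; apply: qdvdMr. Qed.
Lemma qdvdD a x y : qdvd a x -> qdvd a y -> qdvd a (x + y).
Proof. by case=> h -> [k ->]; exists (h + k); rewrite mulrDr. Qed.
Lemma qdvdN a x : qdvd a x -> qdvd a (- x).
Proof. by case=> h ->; exists (- h); rewrite mulrN. Qed.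
Lemma qdvdB a x y : qdvd a x -> qdvd a y -> qdvd a (x - y).
Proof. by move=> h k; apply: qdvdD => //; apply: qdvdN. Qed.
Lemma qdvd_trans a b x : qdvd a b -> qdvd b x -> qdvd a x.
Proof. by case=> h -> [k ->]; exists (h * k); rewrite mulrA. Qed.
Lemma qdvd_nm a : qdvd a (nm a)%:~R.
Proof. by exists (conj a); rewrite mul_conj. Qed.
Lemma qdvd_int a (m : int) : (nm a %| m)%Z -> qdvd a m%:~R.
Proof.
by case/dvdzP=> k ->; rewrite intrM; apply: qdvdMl; apply: qdvd_nm.
Qed.
Lemma qdvd_dvdnm a x : qdvd a x -> (nm a %| nm x)%Z.
Proof. by case=> h ->; rewrite nmM dvdz_mulr. Qed.

(* A primitive multiple y of a identifies O/(a) with Z/(nm a) through x |-> wd x y. *)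
Lemma qdvd_wd a x y : prim y -> qdvd a y -> qdvd a x <-> (nm a %| wd x y)%Z.
Proof.
move=> [w hw] ay; split=> [[h ->]|].
  by case: ay => k ->; rewrite wdM dvdz_mulr.
move=> d; rewrite (basis_exp x hw); apply: qdvdD; last exact: qdvdMr.
by apply: qdvdMl; apply: qdvd_int.
Qed.

Lemma assoc_refl x : assoc x x.
Proof. by exists 1; rewrite ?mul1r // /qunit nm1. Qed.
Lemma qunit_conj x : qunit x -> qunit (conj x).
Proof. by rewrite /qunit nm_conj. Qed.
Lemma qunitM x y : qunit x -> qunit y -> qunit (x * y).
Proof. by rewrite /qunit nmM abszM => -> ->. Qed.
Lemma qunitMl x y : qunit (x * y) -> qunit x.
Proof. by rewrite /qunit nmM abszM => /eqP; rewrite muln_eq1 => /andP[/eqP]. Qed.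
Lemma qunit_inv x : qunit x -> exists2 y, qunit y & y * x = 1.
Proof.
move=> u; exists ((nm x)%:~R * conj x).
  by apply: qunitM; [rewrite /qunit nm_int abszX u | apply: qunit_conj].
rewrite -mulrA [conj x * x]mulrC mul_conj -intrM.
by move: u; rewrite /qunit; case: (nm x) => n /=; [move=> -> | case=> ->].
Qed.
Lemma assoc_sym x y : assoc x y -> assoc y x.
Proof.
case=> h /qunit_inv [k uk e] ->; exists k => //.
by rewrite mulrA e mul1r.
Qed.
Lemma assoc_trans x y z : assoc x y -> assoc y z -> assoc x z.
Proof. by case=> h uh -> [k uk ->]; exists (h * k); [apply: qunitM | rewrite mulrA]. Qed.
Lemma assocM x y x' y' : assoc x x' -> assoc y y' -> assoc (x * y) (x' * y').
Proof.
case=> h uh -> [k uk ->]; exists (h * k); first exact: qunitM.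
by rewrite mulrACA.
Qed.
Lemma assoc_conj x y : assoc x y -> assoc (conj x) (conj y).
Proof. by case=> h uh ->; exists (conj h); [apply: qunit_conj | rewrite conjM]. Qed.
Lemma assoc_nm x y : assoc x y -> `|nm x|%N = `|nm y|%N.
Proof. by case=> h uh ->; rewrite nmM abszM uh mul1n. Qed.
Lemma assoc_dvd x y : assoc x y -> qdvd y x.
Proof. by case=> h _ ->; exists h; rewrite mulrC. Qed.

Lemma assoc_of_dvd a b : nm b != 0 -> qdvd a b -> `|nm a|%N = `|nm b|%N -> assoc a b.
Proof.
move=> nz [h e] n; apply: assoc_sym; exists h; last by rewrite e mulrC.
move: n nz; rewrite /qunit e nmM abszM => /eqP; rewrite -{1}[`|nm a|%N]muln1.
rewrite eqn_mul2l absz_eq0 => /orP[/eqP-> | /eqP<-//]; by rewrite mul0r.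
Qed.

(** By [qdvd_wd], divisibility by a divisor of y is seen by its norm alone, so a divides b. A
    primitive y thus has, up to units, at most one divisor of each absolute norm. *)
Lemma div_same_nm y a b : prim y -> qdvd a y -> qdvd b y -> nm b != 0 ->
  `|nm a|%N = `|nm b|%N -> assoc a b.
Proof.
move=> py ay bY nz n; apply: assoc_of_dvd => //.
apply/(qdvd_wd b py ay); rewrite dvdzE n.
by have /(qdvd_wd b py bY) := qdvdxx b; rewrite dvdzE.
Qed.

Lemma prim_dvd a x : prim x -> qdvd a x -> prim a.
Proof. by case=> y h [k e]; exists (conj k * y); rewrite wd_adj conjK mulrC -e. Qed.

(** In a Bezout relation between N(z)^2 and N(y), multiplied by x, both terms are divisible by
    z^2. *)
Lemma sqr_gauss z x y : coprimez (nm z) (nm y) -> qdvd (z ^+ 2) (x * y) -> qdvd (z ^+ 2) x.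
Proof.
move=> cop h.
have c2 : coprimez (nm z ^+ 2) (nm y) by rewrite coprimezXl.
have [k [l e]] := Bezoutz (nm z ^+ 2) (nm y).
have {}e : k * nm z ^+ 2 + l * nm y = 1 by rewrite e; apply/eqP.
have -> : x = x * (k * nm z ^+ 2)%:~R + (x * y) * (conj y * l%:~R).
  rewrite -[LHS]mulr1 -[1 in LHS]/(1%:~R) -e intrD mulrDr; congr (_ + _).
  by rewrite mulrA -[x * y * _]mulrA mul_conj intrM; ring.
apply: qdvdD; last exact: qdvdMr.
by apply: qdvdMl; apply: qdvd_int; rewrite nmX dvdz_mull.
Qed.
End Ring.

(** * Embeddings and strips *)

Lemma disc_cases D : (0 < D)%N -> disc D = D%:Z \/ disc D = 4 * D%:Z.
Proof.
rewrite /disc /qt /qn /D1mod4 => D0; case: ifP => [/eqP h|_]; last by right; ring.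
left; rewrite expr1n; lia.
Qed.

Lemma disc_gt0 D : (0 < D)%N -> 0 < disc D.
Proof. by move=> D0; case: (disc_cases D0) => ->; lia. Qed.
Lemma disc_le D : (0 < D)%N -> disc D <= 4 * D%:Z.
Proof. by move=> D0; case: (disc_cases D0) => ->; lia. Qed.
Lemma disc_dvd D : (0 < D)%N -> (disc D %| 4 * D%:Z)%Z.
Proof. by move=> D0; case: (disc_cases D0) => -> //; rewrite dvdz_mull. Qed.

Lemma sqf_logn D p : (1 < D)%N -> squarefree D -> prime p -> (p %| D)%N -> logn p D = 1%N.
Proof.
move=> D1 sq pp pD; apply/eqP; rewrite eqn_leq; apply/andP; split; last first.
  by rewrite logn_gt0 mem_primes pp pD (ltnW D1).
rewrite leqNgt; apply/negP => l2; have /negP := sq p pp; apply.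
by rewrite mulnn; apply: dvdn_trans (pfactor_dvdnn p D); apply: dvdn_exp2l.
Qed.

(** The valuation at a prime divisor of D is even on the left and odd on the right. *)
Lemma sqr_disc_nat D (a b : nat) : (1 < D)%N -> squarefree D ->
  (a ^ 2 = D * b ^ 2 \/ a ^ 2 = 4 * D * b ^ 2)%N -> b = 0%N.
Proof.
move=> D1 sq e; apply/eqP; rewrite eqn0Ngt; apply/negP => b0.
have [p pp pD] := pdivP D1.
have D0 : (0 < D)%N by apply: ltnW.
have a0 : (0 < a)%N.
  by rewrite lt0n; apply/eqP => a0; move: e; rewrite a0; case=> e; nia.
have [c c0 ec] : exists2 c, (0 < c)%N & (a ^ 2 = D * c ^ 2)%N.
  by case: e => e; [exists b | exists (2 * b)%N; rewrite ?muln_gt0 // e expnMn; ring].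
have := sqf_logn D1 sq pp pD; move/(congr1 (logn p)): ec.
by rewrite lognX lognM ?expn_gt0 ?c0 // lognX => ec l; move: ec; rewrite l; lia.
Qed.

(** An odd prime divisor of g would divide D twice, so g is a power of 2; and 16 dividing 4 D would
    put 4 into D. *)
Lemma sqf_sqr_le2 D (g : nat) : squarefree D -> (g ^ 2 %| 4 * D)%N -> (g <= 2)%N.
Proof.
move=> sq h.
have [g0|g0] := posnP g; first by rewrite g0.
have odd_free p : prime p -> (p %| g)%N -> p = 2%N.
  move=> pp pg; apply/eqP/negPn/negP => p2; have /negP := sq p pp; apply.
  have : (p ^ 2 %| 4 * D)%N by apply: dvdn_trans h; rewrite dvdn_exp2r.
  rewrite mulnn Gauss_dvdr // (_ : 4 = 2 ^ 2)%N // coprimeXl // coprimeXr //.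
  by rewrite prime_coprime // dvdn_prime2.
have [k gk] : exists k, g = (2 ^ k)%N.
  exists (logn 2 g); rewrite -p_part; apply/esym/part_pnat_id.
  by apply/pnatP => // p pp /(odd_free _ pp) ->.
move: h; rewrite gk; case: k gk => [|[|k]] // _ h.
have /negP := sq 2%N isT; case.
have : (4 * 4 %| 4 * D)%N.
  by apply: dvdn_trans h; rewrite -expnM (_ : 4 * 4 = 2 ^ 4)%N // dvdn_exp2l //; lia.
by rewrite dvdn_pmul2l.
Qed.

Lemma sqr_le_mul (a b : int) : b != 0 -> a ^+ 2 <= (a * b) ^+ 2.
Proof.
move=> b0; rewrite exprMn ler_peMr ?sqr_ge0 //.
by have := sqr_ge0 b; have := sqrf_eq0 b; rewrite (negPf b0); lia.
Qed.

Section Emb.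
Variable D : nat.
Hypothesis D1 : (1 < D)%N.
Hypothesis sqfD : squarefree D.
Local Notation e1 := (@emb1 D : QI D -> R).
Local Notation e2 := (@emb2 D : QI D -> R).
Implicit Types x y z v g : QI D.
Let D0 : (0 < D)%N. Proof. exact: ltnW. Qed.

Definition sD : R := omega D - omega' D.

Lemma omega_tr : omega D + omega' D = (qt D)%:~R.
Proof. by rewrite /omega /omega' /qt; case: ifP => _ /=; lra. Qed.

Lemma omega_nm : omega D * omega' D = - (qn D)%:~R.
Proof.
have h : Num.sqrt (D%:R : R) ^+ 2 = D%:R by rewrite sqr_sqrtr.
rewrite /omega /omega' /qn /D1mod4; case: ifP => [/eqP m|_] /=; last first.
  by rewrite mulrN -expr2 h.
have -> : (1 + Num.sqrt D%:R) / 2 * ((1 - Num.sqrt D%:R) / 2) =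
  (1 - (Num.sqrt (D%:R : R)) ^+ 2) / 4 :> R by field.
rewrite h; have {1}-> : D = (((D - 1) %/ 4) * 4 + 1)%N by clear -m; lia.
by rewrite -pmulrn natrD natrM; field.
Qed.

Lemma sqrtD_gt1 : 1 < Num.sqrt (D%:R : R).
Proof. by rewrite -[X in X < _]sqrtr1 ltr_sqrt ?ltr1n ?ltr0n. Qed.

Lemma omega_gt1 : 1 < omega D.
Proof.
by have := sqrtD_gt1; rewrite /omega; case: ifP => _ h; lra.
Qed.
Lemma omega'_lt0 : omega' D < 0.
Proof. by have := sqrtD_gt1; rewrite /omega'; case: ifP => _ h; lra. Qed.

Lemma sD_gt0 : 0 < sD.
Proof. by rewrite /sD; have := omega_gt1; have := omega'_lt0; lra. Qed.

Lemma sD2 : sD ^+ 2 = (disc D)%:~R.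
Proof.
rewrite /disc rmorphD rmorphXn rmorphM /= -omega_tr.
have -> : (qn D)%:~R = - (omega D * omega' D) :> R by rewrite omega_nm opprK.
by rewrite /sD; ring.
Qed.

Lemma e1D x y : e1 (x + y) = e1 x + e1 y.
Proof. by rewrite /emb1 /= !intrD; ring. Qed.
Lemma e2D x y : e2 (x + y) = e2 x + e2 y.
Proof. by rewrite /emb2 /= !intrD; ring. Qed.
Lemma e1N x : e1 (- x) = - e1 x.
Proof. by rewrite /emb1 /= !intrN; ring. Qed.
Lemma e2N x : e2 (- x) = - e2 x.
Proof. by rewrite /emb2 /= !intrN; ring. Qed.
Lemma e1B x y : e1 (x - y) = e1 x - e1 y. Proof. by rewrite e1D e1N. Qed.
Lemma e1_int (m : int) : e1 m%:~R = m%:~R.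
Proof. by rewrite qintE /emb1 /= mul0r addr0. Qed.
Lemma e2_int (m : int) : e2 m%:~R = m%:~R.
Proof. by rewrite qintE /emb2 /= mul0r addr0. Qed.
Lemma e1_0 : e1 0 = 0. Proof. exact: (e1_int 0). Qed.
Lemma e1_1 : e1 1 = 1. Proof. exact: (e1_int 1). Qed.
Lemma e2_1 : e2 1 = 1. Proof. exact: (e2_int 1). Qed.
Lemma omega_sqr : omega D ^+ 2 = (qt D)%:~R * omega D + (qn D)%:~R.
Proof.
have -> : (qn D)%:~R = - (omega D * omega' D) :> R by rewrite omega_nm opprK.
by rewrite -omega_tr; ring.
Qed.
Lemma omega'_sqr : omega' D ^+ 2 = (qt D)%:~R * omega' D + (qn D)%:~R.
Proof.
have -> : (qn D)%:~R = - (omega D * omega' D) :> R by rewrite omega_nm opprK.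
by rewrite -omega_tr; ring.
Qed.
Lemma e1M x y : e1 (x * y) = e1 x * e1 y.
Proof.
rewrite qmulE /emb1 /= !intrD !intrM.
have := omega_sqr; set w := omega D => h.
transitivity (x.1%:~R * y.1%:~R + (x.1%:~R * y.2%:~R + x.2%:~R * y.1%:~R) * w
  + x.2%:~R * y.2%:~R * w ^+ 2); first by rewrite h; ring.
by ring.
Qed.
Lemma e2M x y : e2 (x * y) = e2 x * e2 y.
Proof.
rewrite qmulE /emb2 /= !intrD !intrM.
have := omega'_sqr; set w := omega' D => h.
transitivity (x.1%:~R * y.1%:~R + (x.1%:~R * y.2%:~R + x.2%:~R * y.1%:~R) * w
  + x.2%:~R * y.2%:~R * w ^+ 2); first by rewrite h; ring.
by ring.
Qed.
Lemma e1X x n : e1 (x ^+ n) = e1 x ^+ n.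
Proof. by elim: n => [|n IH]; rewrite ?expr0 ?e1_1 // !exprS e1M IH. Qed.
Lemma e2X x n : e2 (x ^+ n) = e2 x ^+ n.
Proof. by elim: n => [|n IH]; rewrite ?expr0 ?e2_1 // !exprS e2M IH. Qed.
Lemma e1_conj x : e1 (conj x) = e2 x.
Proof. by rewrite /emb1 /emb2 /conj /= intrD intrN intrM -omega_tr; ring. Qed.
Lemma e2_conj x : e2 (conj x) = e1 x.
Proof. by rewrite /emb1 /emb2 /conj /= intrD intrN intrM -omega_tr; ring. Qed.
Lemma e12_nm x : e1 x * e2 x = (nm x)%:~R.
Proof. by rewrite -(e1_conj x) -e1M mul_conj e1_int. Qed.
Lemma e12_wd x y : e1 x * e2 y - e2 x * e1 y = (wd x y)%:~R * sD.
Proof. by rewrite /emb1 /emb2 /wd /sD intrB !intrM; ring. Qed.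

Lemma sqr_disc (a b : int) : a ^+ 2 = disc D * b ^+ 2 -> b = 0.
Proof.
move=> e; apply/eqP; rewrite -absz_eq0; apply/eqP.
apply: (@sqr_disc_nat D `|a|%N) => //.
move/(congr1 absz): e; rewrite abszX abszM abszX.
by case: (disc_cases D0) => ->; rewrite ?abszM /= => ->; [left|right].
Qed.

Lemma nm_eq0 x : nm x = 0 -> x = 0.
Proof.
move=> h; have : tr x ^+ 2 = disc D * x.2 ^+ 2.
  have := tr_disc x 1; rewrite h mul0r mulr0 addr0.
  rewrite -[1]/(1%:~R) conj_int mulr1 => ->; congr (_ * _ ^+ 2).
  by rewrite qintE /wd /=; ring.
move=> e; have x2 := sqr_disc e; move: e; rewrite x2 expr0n mulr0 => /eqP.
rewrite sqrf_eq0 /tr x2 mulr0 addr0 mulf_eq0 /= => /eqP x1.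
by rewrite [x]surjective_pairing x1 x2.
Qed.

Lemma e1_eq0 x : e1 x = 0 -> x = 0.
Proof.
move=> h; apply: nm_eq0; apply/eqP; rewrite -(intr_eq0 R) -e12_nm h mul0r //.
Qed.
Lemma e2_eq0 x : e2 x = 0 -> x = 0.
Proof.
move=> h; apply: nm_eq0; apply/eqP; rewrite -(intr_eq0 R) -e12_nm h mulr0 //.
Qed.
Lemma e1_inj x y : e1 x = e1 y -> x = y.
Proof.
by move=> h; apply/eqP; rewrite -subr_eq0; apply/eqP/e1_eq0; rewrite e1B h subrr.
Qed.

Lemma q_integral x y : x * y = 0 -> x = 0 \/ y = 0.
Proof.
move=> h; have : nm x * nm y = 0 by rewrite -nmM h -[0]/(0%:~R) nm_int.
by move/eqP; rewrite mulf_eq0 => /orP[]/eqP/nm_eq0; [left|right].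
Qed.
Lemma q_cancel a x y : a <> 0 -> a * x = a * y -> x = y.
Proof.
move=> a0 h; have : a * (x - y) = 0 by rewrite mulrBr h subrr.
by case/q_integral => // /eqP; rewrite subr_eq0 => /eqP.
Qed.
Lemma nm_neq0 x : x <> 0 -> nm x != 0.
Proof. by move=> h; apply/eqP => /nm_eq0. Qed.

(** * Signs under the two embeddings, and strips *)

Definition tp x := (0 < e1 x) && (0 < e2 x).
Definition mp x := (e1 x < 0) && (0 < e2 x).

Lemma tpP x : reflect (totpos D x) (tp x).
Proof. exact: andP. Qed.
Lemma tp_nm x : tp x -> 0 < nm x.
Proof. by case/andP=> a b; rewrite -(ltr0z R) -e12_nm mulr_gt0. Qed.
Lemma mp_nm x : mp x -> nm x < 0.
Proof. by case/andP=> a b; rewrite -(ltrz0 R) -e12_nm nmulr_rlt0. Qed.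
Lemma tp_neq0 x : tp x -> x <> 0.
Proof. by case/andP=> a _ h; move: a; rewrite h e1_0 ltxx. Qed.
Lemma mp_neq0 x : mp x -> x <> 0.
Proof. by case/andP=> a _ h; move: a; rewrite h e1_0 ltxx. Qed.
Lemma nm_tp x : 0 < nm x -> tp x \/ tp (- x).
Proof.
rewrite -(ltr0z R) -e12_nm /tp e1N e2N => h.
have [a|a|a] := ltgtP (e1 x) 0; last by move: h; rewrite a mul0r ltxx.
  by right; rewrite !oppr_gt0 a -(nmulr_rgt0 _ a).
by left; rewrite -(pmulr_rgt0 _ a).
Qed.
Lemma nm_mp x : nm x < 0 -> mp x \/ mp (- x).
Proof.
rewrite -(ltrz0 R) -e12_nm /mp e1N e2N => h.
have [a|a|a] := ltgtP (e1 x) 0; last by move: h; rewrite a mul0r ltxx.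
  by left; rewrite -(nmulr_rlt0 _ a).
by right; rewrite oppr_lt0 oppr_gt0 a -(pmulr_rlt0 _ a).
Qed.
Lemma tpM x y : tp x -> tp y -> tp (x * y).
Proof. by case/andP=> a b /andP[c d]; rewrite /tp e1M e2M; apply/andP; split; apply: mulr_gt0. Qed.
Lemma tp_mp x y : tp x -> mp y -> mp (x * y).
Proof. by case/andP=> a b /andP[c d]; rewrite /mp e1M e2M pmulr_rlt0 // mulr_gt0 ?c. Qed.
Lemma tp_conj x : tp (conj x) = tp x.
Proof. by rewrite /tp e1_conj e2_conj andbC. Qed.
Lemma tp_sqr x : x <> 0 -> tp (x ^+ 2).
Proof.
move=> x0; rewrite /tp e1X e2X !exprn_even_gt0 //=.
by apply/andP; split; apply/eqP; [move/e1_eq0 | move/e2_eq0].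
Qed.
Lemma tp1 : tp 1. Proof. by rewrite /tp e1_1 e2_1 ltr01. Qed.
Lemma tp_divr x y : tp x -> tp (x * y) -> tp y.
Proof.
by case/andP=> a b; rewrite /tp e1M e2M !pmulr_rgt0.
Qed.

Lemma tp_mp_wd b v : tp b -> mp v -> 0 < wd b v.
Proof.
case/andP=> a c /andP[d e]; have := e12_wd b v.
rewrite -(ltr0z R) -(pmulr_lgt0 _ sD_gt0) => <-.
by rewrite subr_gt0; apply: (lt_trans (y := 0)); [rewrite pmulr_rlt0 | rewrite mulr_gt0].
Qed.

Lemma diag_formE m (a x : 'I_m -> QI D) :
  diag_form D a x = \sum_(i < m) a i * (x i * x i) :> QI D.
Proof. by []. Qed.

Definition srep m (a : 'I_m -> QI D) g := exists k x, g = a k * x ^+ 2.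

(* wd _ v is additive and at least 1 on totally positive elements, so an
   element on which it equals 1 is indecomposable. *)
Lemma single_term m (a : 'I_m -> QI D) g v : diag_universal D a ->
  tp g -> mp v -> wd g v = 1 -> srep a g.
Proof.
case=> atp rep /tpP /rep [x0 ->] mv; pose x : 'I_m -> QI D := x0.
rewrite (diag_formE a x) => h.
have term i : x i = 0 :> QI D \/ 0 < wd (a i * (x i * x i) : QI D) v.
  have [e|e] := pselect (x i = 0 :> QI D); first by left.
  by right; apply: tp_mp_wd => //; apply: tpM; [apply/tpP | rewrite -expr2; apply: tp_sqr].
have term0 i : 0 <= wd (a i * (x i * x i) : QI D) v.
  by case: (term i) => [->|/ltW //]; rewrite mulr0 mulr0 wd0l.
have wsum (P : pred 'I_m) : wd (\sum_(i | P i) (a i * (x i * x i) : QI D)) v =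
    \sum_(i | P i) wd (a i * (x i * x i) : QI D) v.
  apply: (big_morph (fun z : QI D => wd z v)); [move=> y z; exact: wdDl | exact: wd0l].
have [[i xi]|no] := pselect (exists i, 0 < wd (a i * (x i * x i) : QI D) v); last first.
  move: h; rewrite wsum big1 // => i _; apply/eqP; rewrite eq_le term0 andbT leNgt.
  by apply/negP => xi; apply: no; exists i.
exists i, (x i); rewrite (bigD1 i) //= [X in _ + X]big1 ?addr0 ?expr2 // => j ji.
case: (term j) => [->|xj]; first by rewrite mulr0 mulr0.
move: h; rewrite wsum (bigD1 i) //= (bigD1 j) //=.
have : 0 <= \sum_(k < m | (k != i) && (k != j)) wd (a k * (x k * x k) : QI D) v.
  by apply: sumr_ge0.
by move: (\sum_(k < m | (k != i) && (k != j)) _) => S S0 e; exfalso; lia.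
Qed.

(** By [wd_adj] a factor x moves across the determinant: the point loses x and the direction v gains
    x', with determinant still 1. *)
Lemma swap_pos a x v : tp x -> mp v -> wd (a * x ^+ 2) v = 1 ->
  mp (conj x * v) /\ wd (a * x) (conj x * v) = 1.
Proof.
move=> tx mv h; split; first by apply: tp_mp => //; rewrite tp_conj.
by rewrite -wd_adj -h; congr wd; rewrite expr2; ring.
Qed.

(** When N x is negative, the same move exchanges the roles: x' v becomes the point and -(a x) the
    direction of the strip. *)
Lemma swap_neg a x v : tp a -> mp (conj x) -> mp v -> wd (a * x ^+ 2) v = 1 ->
  [/\ tp (conj x * v), mp (- (a * x)) & wd (conj x * v) (- (a * x)) = 1].
Proof.
case/andP=> a1 a2 /andP[]; rewrite e1_conj e2_conj => x2 x1 /andP[v1 v2] h; split.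
- by rewrite /tp !e1M !e2M e1_conj e2_conj; apply/andP; split; [rewrite nmulr_rgt0 | rewrite mulr_gt0].
- by rewrite /mp e1N e2N e1M e2M oppr_lt0 oppr_gt0; apply/andP; split; [rewrite mulr_gt0 | rewrite pmulr_rlt0].
rewrite wdNr wdC opprK -wd_adj -h; congr wd; rewrite expr2; ring.
Qed.

(** Each step along v lowers the first embedding by - e1 v, which must stay positive, while
    [wd g v = 1] says that e1 g e2 v - e2 g e1 v is the root of the discriminant; hence k |N v| is
    below that root. *)
Lemma strip_width g v (k : int) : mp v -> tp g -> tp (g + k%:~R * v) -> wd g v = 1 ->
  (k * nm v) ^+ 2 < disc D.
Proof.
wlog k0 : g k / 0 <= k.
  move=> H mv tg tk h; have [k0|k0] := leP 0 k; first exact: (H g).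
  rewrite -sqrrN -mulNr; apply: (H (g + k%:~R * v)) => //; first lia.
    by rewrite intrN mulNr addrK.
  by rewrite wdDl wdZl wdxx mulr0 addr0.
move=> /andP[v1 v2] /andP[g1 g2] /andP[]; rewrite e1D e1M e1_int => t1 _ h.
have := e12_wd g v; rewrite h mul1r => e.
have kR : 0 <= k%:~R :> R by rewrite ler0z.
have cR : - (nm v)%:~R = - e1 v * e2 v by rewrite -e12_nm mulNr.
have : k%:~R * (- (nm v)%:~R) < sD.
  rewrite cR -e; have a : k%:~R * (- e1 v) < e1 g by lra.
  have b : k%:~R * (- e1 v) * e2 v < e1 g * e2 v by rewrite ltr_pM2r.
  have c : e2 g * e1 v < 0 by rewrite pmulr_rlt0.
  by rewrite mulrA; lra.
have nn : 0 <= k%:~R * (- (nm v)%:~R) :> R.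
  by rewrite cR mulr_ge0 // mulr_ge0 // ?oppr_ge0 ltW.
move=> lt; rewrite -(ltr_int R) -sD2 rmorphXn rmorphM /= -sqrrN -mulrN.
by rewrite ltr_pXn2r // nnegrE ltW // sD_gt0.
Qed.

Lemma strip_nm_bound g v : wd g v = 1 -> 4 * (nm g * - nm v) <= disc D.
Proof.
move=> h; have := tr_disc g v; rewrite h expr1n mulr1 => e.
have := sqr_ge0 (tr (g * conj v)); rewrite e; lia.
Qed.

(* If a x^2 and a y^2 lie on the same strip, their distance is
   N(a) wd(x,y) Tr(x y'), and Tr(x y')^2 exceeds the discriminant as soon as
   N(x) N(y) > 0 and wd(x,y) <> 0. *)
Lemma strip_same_coef a x y v (k : int) g : mp v -> tp g -> tp (g + k%:~R * v) ->
  wd g v = 1 -> g = a * x ^+ 2 -> g + k%:~R * v = a * y ^+ 2 -> 0 < nm x * nm y -> k = 0.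
Proof.
move=> mv tg tk h ex ey pos.
have sw := strip_width mv tg tk h.
have kE : k = wd g (g + k%:~R * v) by rewrite wdDr wdxx add0r wdZr h mulr1.
move: kE; rewrite ey {1}ex wdM wd_sqr.
set w := wd x y; set t := tr _ => kE.
have [w0|w0] := eqVneq w 0; first by rewrite kE w0 mul0r mulr0.
have te : t ^+ 2 = disc D * w ^+ 2 + 4 * (nm x * nm y) by exact: tr_disc.
exfalso; have [k0|k0] := eqVneq k 0.
  have a0 : nm a != 0.
    by apply: contraTneq (tp_nm tg) => a0; rewrite ex nmM a0 mul0r ltxx.
  have t0 : t != 0.
    apply: contraTneq pos => t0; move: te; rewrite t0; have := disc_gt0 D0; have := sqr_ge0 w; nia.
  move/eqP: kE; rewrite k0 eq_sym !mulf_eq0 (negPf a0) (negPf w0) (negPf t0) //.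
have w1 : 1 <= w ^+ 2 by nia.
have dt : disc D < t ^+ 2.
  by rewrite te; have := disc_gt0 D0; move: (w ^+ 2) w1 (nm x * nm y) pos => ? ? ? ?; nia.
have kt : t ^+ 2 <= k ^+ 2.
  have -> : k = t * (nm a * w) by rewrite kE; ring.
  by apply: sqr_le_mul; apply: contraNneq k0 => z; rewrite kE mulrA z mul0r.
have kn : k ^+ 2 <= (k * nm v) ^+ 2 by apply: sqr_le_mul; rewrite lt_eqF // mp_nm.
by have := lt_trans (lt_le_trans dt kt) (le_lt_trans kn sw); rewrite ltxx.
Qed.

(** The line b + t v is totally positive exactly for t in an open interval of length l, the root of
    the discriminant divided by |N v|. The U = ceil(l) - 1 integers from the first one, m, beyond
    its left end [lo] all lie inside. *)
Lemma strip_exists v b : mp v -> wd b v = 1 ->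
  exists g U, [/\ wd g v = 1,
     (forall r : nat, (r < U)%N -> tp (g + r%:Z%:~R * v)),
     U%:Z ^+ 2 * nm v ^+ 2 < disc D &
     disc D <= (U%:Z + 1) ^+ 2 * nm v ^+ 2].
Proof.
move=> mv h; have /andP[v1 v2] := mv.
have c0 : 0 < - (nm v)%:~R :> R by rewrite oppr_gt0 ltrz0 mp_nm.
set l : R := sD / - (nm v)%:~R.
have l0 : 0 < l by rewrite divr_gt0 ?sD_gt0.
have [U UE] : exists U : nat, U%:Z = Num.ceil l - 1.
  exists `|Num.ceil l - 1|%N; rewrite gez0_abs //.
  by have := ceil_gt0 l; rewrite l0; lia.
have Ul : U%:R < l.
  have : (U%:Z)%:~R < l by rewrite UE; have := ceilB1_lt l; rewrite intrB.
  by rewrite -pmulrn.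
have lU : l <= U%:R + 1.
  have : l <= (U%:Z + 1)%:~R by rewrite UE subrK; exact: ceil_ge.
  by rewrite intrD -pmulrn.
pose lo : R := - e2 b / e2 v.
have [m mlo mlo1] : exists2 m : int, lo < m%:~R & m%:~R <= lo + 1.
  exists (Num.floor lo + 1); first exact: floorD1_gt.
  by rewrite intrD lerD2r; exact: floor_le.
exists (b + m%:~R * v), U; split.
- by rewrite wdDl wdZl wdxx mulr0 addr0.
- move=> r rU; rewrite -addrA -mulrDl -intrD.
  have r0 : 0 <= r%:R :> R by [].
  have rU1 : r%:R + 1 <= U%:R :> R by rewrite -[1]/(1%:R) -natrD ler_nat addn1.
  have e := e12_wd b v; rewrite h mul1r in e.
  have lE : l * (- e1 v * e2 v) = e1 b * e2 v - e2 b * e1 v.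
    by rewrite e /l mulNr e12_nm divfK // gt_eqF.
  have loE : lo * e2 v = - e2 b by rewrite /lo divfK // gt_eqF.
  rewrite /tp !e1D !e2D !e1M !e2M !e1_int !e2_int !intrD -!pmulrn; apply/andP; split.
    rewrite -(pmulr_lgt0 _ v2).
    have -> : (e1 b + (m%:~R + r%:R) * e1 v) * e2 v =
       (l + lo - (m%:~R + r%:R)) * (- e1 v * e2 v).
      have e3 : lo * (- e1 v * e2 v) = e2 b * e1 v.
        by transitivity (- e1 v * (lo * e2 v)); [ring | rewrite loE; ring].
      transitivity (l * (- e1 v * e2 v) + lo * (- e1 v * e2 v)
        - (m%:~R + r%:R) * (- e1 v * e2 v)); first by rewrite lE e3; ring.
      by ring.
    rewrite mulr_gt0 //; last by rewrite mulr_gt0 // oppr_gt0.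
    by lra.
  have -> : e2 b = - (lo * e2 v) by rewrite loE opprK.
  by rewrite -mulNr -mulrDl mulr_gt0 //; lra.
- rewrite -exprMn -(ltr_int R) -sD2 rmorphXn /= intrM -sqrrN -mulrN -pmulrn.
  rewrite ltr_pXn2r // ?nnegrE; last by rewrite ltW // sD_gt0.
    by rewrite -ltr_pdivlMr.
  by rewrite mulr_ge0 // ltW.
- rewrite -exprMn -(ler_int R) -sD2 rmorphXn /= intrM -[X in _ <= X]sqrrN -mulrN intrD -pmulrn.
  rewrite ler_pXn2r // ?nnegrE; first by rewrite -ler_pdivrMr.
    by rewrite ltW // sD_gt0.
  by rewrite mulr_ge0 // ?addr_ge0 // ltW.
Qed.

(** Two directions at g differ by a multiple w of g. Pairing v' with the neighbours g + v and g - v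
    gives 1 - w and 1 + w, both positive, so w = 0. *)
Lemma strip_inj g v v' : tp (g + v) -> tp (g - v) -> mp v -> mp v' -> wd g v = 1 -> wd g v' = 1 ->
  v = v'.
Proof.
move=> t1 t2 mv mv' h h'.
have e : v' = v + g * (wd v' v)%:~R.
  by have := basis_exp v' h; rewrite h' mulr1 => {1}->; rewrite addrC.
have w1 := tp_mp_wd t1 mv'; have w2 := tp_mp_wd t2 mv'.
move: w1 w2; rewrite !wdDl wdNl h' [wd v v']wdC => w1 w2.
have w0 : wd v' v = 0 by lia.
by rewrite e w0 mulr0 addr0.
Qed.
End Emb.

(** * Convergents of the continued fraction *)

Section CF.
Variable D : nat.
Hypothesis D1 : (1 < D)%N.
Hypothesis sqfD : squarefree D.
Local Notation e1 := (@emb1 D : QI D -> R).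
Local Notation e2 := (@emb2 D : QI D -> R).
Local Notation u := (cf_u D).
Local Notation x := (cf_x D).

(* The convergents, with index shifted by 2: cc k.+2 stands for p_k - q_k omega. *)
Fixpoint ccp (k : nat) : QI D * QI D :=
  if k is k'.+1 then ((ccp k').2, (ccp k').1 + (u k')%:~R * (ccp k').2)
  else (- om D, 1).
Definition cc k := (ccp k).1.

Lemma cc1 : cc 1 = 1. Proof. by []. Qed.
Lemma ccS k : cc k.+2 = cc k + (u k)%:~R * cc k.+1. Proof. by []. Qed.

Lemma wd_cc k : wd (cc k) (cc k.+1) = (-1) ^+ k.+1.
Proof.
elim: k => [|k IH]; first by [].
by rewrite ccS wdDr wdZr wdxx mulr0 addr0 wdC IH [RHS]exprS mulN1r.
Qed.

Lemma cc_neq0 k : cc k <> 0.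
Proof.
move=> h; have := wd_cc k; rewrite h wd0l => /esym/eqP.
by rewrite expf_eq0 /= oppr_eq0 oner_eq0.
Qed.
Lemma e1cc_neq0 k : e1 (cc k) != 0.
Proof. by apply/eqP => h; apply: (@cc_neq0 k); apply: (e1_eq0 D1 sqfD). Qed.

(** Complete quotients are ratios of consecutive convergents. The lower bound and the alternating
    sign carry the induction; irrationality keeps the fractional parts nonzero. *)
Lemma cf_inv k : [/\ x k = - e1 (cc k) / e1 (cc k.+1), 1 < x k &
  0 < (-1) ^+ k.+1 * e1 (cc k)].
Proof.
elim: k => [|k [xE x1 sg]].
  have -> : e1 (cc 0) = - omega D by rewrite /cc /= e1N /om /emb1 /= mul1r add0r.
  rewrite cc1 e1_1 divr1 opprK expr1 mulN1r opprK /=; have := omega_gt1 D1.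
  by split => //; lra.
have n1 := e1cc_neq0 k.+1; have n2 := e1cc_neq0 k.+2.
have e : x k - (u k)%:~R = - e1 (cc k.+2) / e1 (cc k.+1).
  by rewrite xE ccS e1D e1M e1_int; field.
have f0 : 0 <= x k - (u k)%:~R by rewrite subr_ge0; exact: floor_le.
have f1 : x k - (u k)%:~R < 1.
  by rewrite ltrBlDr addrC; have := floorD1_gt (x k); rewrite intrD.
have fn : x k - (u k)%:~R != 0 by rewrite e mulf_neq0 ?oppr_eq0 ?invr_eq0.
have fp : 0 < x k - (u k)%:~R by rewrite lt_neqAle eq_sym fn.
have xS : x k.+1 = (x k - (u k)%:~R)^-1 by [].
split.
- by rewrite xS e; field; rewrite n1 n2.
- by rewrite xS invf_gt1.
have x0 : 0 < x k by apply: lt_trans x1.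
rewrite exprS mulN1r mulNr -mulrN -(pmulr_rgt0 _ x0).
suff -> : x k * ((-1) ^+ k.+1 * - e1 (cc k.+1)) = (-1) ^+ k.+1 * e1 (cc k) by [].
by rewrite xE; field.
Qed.

Lemma cf_x_gt1 k : 1 < x k. Proof. by case: (cf_inv k). Qed.
Lemma cf_xE k : x k = - e1 (cc k) / e1 (cc k.+1). Proof. by case: (cf_inv k). Qed.
Lemma cf_u_ge1 k : 1 <= u k.
Proof. by rewrite /cf_u floor_ge_int ltW // cf_x_gt1. Qed.

Lemma e2cc k : 0 < e2 (cc k) /\ e2 (cc k.+1) < e2 (cc k.+2).
Proof.
have u1 i : 1 <= (u i)%:~R :> R by rewrite ler1z cf_u_ge1.
have w0 := omega'_lt0 D1.
have step i : 0 < e2 (cc i) -> 0 < e2 (cc i.+1) -> e2 (cc i.+1) < e2 (cc i.+2).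
  move=> a b; rewrite ccS e2D e2M e2_int; apply: (@lt_le_trans _ _ (e2 (cc i) + e2 (cc i.+1))).
    by rewrite ltrDr.
  by rewrite lerD2l ler_peMl // ltW.
have pos i : 0 < e2 (cc i) /\ 0 < e2 (cc i.+1).
  elim: i => [|i [a b]]; last by split => //; exact: lt_trans b (step i a b).
  rewrite cc1 e2_1 /cc /= e2N /om /emb2 /= mul1r add0r.
  by split => //; rewrite oppr_gt0.
by case: (pos k) => a b; split => //; apply: step.
Qed.

Lemma tp_cc k : odd k -> tp (cc k).
Proof.
move=> o; rewrite /tp; case: (e2cc k) => -> _; rewrite andbT.
by case: (cf_inv k) => _ _; rewrite -signr_odd /= o expr0 mul1r.
Qed.
Lemma mp_cc k : ~~ odd k -> mp (cc k).
Proof.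
move=> o; rewrite /mp; case: (e2cc k) => -> _; rewrite andbT.
by case: (cf_inv k) => _ _; rewrite -signr_odd /= o expr1 mulN1r oppr_gt0.
Qed.
Lemma wd_cc_odd k : odd k -> wd (cc k) (cc k.+1) = 1.
Proof. by move=> o; rewrite wd_cc -signr_odd /= o. Qed.
Lemma tp_cc_strip k (r : int) : odd k -> 0 <= r <= u k -> tp (cc k + r%:~R * cc k.+1).
Proof.
move=> o /andP[r0 ru].
have /andP[a1 a2] := tp_cc o.
have /andP[b1 b2] : mp (cc k.+1) by apply: mp_cc; rewrite /= o.
have /andP[] : tp (cc k.+2) by apply: tp_cc; rewrite /= o.
rewrite ccS !e1D !e2D !e1M !e2M !e1_int !e2_int => c1 c2.
rewrite /tp e1D e2D e1M e2M e1_int e2_int; apply/andP; split.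
  apply: lt_le_trans c1 _; rewrite lerD2l ler_nM2r // ler_int //.
by rewrite ltr_wpDr // mulr_ge0 ?ler0z // ltW.
Qed.

(** With equal partial quotients, the distance of two complete quotients is multiplied at each step
    by the product of the next ones, hence by at least 4 every two steps. As it stays below 1, it
    vanishes. *)
Lemma cf_x_eq i j : (forall n, u (i + n) = u (j + n)) -> x i = x j.
Proof.
move=> uu.
pose d n := `|x (i + n) - x (j + n)|.
have dS n : d n.+1 = d n * (x (i + n.+1) * x (j + n.+1)).
  rewrite /d !addnS.
  have pa : 0 < x (i + n).+1 := lt_trans ltr01 (cf_x_gt1 _).
  have pb : 0 < x (j + n).+1 := lt_trans ltr01 (cf_x_gt1 _).
  have ea : x (i + n) = (u (i + n))%:~R + (x (i + n).+1)^-1 by rewrite /= invrK addrC subrK.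
  have eb : x (j + n) = (u (j + n))%:~R + (x (j + n).+1)^-1 by rewrite /= invrK addrC subrK.
  rewrite {1}ea {1}eb uu.
  move: (x (i + n).+1) (x (j + n).+1) pa pb => a b pa pb.
  rewrite -[in RHS](gtr0_norm pa) -[in RHS](gtr0_norm pb) -!normrM.
  rewrite -normrN; congr `|_|; rewrite !gtr0_norm //; field.
  by rewrite !gt_eqF.
have prod2 k : 2 <= x k * x k.+1.
  have e : x k = (u k)%:~R + (x k.+1)^-1 by rewrite /= invrK addrC subrK.
  have h1 := cf_x_gt1 k.+1.
  have u1 : 1 <= (u k)%:~R :> R by rewrite ler1z cf_u_ge1.
  rewrite {1}e mulrDl mulVf; last by rewrite gt_eqF // (lt_trans ltr01).
  have : x k.+1 <= (u k)%:~R * x k.+1 by rewrite ler_peMl // ltW // (lt_trans ltr01).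
  lra.
have d4 n : 4 * d n <= d n.+2.
  rewrite !dS mulrC -mulrA ler_wpM2l ?normr_ge0 //.
  rewrite mulrACA (_ : 4 = 2 * 2 :> R); last by rewrite -natrM.
  by rewrite !addnS ler_pM.
have dn n : n.+1%:R * d 0%N <= d (n * 2)%N.
  elim: n => [|n IH]; first by rewrite mul1r.
  rewrite mulSn add2n; apply: le_trans (d4 _); apply: le_trans (_ : 4 * (n.+1%:R * d 0%N) <= _).
    rewrite mulrA ler_wpM2r ?normr_ge0 // -natrM ler_nat; lia.
  by rewrite ler_pM2l.
have d1 n : d n < 1.
  rewrite /d; have fa := floor_le (x (i + n)); have fb := floor_le (x (j + n)).
  have ga := floorD1_gt (x (i + n)); have gb := floorD1_gt (x (j + n)).
  have e : Num.floor (x (i + n)) = Num.floor (x (j + n)) by exact: uu.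
  rewrite e intrD in ga fa; rewrite intrD in gb; rewrite ltr_norml; apply/andP; split; lra.
have d0 : d 0%N = 0.
  apply/eqP; rewrite eq_le normr_ge0 andbT leNgt; apply/negP => d0.
  have := archi_boundP (ltW (divr_gt0 ltr01 d0)); set N := Num.bound _.
  rewrite ltr_pdivrMr // => h.
  have := le_lt_trans (dn N) (d1 _); rewrite -addn1 natrD mulrDl mul1r; lra.
by move/eqP: d0; rewrite /d !addn0 normr_eq0 subr_eq0 => /eqP.
Qed.

(** * Periods, the unit of a period, and M_D *)

Lemma cf_x_shift i j : x i = x j -> forall n, x (i + n) = x (j + n).
Proof. by move=> h; elim=> [|n IH]; rewrite ?addn0 // !addnS /= IH. Qed.
Lemma cf_u_shift i j : x i = x j -> forall n, u (i + n) = u (j + n).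
Proof. by move=> h n; rewrite /cf_u (cf_x_shift h). Qed.

Lemma is_period_mul s n : is_period D s -> (0 < n)%N -> is_period D (n * s).
Proof.
move=> [s0 ps] n0; split; first by rewrite muln_gt0 n0.
move=> i i1; elim: n {n0} => [|n IH]; first by rewrite mul0n addn0.
by rewrite mulSn addnCA addnC ps ?IH // addn_gt0 i1.
Qed.

Lemma period_x s : is_period D s -> x s.+1 = x 1.
Proof.
move=> [s0 ps]; apply: cf_x_eq => n.
by rewrite addSn -addnS addnC ps // addnC.
Qed.

Lemma period_of_eq s k l : is_period D s -> (0 < k)%N -> (k < l)%N -> x l = x k ->
  is_period D (l - k).
Proof.
move=> ps k0 kl e; split; first by rewrite subn_gt0.
move=> i i0.
have [P0 Ps] : is_period D (k * s) by apply: is_period_mul.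
rewrite -(Ps i) // -(Ps (i + _)%N) ?addn_gt0 ?i0 //.
have ks : (k <= k * s)%N by rewrite leq_pmulr //; case: ps.
have -> : (i + (l - k) + k * s = l + (i + k * s - k))%N by lia.
by rewrite (cf_u_shift e); congr u; lia.
Qed.

(** The unit by which a shift through one period multiplies the convergents; see [cc_shift]. *)
Definition epsT s : QI D := cc s.+1.

Lemma cc_shift s k : is_period D s -> cc (k.+1 + s) = cc k.+1 * epsT s.
Proof.
move=> ps; suff : cc (k.+1 + s) = cc k.+1 * epsT s /\ cc (k.+2 + s) = cc k.+2 * epsT s by case.
elim: k => [|k [IH1 IH2]]; last first.
  split => //; rewrite -[LHS]/(cc (k.+1 + s) + (u (k.+1 + s))%:~R * cc (k.+2 + s)).
  by rewrite IH1 IH2 [cc k.+3]ccS; case: ps => _ -> //; ring.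
rewrite cc1 mul1r add1n; split => //; rewrite add2n.
apply: (e1_inj D1 sqfD); rewrite e1M.
have := period_x ps; rewrite !cf_xE cc1 e1_1.
have n1 := e1cc_neq0 s.+2; have n2 := e1cc_neq0 2.
move/(congr1 (fun z => - z * e1 (cc s.+2) * e1 (cc 2))).
rewrite !mulNr !opprK divfK // mul1r mulrAC mulVf // mul1r => e.
by rewrite /epsT -e mulrC.
Qed.

(** The shift multiplies the determinant of two neighbours by the norm, and that determinant is a
    sign alternating with the index. *)
Lemma nm_epsT s : is_period D s -> nm (epsT s) = (-1) ^+ s.
Proof.
move=> ps; have := wd_cc (1 + s); rewrite -[(1 + s).+1]/(2 + s)%N !cc_shift //.
by rewrite (mulrC (cc 1)) (mulrC (cc 2)) wdM wd_cc exprD sqrrN expr1n mulr1 mul1r.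
Qed.

Let int_lt1_eq0 (r : int) : r < 1 -> -1 < r -> r = 0.
Proof. lia. Qed.

(** The unit h is totally positive of norm 1, so both h cc_k and cc_l complete cc_(l+1) to a basis
    and differ by r cc_(l+1). Their second embeddings lie between 0 and that of cc_(l+1), so r = 0
    and the ratios agree. *)
Lemma cc_assoc_x k l : odd k -> odd l -> assoc (cc l.+1) (cc k.+1) -> x l = x k.
Proof.
move=> ok ol [h uh e].
have mk : mp (cc k.+1) by apply: mp_cc; rewrite /= ok.
have ml : mp (cc l.+1) by apply: mp_cc; rewrite /= ol.
have th : tp h.
  case/andP: mk => k1 k2; case/andP: ml; rewrite e e1M e2M => l1 l2.
  by rewrite /tp -(nmulr_llt0 _ k1) l1 -(pmulr_lgt0 _ k2).
have nh : nm h = 1 by have := tp_nm th; move: uh; rewrite /qunit; lia.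
have hk : wd (h * cc k) (cc l.+1) = 1 by rewrite e wdM nh wd_cc_odd.
have := basis_exp (cc l) hk; rewrite wd_cc_odd // mulr1.
set r := wd _ _ => er.
have r0 : r = 0.
  have [l0 _] := e2cc l; have [_ l2] := e2cc l.-1.
  have [k0 _] := e2cc k; have [_ k2] := e2cc k.-1.
  rewrite !prednK ?odd_gt0 // in l2 k2.
  have h2 : 0 < e2 h by case/andP: th.
  have [vl _] := e2cc l.+1.
  move/(congr1 e2): er; rewrite e2D !e2M e2_int => er.
  have a : e2 h * e2 (cc k) < e2 (cc l.+1) by rewrite e e2M ltr_pM2l.
  have b : 0 < e2 h * e2 (cc k) by rewrite mulr_gt0.
  have r1 : e2 (cc l.+1) * r%:~R < e2 (cc l.+1) * 1 by lra.
  have r2 : e2 (cc l.+1) * (-1) < e2 (cc l.+1) * r%:~R by lra.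
  rewrite ltr_pM2l // ltrz1 in r1; rewrite ltr_pM2l // in r2.
  have : (-1 : int)%:~R < r%:~R :> R by [].
  by rewrite ltr_int => r3; apply: int_lt1_eq0.
rewrite r0 mulr0 addr0 in er; rewrite !cf_xE er e !e1M.
have := e1cc_neq0 k.+1; have h1 : e1 h != 0 by case/andP: th => h1 _; rewrite gt_eqF.
by move=> n1; field; rewrite h1 n1.
Qed.

(** The least even multiple of s: the unit then has norm 1 and the shift preserves the parity of the
    index. *)
Definition evper s := if odd s then (2 * s)%N else s.

Lemma evper_odd s : odd (evper s) = false.
Proof. by rewrite /evper; case: ifP => //; rewrite oddM. Qed.
Lemma evper_kappa s : (kappa s * s)%N = evper s.
Proof. by rewrite /kappa /evper; case: ifP; rewrite ?mul1n. Qed.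
Lemma evper_period s : is_period D s -> is_period D (evper s).
Proof. by rewrite /evper; case: ifP => // _ ps; apply: is_period_mul. Qed.

(** Otherwise l - k is a period. For odd s it is even, so it differs from s, and l - k - s is then a
    period shorter than s. *)
Lemma cc_nonassoc s k l : is_min_period D s -> odd k -> odd l -> (k < l)%N -> (l < evper s)%N ->
  ~ assoc (cc l.+1) (cc k.+1).
Proof.
move=> [ps mins] ok ol kl lT h.
have := period_of_eq ps (odd_gt0 ok) kl (cc_assoc_x ok ol h) => pt.
have st := mins _ pt; move: lT; rewrite /evper; case: ifP => os lT; last by lia.
have ot : odd (l - k) = false by rewrite oddB ?ok ?ol // ltnW.
have [e|e] := eqVneq s (l - k)%N; first by rewrite -e os in ot.
have : is_period D (l - k - s).
  split; first by rewrite subn_gt0 ltn_neqAle e.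
  move=> i i1; case: ps => _ ps; rewrite -ps ?addn_gt0 ?i1 //.
  by rewrite -addnA subnK //; case: pt => _; apply.
by move/mins; lia.
Qed.

(** Here x_s = omega + (u_s - u_0), and the conjugate of the right side lies between -1 and 0, being
    minus a ratio of increasing second embeddings. With omega + omega' = [qt], this pins down the
    integer u_s. *)
Lemma u_period_end s : is_period D s -> u s = 2 * u 0 - (D1mod4 D : nat)%:Z.
Proof.
move=> ps; have s0 : (0 < s)%N by case: ps.
have xs : x s = omega D + (u s - u 0)%:~R.
  have := period_x ps; rewrite /= => /invr_inj e.
  rewrite intrB; move: e; rewrite -/(u s) -/(u 0%N) => e.
  by transitivity (x s - (u s)%:~R + (u s)%:~R); [ring | rewrite e; ring].
have es : - cc s = cc s.+1 * (om D + (u s - u 0)%:~R).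
  apply: (e1_inj D1 sqfD); rewrite e1N e1M e1D e1_int.
  have -> : e1 (om D) = omega D by rewrite /om /emb1 /= mul1r add0r.
  by rewrite -xs cf_xE mulrC divfK // e1cc_neq0.
move/(congr1 e2): es; rewrite e2N e2M e2D e2_int.
have -> : e2 (om D) = omega' D by rewrite /om /emb2 /= mul1r add0r.
have [p0 _] := e2cc s; have [_] := e2cc s.-1; rewrite prednK // => lt1.
have [p1 _] := e2cc s.+1.
set t := omega' D + _ => et.
have t0 : t < 0 by rewrite -(pmulr_rlt0 _ p1) -et oppr_lt0.
have t1 : -1 < t by rewrite -(ltr_pM2l p1) -et; lra.
have f0 := floor_le (omega D); have f1 := floorD1_gt (omega D).
have u0 : u 0 = Num.floor (omega D) by [].
rewrite -u0 intrD in f0 f1.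
have wt := omega_tr D.
have tE : t = (qt D)%:~R - omega D + (u s)%:~R - (u 0)%:~R by rewrite /t -wt intrB; ring.
have a : (u s + qt D - 2 * u 0)%:~R < 1 :> R by rewrite intrB intrD intrM; lra.
have b : -1 < (u s + qt D - 2 * u 0)%:~R :> R.
  have : omega D != (u 0)%:~R.
    apply/eqP => e; have := e1cc_neq0 2; rewrite ccS cc1 e1D mulr1 e1_int.
    have -> : e1 (cc 0) = - omega D by rewrite /cc /= e1N /om /emb1 /= mul1r add0r.
    by rewrite -e addNr eqxx.
  rewrite intrB intrD intrM => ne; have : (u 0)%:~R < omega D by rewrite lt_neqAle eq_sym ne.
  lra.
have {}b : (-1 : int)%:~R < (u s + qt D - 2 * u 0)%:~R :> R by [].
rewrite ltrz1 in a; rewrite ltr_int in b.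
by move: a b; rewrite /qt; case: (D1mod4 D) => /=; lia.
Qed.

(** As s is odd, shifting by s exchanges the parities, so the odd indices below 2 s meet each class
    modulo s once. *)
Lemma sum_odd_double (g : nat -> int) s : odd s -> (forall i, (0 < i)%N -> g (i + s)%N = g i) ->
  \sum_(0 <= k < 2 * s | odd k) g k = \sum_(1 <= k < s) g k + g s.
Proof.
move=> os pg; have s0 : (0 < s)%N by case: s os {pg}.
rewrite mul2n -addnn (big_cat_nat (n := s)) //= ?leq_addr //.
rewrite -{2}[s]add0n big_addn addnK.
rewrite [X in _ + X = _](_ : _ = \sum_(0 <= k < s | ~~ odd k) g (k + s)%N); last first.
  by apply: eq_bigl => k; rewrite oddD os; case: (odd k).
rewrite [X in _ + X = _]big_ltn_cond //= add0n.
rewrite [X in _ + (_ + X) = _](_ : _ = \sum_(1 <= k < s | ~~ odd k) g k); last first.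
  rewrite big_nat_cond [RHS]big_nat_cond; apply: eq_bigr => k /andP[/andP[k1 _] _]; exact: pg.
rewrite big_ltn_cond //=; rewrite addrCA addrC; congr (_ + _).
by rewrite [RHS](bigID odd).
Qed.

(** The three cases of the definition merge: for odd s the index s contributes u_s = 2 u_0, lowered
    by 1 if D is 1 modulo 4. *)
Lemma M_DE s : is_period D s -> M_D D s = \sum_(0 <= k < evper s | odd k) u k.
Proof.
move=> ps; rewrite /M_D /M_gen /evper; case os : (odd s) => /=; last first.
  rewrite subr0 [RHS]big_ltn_cond //=; last by case: ps.
  by apply: eq_bigl => k; rewrite andbT.
rewrite sum_odd_double //; last by case: ps.
by rewrite (u_period_end ps); case: (D1mod4 D) => /=; ring.
Qed.

(** The factor 2 pays for the term 2 u_0, which is at most 2 u_s; if u_0 passes the threshold, so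
    does u_s. *)
Lemma M_gen_le s (P : int -> bool) : is_period D s ->
  (forall a b, a <= b -> P a -> P b) ->
  M_gen D s P <= 2 * \sum_(0 <= k < evper s | odd k && P (u k)) u k.
Proof.
move=> ps mono; rewrite /M_gen /evper; case os : (odd s) => /=; last first.
  have s0 : (0 < s)%N by case: ps.
  rewrite [X in _ <= _ * X]big_ltn_cond //=.
  set S := \sum_(_ <= _ < _ | _) _.
  have : 0 <= S by apply: sumr_ge0 => i _; apply: le_trans (cf_u_ge1 i).
  lia.
rewrite [X in _ <= 2 * X]big_mkcondr /=.
rewrite (sum_odd_double (g := fun k => if P (u k) then u k else 0)) //; last by move=> i i0; case: ps => _ ->.
rewrite -big_mkcond /=; set S := \sum_(_ <= _ < _ | _) _.
have S0 : 0 <= S by apply: sumr_ge0 => i _; apply: le_trans (cf_u_ge1 i).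
have us := u_period_end ps; have u0 := cf_u_ge1 0.
have le : u 0 <= u s by move: us; case: (D1mod4 D) => /=; lia.
have le2 : u 0 <= u s by [].
case: ifP => p0; last by have := cf_u_ge1 s; case: ifP; lia.
rewrite (mono _ _ le p0); lia.
Qed.
End CF.

(** * A universal form with 8 M_D variables *)

Section Universal.
Variable D : nat.
Hypothesis D1 : (1 < D)%N.
Hypothesis sqfD : squarefree D.
Local Notation e1 := (@emb1 D : QI D -> R).
Local Notation e2 := (@emb2 D : QI D -> R).
Local Notation u := (cf_u D).
Local Notation x := (cf_x D).
Local Notation cc := (cc D).

(** * The first lower bound *)

Lemma universal_gt0 m (a : 'I_m -> QI D) : diag_universal D a -> (0 < m)%N.
Proof.
case: m a => // a [_ rep]; have [] := rep (1 : QI D); first by apply/tpP/tp1.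
by move=> z; rewrite (diag_formE a z) big_ord0.
Qed.

Lemma u_le_2m m (a : 'I_m -> QI D) k : diag_universal D a -> odd k -> u k <= (2 * m)%N%:Z.
Proof.
move=> ua ok; have u0 := cf_u_ge1 D1 sqfD k.
have [n un] : exists n : nat, u k = n%:Z by exists `|u k|%N; rewrite gez0_abs //; lia.
have mv : mp (cc k.+1) by apply: mp_cc; rewrite //= ok.
have tg (r : 'I_n) : tp (cc k + (r : nat)%:Z%:~R * cc k.+1).
  by apply: tp_cc_strip => //; rewrite un; have := ltn_ord r; lia.
have wg (r : 'I_n) : wd (cc k + (r : nat)%:Z%:~R * cc k.+1) (cc k.+1) = 1.
  by rewrite wdDl wdZl wdxx mulr0 addr0 wd_cc_odd.
(* The boolean is the sign of N z: two points with the same coefficient and the same sign coincide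
   by [strip_same_coef]. *)
pose P (r : 'I_n) (b : 'I_m * bool) :=
  exists z, cc k + (r : nat)%:Z%:~R * cc k.+1 = a b.1 * z ^+ 2 /\ (0 < nm z) = b.2.
suff : (#|[set: 'I_n]| <= #|[set: 'I_m * bool]|)%N.
  by rewrite !cardsT card_prod card_bool !card_ord un; lia.
apply: (card_inj_rel (P := P)).
  move=> r _; have [i [z e]] := single_term D1 sqfD ua (tg r) mv (wg r).
  by exists (i, 0 < nm z); [rewrite inE | exists z].
move=> r r' [i s] _ _ [z [e s1]] [z' [e' s2]] /=.
have : (r' : nat)%:Z - (r : nat)%:Z = 0.
  apply: (strip_same_coef D1 (a := a i) (x := z) (y := z') (v := cc k.+1)
    (g := cc k + (r : nat)%:Z%:~R * cc k.+1)) => //.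
  - by rewrite -addrA -mulrDl -intrD subrKC; exact: tg.
  - by rewrite -addrA -mulrDl -intrD subrKC.
  have tz w q : tp w -> w = a i * q ^+ 2 -> nm q != 0.
    by move=> tw ew; apply: contraTneq (tp_nm tw) => q0; rewrite ew nmM nmX q0 expr0n mulr0 ltxx.
  have z0 := tz _ _ (tg r) e; have z1 := tz _ _ (tg r') e'.
  move: s1 s2 => /= s1 s2; have : (0 < nm z) = (0 < nm z') by rewrite s1 s2.
  by case: (ltrP 0 (nm z)) => p1 /esym; [|move/negbT; rewrite -leNgt] => p2; nia.
by move=> h; apply: val_inj => /=; lia.
Qed.

Lemma M_le s m (a : 'I_m -> QI D) : is_period D s -> diag_universal D a ->
  M_D D s <= (evper s * m)%N%:Z.
Proof.
move=> ps ua; rewrite M_DE //.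
have : \sum_(0 <= k < evper s | odd k) u k <= \sum_(0 <= k < evper s | odd k) (2 * m)%N%:Z.
  by apply: ler_sum => k ok; apply: u_le_2m ua ok.
move/le_trans; apply.
have [t ->] : exists t, evper s = t.*2.
  by exists (evper s)./2; rewrite -[LHS]odd_double_half evper_odd.
elim: t => [|t IH]; first by rewrite big_geq.
rewrite doubleS [X in X <= _]big_mkcond !big_nat_recr //= -big_mkcond odd_double /= addr0.
have -> : (t.*2.+2 * m)%N = (t.*2 * m + 2 * m)%N by ring.
by rewrite PoszD lerD2r.
Qed.

(** The right end cc_(k+2) of each strip is left out, as it opens the next one. *)
Definition blocks (K : nat) : seq (QI D) :=
  flatten [seq [seq cc k + r%:Z%:~R * cc k.+1 | r <- iota 0 `|u k|%N] | k <- [seq k <- iota 0 K | odd k]].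

Lemma size_blocks K : (size (blocks K))%:Z = \sum_(0 <= k < K | odd k) u k.
Proof.
rewrite /blocks size_flatten /shape -map_comp.
rewrite (eq_map (g := fun k => `|u k|%N)); last by move=> k /=; rewrite size_map size_iota.
rewrite sumnE big_map big_filter /index_iota subn0 -[LHS]natz natr_sum.
apply: eq_bigr => k _; rewrite natz gez0_abs //; apply: le_trans (cf_u_ge1 D1 sqfD k); lia.
Qed.

Lemma mem_blocks K k (r : nat) : odd k -> (k < K)%N -> r%:Z < u k ->
  cc k + r%:Z%:~R * cc k.+1 \in blocks K.
Proof.
move=> ok kK ru; apply/flatten_mapP; exists k; first by rewrite mem_filter ok mem_iota.
by apply/mapP; exists r => //; rewrite mem_iota; lia.
Qed.

Lemma tp_blocks K y : y \in blocks K -> tp y.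
Proof.
case/flatten_mapP=> k; rewrite mem_filter mem_iota => /andP[ok _] /mapP[r].
rewrite mem_iota => rk ->; apply: tp_cc_strip => //.
by have := cf_u_ge1 D1 sqfD k; move: rk => /=; lia.
Qed.

(** Each entry is taken four times as a coefficient: position j stands for entry j / 4 and variable
    j mod 4. *)
Lemma diag_universal_seq (ys : seq (QI D)) : {in ys, forall y, tp y} ->
  (forall al, tp al -> exists y1 y2 (c1 c2 : nat -> QI D),
     [/\ y1 \in ys, y2 \in ys, y1 != y2 &
      al = y1 * (c1 0%N ^+ 2 + c1 1%N ^+ 2 + c1 2%N ^+ 2 + c1 3%N ^+ 2) +
           y2 * (c2 0%N ^+ 2 + c2 1%N ^+ 2 + c2 2%N ^+ 2 + c2 3%N ^+ 2)]) ->
  has_diag_universal D (size ys * 4).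
Proof.
move=> tys rep.
pose a (j : 'I_(size ys * 4)) : QI D := nth 0 ys (j %/ 4).
exists a; split.
  by move=> j; apply/tpP/tys; rewrite mem_nth // ltn_divLR // ltn_ord.
move=> al /tpP /rep [y1 [y2 [c1 [c2 [m1 m2 ne ->]]]]].
pose g i : nat -> QI D := if i == index y1 ys then c1 else if i == index y2 ys then c2 else fun=> 0.
pose z (j : 'I_(size ys * 4)) : QI D := g (j %/ 4)%N (j %% 4)%N.
exists z; rewrite (diag_formE a z).
rewrite -(big_mkord xpredT (fun j => nth 0 ys (j %/ 4) * (g (j %/ 4)%N (j %% 4)%N * g (j %/ 4)%N (j %% 4)%N))).
have -> n : \sum_(0 <= j < n * 4) nth 0 ys (j %/ 4) * (g (j %/ 4)%N (j %% 4)%N * g (j %/ 4)%N (j %% 4)%N)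
  = \sum_(0 <= i < n) nth 0 ys i * (g i 0%N ^+ 2 + g i 1%N ^+ 2 + g i 2%N ^+ 2 + g i 3%N ^+ 2).
  elim: n => [|n IH]; first by rewrite !big_geq.
  rewrite mulSn addnC !addnS addn0 !big_nat_recr //= IH -!addrA; congr (_ + _).
  have q k : (k < 4)%N -> ((n * 4 + k) %/ 4 = n)%N /\ ((n * 4 + k) %% 4 = k)%N.
    by move=> k4; rewrite divnMDl // divn_small // addn0 modnMDl modn_small.
  have [d0 r0] := q 0%N isT; have [d1 r1] := q 1%N isT; have [d2 r2] := q 2%N isT.
  have [d3 r3] := q 3%N isT.
  rewrite addn0 in d0 r0; rewrite addn1 in d1 r1; rewrite addn2 in d2 r2; rewrite addn3 in d3 r3.
  by rewrite d0 d1 d2 d3 r0 r1 r2 r3; ring.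
have i12 : index y2 ys == index y1 ys = false.
  apply/negP => /eqP e; case/negP: ne; apply/eqP.
  by rewrite -(nth_index 0 m1) -(nth_index 0 m2) e.
rewrite big_mkord.
pose i1 : 'I_(size ys) := Ordinal (etrans (index_mem y1 ys) m1).
pose i2 : 'I_(size ys) := Ordinal (etrans (index_mem y2 ys) m2).
rewrite (bigD1 i1) //= (bigD1 i2) /=; last by rewrite -val_eqE /= i12.
rewrite big1; last first.
  move=> i /andP[n1 n2]; rewrite /g -!val_eqE /= in n1 n2 *.
  by rewrite (negPf n1) (negPf n2) expr0n /= !addr0 mulr0.
by rewrite !nth_index // /g eqxx i12 eqxx addr0.
Qed.

Lemma e2cc_homo k l : (k <= l)%N -> e2 (cc k.+1) <= e2 (cc l.+1).
Proof.
elim: l => [|l IH]; first by rewrite leqn0 => /eqP->.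
rewrite leq_eqVlt => /orP[/eqP->//|]; rewrite ltnS => /IH h.
by apply: le_trans h _; apply: ltW; have [] := e2cc D1 sqfD l.
Qed.

Lemma e2cc3_gt2 : 2 < e2 (cc 3).
Proof.
have [_ l1] := e2cc D1 sqfD 0; rewrite cc1 e2_1 in l1.
have u1 : 1 <= (u 1)%:~R :> R by rewrite ler1z cf_u_ge1.
rewrite ccS e2D e2M e2_int cc1 e2_1.
have : e2 (cc 2) <= (u 1)%:~R * e2 (cc 2) by rewrite ler_peMl // ltW // (lt_trans ltr01).
lra.
Qed.

(** * A cone containing each totally positive element up to squared units *)

Section Sector.
Variable s : nat.
Hypothesis ps : is_period D s.
Local Notation T := (evper s).
Let pT := evper_period ps.
Let eta : QI D := epsT D T.
Let T2 : (1 < T)%N.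
Proof. by case: pT => T0 _; have := evper_odd s; case: T T0 => [|[]]. Qed.

Lemma nm_eta : nm eta = 1.
Proof. by rewrite /eta nm_epsT // -signr_odd evper_odd. Qed.
Lemma tp_eta : tp eta.
Proof. by apply: tp_cc; rewrite //= evper_odd. Qed.
Lemma e2_eta : 2 < e2 eta.
Proof. by apply: lt_le_trans e2cc3_gt2 _; apply: (@e2cc_homo 2). Qed.
Lemma e1_eta : e1 eta < 1.
Proof.
have e : e1 eta * e2 eta = 1 by rewrite e12_nm nm_eta.
have h2 := e2_eta; have /andP[a b] := tp_eta.
rewrite ltNge; apply/negP => h; have : e2 eta <= e1 eta * e2 eta by rewrite ler_peMl // ltW.
by rewrite e; lra.
Qed.
Lemma eta_pow n : e1 (eta ^+ n) <= 1 /\ n%:R <= e2 (eta ^+ n).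
Proof.
have /andP[a b] := tp_eta; rewrite e1X e2X; split.
  by rewrite exprn_ile1 // ltW // e1_eta.
apply: (@le_trans _ _ (2 ^+ n)); first by rewrite -natrX ler_nat ltnW // ltn_expl.
by rewrite lerXn2r // ?nnegrE ?ltW // e2_eta.
Qed.
Lemma wd_sign (y z : QI D) : (0 <= wd y z) = (e2 y * e1 z <= e1 y * e2 z).
Proof. by rewrite -[RHS]subr_ge0 (e12_wd y z) pmulr_lge0 ?sD_gt0 // ler0z. Qed.
Lemma wd_eta n y z : wd (eta ^+ n * y) (eta ^+ n * z) = wd y z.
Proof. by rewrite wdM nmX nm_eta expr1n mul1r. Qed.
Lemma conj_eta n : conj eta ^+ n * eta ^+ n = 1.
Proof. by rewrite -exprMn mulrC mul_conj nm_eta expr1n. Qed.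
Lemma cc_end : cc (2 * T).+1 = eta ^+ 2.
Proof.
by rewrite mul2n -addnn -addSn cc_shift // -[T.+1]add1n addnC addn1 expr2.
Qed.

Lemma archi_nat (c : R) : exists n : nat, c < n%:R.
Proof.
exists (Num.bound `|c|); apply: le_lt_trans (ler_norm c) _.
by have := archi_boundP (normr_ge0 c).
Qed.

Lemma le_sqr_nat (n : nat) (b : R) : n%:R <= b -> n%:R <= b ^+ 2.
Proof.
case: n => [|n] h; first exact: sqr_ge0.
have b1 : 1 <= b by apply: le_trans h; rewrite ler1n.
by apply: le_trans h _; rewrite expr2 ler_peMl // (le_trans ler01).
Qed.

(** Powers of eta^2 turn past any totally positive direction, since the first embedding of eta is
    below 1 and the second above 2. Dividing by the last power not past al lands in the cone from 1
    to eta^2. *)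
Lemma sector_up al : tp al -> 0 <= wd 1 al -> exists n be,
  [/\ al = (eta ^+ n) ^+ 2 * be, tp be, 0 <= wd 1 be & wd (eta ^+ 2) be < 0].
Proof.
move=> /andP[a1 a2] w0.
pose P n := wd ((eta ^+ 2) ^+ n) al < 0.
have exP : exists n, P n.
  have [n hn] := archi_nat (e2 al / e1 al); exists n.
  rewrite /P ltNge wd_sign -ltNge -exprM mulnC exprM.
  have [h1 h2] := eta_pow n; rewrite ltr_pdivrMr // in hn.
  rewrite !(e1X, e2X); rewrite e1X in h1; rewrite e2X in h2.
  have h0 : 0 <= e1 eta ^+ n by rewrite exprn_ge0 //; case/andP: tp_eta => /ltW.
  have h3 : (e1 eta ^+ n) ^+ 2 * e2 al <= e2 al.
    by apply: ler_piMl; [exact: ltW | exact: exprn_ile1].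
  apply: le_lt_trans h3 (lt_le_trans hn _).
  by rewrite ler_wpM2r ?(ltW a1) //; apply: le_sqr_nat.
case: (ex_minnP exP) => n Pn minn.
have n0 : (0 < n)%N by case: n Pn {minn} => //; rewrite /P expr0 ltNge w0.
exists n.-1, (conj eta ^+ (2 * n.-1) * al); set be := conj eta ^+ _ * al.
have e : al = (eta ^+ n.-1) ^+ 2 * be.
  by rewrite /be mulrA -exprM [(n.-1 * 2)%N]mulnC [_ * conj eta ^+ _]mulrC conj_eta mul1r.
have e' : al = eta ^+ (2 * n.-1) * be by rewrite {1}e -exprM mulnC.
split => //.
- apply: (@tp_divr D (eta ^+ (2 * n.-1))); last by rewrite -e' /tp a1 a2.
  rewrite exprM; elim: n.-1 => [|i IH]; first by rewrite expr0 tp1.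
  by rewrite exprS; apply: tpM => //; rewrite expr2; apply: tpM; apply: tp_eta.
- rewrite leNgt; apply/negP => h; have := minn n.-1; rewrite /P -exprM {1}e'.
  by rewrite -[eta ^+ _ in X in wd X _]mulr1 wd_eta h => /(_ isT); rewrite leqNgt ltn_predL n0.
- by move: Pn; rewrite /P -(prednK n0) exprS -exprM [eta ^+ 2 * _]mulrC {1}e' wd_eta.
Qed.

(** A squared power of eta first brings al to the correct side of 1, which [sector_up] assumes. *)
Lemma sector al : tp al -> exists th be,
  [/\ al = th ^+ 2 * be, tp be, 0 <= wd 1 be & wd (eta ^+ 2) be < 0].
Proof.
move=> ta; have /andP[a1 a2] := ta.
have [n hn] := archi_nat (e1 al / e2 al); rewrite ltr_pdivrMr // in hn.
have tn i : tp (eta ^+ i).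
  by elim: i => [|i IH]; rewrite ?expr0 ?tp1 // exprS tpM // tp_eta.
have [|k [be [e t h1 h2]]] := sector_up (tpM (tn (n * 2)%N) ta).
  rewrite wd_sign e1_1 e2_1 !mul1r e1M e2M.
  have [h1 h2] := eta_pow n; rewrite e1X in h1; rewrite e2X in h2.
  have h0 : 0 <= e1 eta ^+ n by rewrite exprn_ge0 //; case/andP: tp_eta => /ltW.
  rewrite e1X e2X exprM [e2 eta ^+ _]exprM.
  have h3 : (e1 eta ^+ n) ^+ 2 * e1 al <= e1 al.
    by apply: ler_piMl; [exact: ltW | exact: exprn_ile1].
  apply: (le_trans h3); apply: (le_trans (ltW hn)).
  by rewrite ler_wpM2r ?(ltW a2) //; apply: le_sqr_nat.
exists (conj eta ^+ n * eta ^+ k), be; split => //.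
rewrite exprMn -mulrA -e mulrA -exprM conj_eta mul1r //.
Qed.

(** Two searches for a change of sign: first along the convergents of odd index, then along the
    strip between two of them. *)
Lemma wd_block be : 0 <= wd 1 be -> wd (eta ^+ 2) be < 0 ->
  exists k (r : nat), [/\ odd k, (k < 2 * T)%N, r%:Z < u k,
    0 <= wd (cc k + r%:Z%:~R * cc k.+1) be &
    wd (cc k + r.+1%:Z%:~R * cc k.+1) be < 0].
Proof.
move=> h1 h2.
pose P i := wd (cc (2 * i).+1) be < 0.
have PT : P T by rewrite /P cc_end.
have exP : exists i, P i by exists T.
case: (ex_minnP exP) => i Pi mini.
have i0 : (0 < i)%N by case: i Pi {mini} => //; rewrite /P muln0 cc1 ltNge h1.
pose k := (2 * i.-1).+1.
have kE : (2 * i).+1 = k.+2 by rewrite /k; lia.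
have ok : odd k by rewrite /k /= oddM.
have wk : 0 <= wd (cc k) be.
  rewrite leNgt; apply/negP => h; have := mini _ h; lia.
have wk2 : wd (cc k.+2) be < 0 by rewrite -kE.
pose Q (r : nat) := wd (cc k + r%:Z%:~R * cc k.+1) be < 0.
have u0 := cf_u_ge1 D1 sqfD k.
have exQ : exists r, Q r.
  by exists `|u k|%N; rewrite /Q gez0_abs -?ccS //; lia.
case: (ex_minnP exQ) => r Qr minr.
have r0 : (0 < r)%N by case: r Qr {minr} => //; rewrite /Q mul0r addr0 ltNge wk.
exists k, r.-1; split => //.
- by have := mini _ PT; rewrite /k; lia.
- have : (r <= `|u k|)%N by apply: minr; rewrite /Q gez0_abs -?ccS //; lia.
  lia.
- by rewrite leNgt; apply/negP => h; have := minr _ h; lia.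
- by rewrite prednK.
Qed.

(** Two even periods give 2 M_D points, each used four times. Stopping at eta^2 rather than eta
    makes the last vector a square times the first one, so it needs no new coefficient. *)
Lemma has_universal_8M : exists n : nat, n%:Z = 8 * M_D D s /\ has_diag_universal D n.
Proof.
exists (size (blocks (2 * T)) * 4)%N; split.
  have := size_blocks (2 * T); rewrite M_DE // PoszM => ->.
  rewrite mul2n -addnn (big_cat_nat (n := T)) //= ?leq_addr //.
  rewrite -{2}[T]add0n big_addn addnK.
  rewrite [X in _ + X](_ : _ = \sum_(0 <= k < T | odd k) u k); first by ring.
  apply: congr_big_nat => //.
    by move=> k _; rewrite oddD evper_odd addbF.
  move=> k /andP[ok _]; have k0 : (0 < k)%N by case: k ok => //; rewrite add0n evper_odd.
  by case: pT => _ ->.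
apply: diag_universal_seq; first by move=> y /tp_blocks.
move=> al /sector [th [be [-> tbe h1 h2]]].
have [k [r [ok kT ru w1 w2]]] := wd_block h1 h2.
set y := cc k + _ in w1.
set y' := cc k + _ in w2.
have y'E : y' = y + cc k.+1.
  by rewrite /y' /y -addn1 PoszD intrD mulrDl mul1r addrA.
have wyy : wd y y' = 1.
  by rewrite y'E wdDr wdxx add0r /y wdDl wdZl wdxx mulr0 addr0 wd_cc_odd.
have yb : y \in blocks (2 * T) by apply: mem_blocks.
have [q [y2 [y2b nyy y2E]]] : exists q y2, [/\ y2 \in blocks (2 * T), y != y2 & y' = y2 * q ^+ 2].
  have [rl|rl] := ltP r.+1%:Z (u k).
    exists 1, y'; split; [exact: mem_blocks | | by rewrite expr1n mulr1].
    by apply/eqP => e; move: wyy; rewrite -e wdxx.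
  have y'c : y' = cc k.+2 by rewrite ccS /y'; congr (_ + _%:~R * _); lia.
  have [k2|k2] := ltnP k.+2 (2 * T).
    exists 1, y'; split; last by rewrite expr1n mulr1.
      have -> : y' = cc k.+2 + 0%:Z%:~R * cc k.+3 by rewrite mul0r addr0.
      by apply: mem_blocks; rewrite //= ?ok // (lt_le_trans _ (cf_u_ge1 D1 sqfD _)).
    by apply/eqP => e; move: wyy; rewrite -e wdxx.
  have kE : k.+1 = (2 * T)%N.
    apply/eqP; rewrite eqn_leq kT /=; move: k2; rewrite leq_eqVlt => /orP[/eqP e|]; last by [].
    by move: (congr1 odd e); rewrite oddM /= ok.
  (* Wrap-around: y' = eta^2 is represented through the coefficient 1. The second embedding of y
     exceeds 2, so y differs from 1. *)
  exists eta, 1; split.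
  - have -> : 1 = cc 1 + 0%:Z%:~R * cc 2 by rewrite mul0r addr0.
    apply: mem_blocks => //; first by lia.
    exact: lt_le_trans (cf_u_ge1 D1 sqfD 1).
  - apply/eqP => e; have : 1 < e2 y; last by rewrite e e2_1 ltxx.
    apply: (@lt_trans _ _ 2); first by rewrite ltr1n.
    apply: lt_le_trans e2cc3_gt2 _; rewrite /y e2D e2M e2_int.
    apply: le_trans (_ : e2 (cc k) <= _).
      by have := @e2cc_homo 2 k.-1; rewrite prednK ?odd_gt0 //; apply; lia.
    have [p _] := e2cc D1 sqfD k.+1.
    by rewrite lerDl mulr_ge0 // ltW.
  - by rewrite mul1r y'c kE cc_end.
have [f fE] : exists f : nat, wd y be = f by exists `|wd y be|%N; rewrite gez0_abs.
have [e eE] : exists e : nat, wd be y' = e.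
  by exists `|wd be y'|%N; rewrite gez0_abs // wdC oppr_ge0 ltW.
have [a [b [c [d s1]]]] := lagrange_sum4 e.
have [a' [b' [c' [d' s2]]]] := lagrange_sum4 f.
exists y, y2, (fun i => th * (nth 0 [:: a; b; c; d] i)%:~R), (fun i => th * q * (nth 0 [:: a'; b'; c'; d'] i)%:~R).
split => //=.
rewrite (basis_exp be wyy) eE fE s1 s2 y2E !intrD !rmorphXn /=; ring.
Qed.
End Sector.
End Universal.

(** * Roots of the norm form on a strip *)

Lemma dvdz_sub (d m n : int) : (d %| m)%Z -> (d %| n)%Z -> (d %| m - n)%Z.
Proof. exact: rpredB. Qed.
Lemma dvdz_add (d m n : int) : (d %| m)%Z -> (d %| n)%Z -> (d %| m + n)%Z.
Proof. exact: rpredD. Qed.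
Lemma modn_dvdz (q r t : nat) : (q%:Z %| r%:Z - t%:Z)%Z -> (r = t %[mod q])%N.
Proof. by rewrite -eqz_mod_dvd !modz_nat => /eqP[]. Qed.
Lemma dvdz_gcd_mul (e c x : int) : (e %| c * x)%Z -> (e %| gcdz e c * x)%Z.
Proof.
move=> h; have [a [b <-]] := Bezoutz e c.
by rewrite mulrDl -!mulrA dvdz_add // dvdz_mull // dvdz_mulr.
Qed.

Lemma dvdz_sqr_prime (p : nat) (a : int) : prime p -> (p%:Z ^+ 2 %| a ^+ 2)%Z = (p %| a)%Z.
Proof. by move=> pp; rewrite !dvdzE !abszX /= dvdn_pexp2r. Qed.

Section Roots.
Variable D : nat.
Hypothesis D1 : (1 < D)%N.
Hypothesis sqfD : squarefree D.
Let D0 : (0 < D)%N. Proof. exact: ltnW. Qed.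

Lemma disc_sqr_le2 (k : int) : (k ^+ 2 %| disc D)%Z -> (`|k| <= 2)%N.
Proof.
move=> h; apply: (sqf_sqr_le2 sqfD).
by have := dvdz_trans h (disc_dvd D0); rewrite dvdzE abszX abszM.
Qed.

Lemma disc_sqr_prime (p : nat) : prime p -> (2 < p)%N -> ~~ (p%:Z ^+ 2 %| disc D)%Z.
Proof. by move=> pp p2; apply/negP => /disc_sqr_le2 /=; rewrite leqNgt p2. Qed.

Lemma tr_disc1 (g v : QI D) : wd g v = 1 ->
  tr (g * conj v) ^+ 2 = disc D + 4 * (nm g * nm v).
Proof. by move=> h; rewrite tr_disc h expr1n mulr1. Qed.

(** If p divided the trace, p^2 would divide the discriminant, forcing p = 2; modulo 4 this
    contradicts either the choice of omega or the square-freeness of D. *)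
Lemma sqr_root_simple (g v : QI D) (p : nat) : wd g v = 1 -> prime p ->
  (p%:Z ^+ 2 %| nm g)%Z -> ~~ (p %| tr (g * conj v))%Z.
Proof.
move=> h pp pg; apply/negP => pt; have e := tr_disc1 h.
have pt2 : (p%:Z ^+ 2 %| tr (g * conj v) ^+ 2)%Z by rewrite dvdz_sqr_prime.
have pd : (p%:Z ^+ 2 %| disc D)%Z.
  have -> : disc D = tr (g * conj v) ^+ 2 - 4 * (nm g * nm v) by rewrite e addrK.
  by rewrite dvdz_sub // dvdz_mull // dvdz_mulr.
have p2 : p = 2%N.
  by have := disc_sqr_le2 pd; have := prime_gt1 pp => /= a b; apply/eqP; rewrite eqn_leq a b.
rewrite {}p2 {p pp pt} in pg pd pt2.
have n4 : ~~ (4 %| D)%N by exact: (sqfD (p := 2)).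
have [d1|d1] := boolP (D1mod4 D).
  by move: pd n4; rewrite /disc /qt /qn d1; move/eqP: d1 => d1; lia.
have hd : disc D = 4 * D%:Z by rewrite /disc /qt /qn (negPf d1); ring.
move: e; rewrite hd; have -> : tr (g * conj v) = 2 * (g * conj v).1.
  by rewrite /tr /qt (negPf d1) mul0r addr0.
case/dvdzP: pg => k ->; move: (g * conj v).1 (nm v) => a b e.
have {}e : a ^+ 2 = D%:Z + 4 * (k * b) by lia.
have [c [ac|ac]] : exists c : int, a = 2 * c \/ a = 2 * c + 1.
  exists (a %/ 2)%Z; have := divz_eq a 2; have := modz_ge0 a (isT : 2 != 0 :> int).
  by have := ltz_pmod a (isT : 0 < 2 :> int); lia.
  case/negP: n4; have : (4 %| D%:Z)%Z.
    by apply/dvdzP; exists (c ^+ 2 - k * b); rewrite ac in e; lia.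
  by rewrite dvdzE.
case/negP: d1; rewrite /D1mod4; apply/eqP.
have : D%:Z = 1 + 4 * (c ^+ 2 + c - k * b) by rewrite ac in e; lia.
by move: (c ^+ 2 + c - k * b) => z; lia.
Qed.

(** * The quadratic values along a strip *)

Section Strip.
Variables g v : QI D.
Hypothesis gv : wd g v = 1.
Definition stp (r : int) : QI D := g + r%:~R * v.
Local Notation f r := (nm (stp r)).
Local Notation c := (nm v).
Local Notation t0 := (tr (g * conj v)).

Lemma wd_stp r : wd (stp r) v = 1.
Proof. by rewrite /stp wdDl wdZl wdxx mulr0 addr0. Qed.
Lemma prim_stp r : prim (stp r).
Proof. by exists (- v); rewrite wdNl wdC opprK wd_stp. Qed.
Lemma tr_stp r : tr (stp r * conj v) = t0 + 2 * r * c.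
Proof.
rewrite /stp mulrDl -[r%:~R * v * _]mulrA mul_conj -intrM.
rewrite /tr qintE /=; ring.
Qed.
Lemma nm_stp r : f r = nm g + r * t0 + r ^+ 2 * c.
Proof. by rewrite /stp nmD trZr nmZ. Qed.
Lemma nm_stpB r t : f r - f t = (r - t) * (t0 + c * (r + t)).
Proof. by rewrite !nm_stp; ring. Qed.

Lemma coprime_sqr_primeP (p : nat) (a b : int) : prime p -> ~~ (p %| a)%Z ->
  (p%:Z ^+ 2 %| a * b)%Z -> (p%:Z ^+ 2 %| b)%Z.
Proof.
move=> pp na; rewrite Gauss_dvdzr // coprimezE abszX coprimeXl //=.
by rewrite prime_coprime.
Qed.

(** Roots modulo p are simple, so p^2 divides one of the two factors of f r - f r0, and not p in
    each. This leaves at most two classes modulo p^2. *)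
Lemma sqr_roots_card (p U : nat) : prime p ->
  (#|[set r : 'I_U | (p%:Z ^+ 2 %| f (r : nat)%:Z)%Z]| <= 2 * (U %/ p ^ 2 + 1))%N.
Proof.
move=> pp; set X := [set _ | _].
have pq : (0 < p ^ 2)%N by rewrite expn_gt0 prime_gt0.
have modP (r t : nat) : (p%:Z ^+ 2 %| r%:Z - t%:Z)%Z -> (r = t %[mod p ^ 2])%N.
  by rewrite -[p%:Z ^+ 2]/((p ^ 2)%N%:Z); exact: modn_dvdz.
have [->|[r0 Xr0]] := set_0Vmem X; first by rewrite cards0.
have key r : r \in X -> ~~ (p %| t0 + 2 * (r : nat)%:Z * c)%Z.
  by rewrite inE => h; rewrite -tr_stp; apply: sqr_root_simple => //; apply: wd_stp.
pose Q (r : 'I_U) := t0 + c * ((r : nat)%:Z + (r0 : nat)%:Z).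
pose X1 := [set r in X | (p%:Z ^+ 2 %| (r : nat)%:Z - (r0 : nat)%:Z)%Z].
pose X2 := X :\: X1.
have sub : (#|X| <= #|X1| + #|X2|)%N.
  by rewrite -(cardsID X1 X) leq_add2r subset_leq_card // subsetIr.
apply: leq_trans sub _; rewrite mul2n -addnn leq_add //; apply: card_congr_set => // r t.
  rewrite !inE => /andP[_ h1] /andP[_ h2]; apply: modP.
  have -> : (r : nat)%:Z - (t : nat)%:Z = (r : nat)%:Z - (r0 : nat)%:Z - ((t : nat)%:Z - (r0 : nat)%:Z) by ring.
  exact: dvdz_sub.
have inX2 s : s \in X2 -> (p%:Z ^+ 2 %| Q s)%Z.
  rewrite !inE => /andP[]; case Xs : (_ %| f _)%Z => //= h _.
  have Xs' : s \in X by rewrite inE.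
  have pd : (p%:Z ^+ 2 %| ((s : nat)%:Z - (r0 : nat)%:Z) * Q s)%Z.
    by rewrite -nm_stpB dvdz_sub //; move: Xr0; rewrite inE.
  have [pQ|pQ] := boolP (p %| Q s)%Z; last first.
    by case/negP: h; apply: (coprime_sqr_primeP pp pQ); rewrite mulrC.
  apply: (coprime_sqr_primeP pp _ pd); apply/negP => pr.
  case/negP: (key _ Xr0).
  have -> : t0 + 2 * (r0 : nat)%:Z * c = Q s - c * ((s : nat)%:Z - (r0 : nat)%:Z) by rewrite /Q; ring.
  by rewrite dvdz_sub // dvdz_mull.
move=> r2 t2; apply: modP; have h1 := inX2 _ r2; have h2 := inX2 _ t2.
apply: (@coprime_sqr_primeP p c) => //; last first.
  have -> : c * ((r : nat)%:Z - (t : nat)%:Z) = Q r - Q t by rewrite /Q; ring.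
  exact: dvdz_sub.
(* If p divided c, then p would divide the derivative at r0. *)
apply/negP => pc; case/negP: (key _ Xr0).
have -> : t0 + 2 * (r0 : nat)%:Z * c = Q r + c * ((r0 : nat)%:Z - (r : nat)%:Z) by rewrite /Q; ring.
rewrite dvdz_add ?dvdz_mulr //; apply: dvdz_trans h1; by rewrite expr2 dvdz_mulr.
Qed.

(** Modulo p the form is linear in r, and its slope is nonzero, for otherwise p^2 would divide the
    discriminant. So one class remains. *)
Lemma roots_dvd_card (p U : nat) : prime p -> (2 < p)%N -> (p %| c)%Z ->
  (#|[set r : 'I_U | (p %| f (r : nat)%:Z)%Z]| <= U %/ p + 1)%N.
Proof.
move=> pp p2 pc; apply: card_congr_set; first exact: prime_gt0.
move=> r t; rewrite !inE => hr ht; apply: modn_dvdz.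
have : (p %| ((r : nat)%:Z - (t : nat)%:Z) * (t0 + c * ((r : nat)%:Z + (t : nat)%:Z)))%Z.
  by rewrite -nm_stpB dvdz_sub.
rewrite dvdzE abszM Euclid_dvdM // => /orP[//|] pQ; exfalso.
have pt : (p %| t0)%Z.
  have -> : t0 = t0 + c * ((r : nat)%:Z + (t : nat)%:Z) - c * ((r : nat)%:Z + (t : nat)%:Z) by ring.
  by rewrite dvdz_sub // dvdz_mulr.
have pg : (p %| nm g)%Z.
  have -> : nm g = f (r : nat)%:Z - (r : nat)%:Z * t0 - (r : nat)%:Z ^+ 2 * c by rewrite nm_stp; ring.
  by apply: dvdz_sub; [apply: dvdz_sub => //; exact: dvdz_mull | exact: dvdz_mull].
case/negP: (disc_sqr_prime pp p2).
have -> : disc D = t0 ^+ 2 - 4 * (nm g * c) by rewrite tr_disc1 // addrK.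
rewrite dvdz_sub //; first by rewrite dvdz_sqr_prime.
by rewrite dvdz_mull // expr2 dvdz_mul.
Qed.

(* Two roots r, s with the same gcd (r - r0, n) satisfy 4 r = 4 s mod n. *)
Lemma roots_mod_card (n : nat) : (0 < n)%N ->
  (#|[set r : 'I_n | (n %| f (r : nat)%:Z)%Z]| <= 4 * size (divisors n))%N.
Proof.
move=> n0; set X := [set _ | _].
have [->|[r0 Xr0]] := set_0Vmem X; first by rewrite cards0.
pose dd (r : 'I_n) := gcdn `|(r : nat)%:Z - (r0 : nat)%:Z|%N n.
have f0 : (n%:Z %| f (r0 : nat)%:Z)%Z by move: Xr0; rewrite inE.
have key r s : r \in X -> s \in X -> dd r = dd s -> (n%:Z %| 4 * ((r : nat)%:Z - (s : nat)%:Z))%Z.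
  pose Q (r : 'I_n) := t0 + c * ((r : nat)%:Z + (r0 : nat)%:Z).
  move=> Xr Xs ers; set d := dd r in ers.
  have d0 : (0 < d)%N by rewrite gcdn_gt0 n0 orbT.
  have [e en] : exists e : nat, n = (d * e)%N.
    by have /dvdnP[e en] : (d %| n)%N := dvdn_gcdr _ _; exists e; rewrite mulnC.
  have e0 : (0 < e)%N by move: n0; rewrite en muln_gt0 => /andP[].
  have dz : d%:Z != 0 by rewrite gt_eqF // ltz_nat.
  have nE : n%:Z = d%:Z * e%:Z by rewrite -PoszM -en.
  have split t : t \in X -> dd t = d ->
      exists2 a : int, (t : nat)%:Z - (r0 : nat)%:Z = d%:Z * a & (e%:Z %| Q t)%Z.
    move=> Xt ed; have dt : (d%:Z %| (t : nat)%:Z - (r0 : nat)%:Z)%Z.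
      by rewrite dvdzE /= -ed; exact: dvdn_gcdl.
    have [a ea] := dvdzP dt; exists a; first by rewrite ea mulrC.
    have cop : coprime `|a| e.
      rewrite /coprime -(eqn_pmul2l d0) muln_gcdr muln1 -en -{2}ed /dd ea abszM /= mulnC.
      by rewrite eqxx.
    have : (n%:Z %| ((t : nat)%:Z - (r0 : nat)%:Z) * Q t)%Z.
      by rewrite -nm_stpB dvdz_sub //; move: Xt; rewrite inE.
    rewrite ea nE [a * _]mulrC -mulrA dvdz_mul2l // Gauss_dvdzr //.
    by rewrite coprimezE /= coprime_sym.
  have [a ea eQr] := split _ Xr erefl; have [b eb eQs] := split _ Xs (esym ers).
  have ab : (r : nat)%:Z - (s : nat)%:Z = d%:Z * (a - b).
    by rewrite mulrBr -ea -eb; ring.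
  have h1 : (e%:Z %| c * (d%:Z * (a - b)))%Z.
    have -> : c * (d%:Z * (a - b)) = Q r - Q s by rewrite -ab /Q; ring.
    exact: dvdz_sub.
  (* The squares of both gcds divide the discriminant, so each gcd is at most 2 and their product
     divides 4. *)
  have {}h1 : (e%:Z %| gcdz e d * (gcdz e c * (a - b)))%Z.
    by apply: dvdz_gcd_mul; rewrite mulrCA; apply: dvdz_gcd_mul.
  have k2 : (`|gcdz e c| <= 2)%N.
    apply: disc_sqr_le2; set k := gcdz e c.
    have ke : (k %| e%:Z)%Z by exact: dvdz_gcdl.
    have kc : (k %| c)%Z by exact: dvdz_gcdr.
    have kt : (k %| t0)%Z.
      have -> : t0 = Q r - c * ((r : nat)%:Z + (r0 : nat)%:Z) by rewrite /Q addrK.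
      by rewrite dvdz_sub ?dvdz_mulr //; apply: dvdz_trans eQr.
    have kg : (k %| nm g)%Z.
      have -> : nm g = f (r0 : nat)%:Z - (r0 : nat)%:Z * t0 - (r0 : nat)%:Z ^+ 2 * c by rewrite nm_stp; ring.
      apply: dvdz_sub; last exact: dvdz_mull.
      apply: dvdz_sub; last exact: dvdz_mull.
      apply: dvdz_trans f0.
      by rewrite nE dvdz_mull.
    have -> : disc D = t0 ^+ 2 - 4 * (nm g * c) by rewrite tr_disc1 // addrK.
    rewrite dvdz_sub //; first by rewrite expr2 dvdz_mul.
    by rewrite dvdz_mull // expr2 dvdz_mul.
  have g2 : (`|gcdz e d| <= 2)%N.
    apply: disc_sqr_le2; set k := gcdz e d.
    have ke : (k %| e%:Z)%Z by exact: dvdz_gcdl.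
    have kd : (k %| d%:Z)%Z by exact: dvdz_gcdr.
    have -> : disc D = (t0 + 2 * (r0 : nat)%:Z * c) ^+ 2 - 4 * (f (r0 : nat)%:Z * c).
      by rewrite -tr_stp tr_disc1 ?addrK // wd_stp.
    have kt : (k %| t0 + 2 * (r0 : nat)%:Z * c)%Z.
      have -> : t0 + 2 * (r0 : nat)%:Z * c = Q r - c * ((r : nat)%:Z - (r0 : nat)%:Z) by rewrite /Q; ring.
      rewrite dvdz_sub //; first by apply: dvdz_trans eQr.
      by rewrite ea dvdz_mull // dvdz_mulr.
    rewrite dvdz_sub //; first by rewrite [k ^+ 2]expr2 [_ ^+ 2]expr2 dvdz_mul.
    rewrite dvdz_mull // dvdz_mulr //; apply: dvdz_trans f0.
    by rewrite nE expr2 dvdz_mul.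
  rewrite ab nE mulrCA dvdz_mul2l //; move: h1; rewrite mulrA => h1.
  have : (gcdz e d * gcdz e c %| 4)%Z.
    have p1 : (0 < `|gcdz e c|)%N by rewrite gcdn_gt0 e0.
    have p2 : (0 < `|gcdz e d|)%N by rewrite gcdn_gt0 e0.
    rewrite dvdzE abszM.
    move: `|gcdz e c|%N `|gcdz e d|%N k2 g2 p1 p2 => [|[|[|?]]] [|[|[|?]]] //.
  by move=> h4; apply: dvdz_trans h1 _; apply: dvdz_mul.
(* 4 r is determined by its residue modulo n, hence by the gcd, and by its quotient by n, which
   takes four values. *)
pose P (r : 'I_n) (b : 'I_4 * 'I_(size (divisors n))) :=
  (4 * r %/ n = b.1)%N /\ (index (dd r) (divisors n) = b.2)%N.
have -> : (4 * size (divisors n))%N = #|[set: 'I_4 * 'I_(size (divisors n))]|.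
  by rewrite cardsT card_prod !card_ord.
have dmem r : dd r \in divisors n by rewrite -dvdn_divisors // dvdn_gcdr.
apply: (card_inj_rel (P := P)).
  move=> r _; have lt1 : (4 * r %/ n < 4)%N by rewrite ltn_divLR // ltn_pmul2l.
  have lt2 : (index (dd r) (divisors n) < size (divisors n))%N by rewrite index_mem.
  by exists (Ordinal lt1, Ordinal lt2); rewrite ?inE.
move=> r s [b1 b2] Xr Xs [e1 e2] [e3 e4]; apply: val_inj => /=.
have ds : dd r = dd s.
  by rewrite -(nth_index 0%N (dmem r)) -(nth_index 0%N (dmem s)) e2 e4.
have : (4 * r = 4 * s %[mod n])%N.
  by apply: modn_dvdz; rewrite !PoszM -mulrBr; exact: key.
move=> em; have := divn_eq (4 * r) n; rewrite e1 -e3 em -divn_eq => /eqP.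
by rewrite eqn_pmul2l // => /eqP.
Qed.
End Strip.

(* e0 has the least positive second coordinate among totally positive units;
   multiplication by conj e0 lowers that coordinate. *)
Lemma tp_unit_classes : exists2 e0 : QI D, tp e0 &
  forall h : QI D, tp h -> qunit h -> exists z : QI D, h = z ^+ 2 \/ h = e0 * z ^+ 2.
Proof.
have triv (h : QI D) : tp h -> h.2 = 0 -> nm h = 1 -> h = 1.
  move=> th h2; have [m e] : exists m : int, h = m%:~R.
    by exists h.1; rewrite qintE {1}[h]surjective_pairing h2.
  have /andP[p _] := th; move: p; rewrite e e1_int nm_int ltr0z => p n1.
  by have -> : m = 1 by nia.
have nm_tp1 (h : QI D) : tp h -> qunit h -> nm h = 1.
  by move=> th; rewrite /qunit; have := tp_nm th; case: (nm h) => // n _ /= ->.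
have w1 (h : QI D) : h.2 = wd h 1 by rewrite /wd /=; ring.
have e12 (h : QI D) : emb1 D h - emb2 D h = (h.2)%:~R * sD D.
  by rewrite w1 -(e12_wd h 1) e1_1 e2_1 !mulr1.
have [[e [te ue e2]]|no] := pselect (exists e : QI D, [/\ tp e, qunit e & 0 < e.2]); last first.
  exists 1; first exact: tp1.
  move=> h th uh; exists 1; left; rewrite expr1n.
  have h2 : h.2 = 0.
    have [h2|h2|//] := ltgtP h.2 0; exfalso; apply: no; last by exists h.
    by exists (conj h); rewrite tp_conj /= oppr_gt0; split => //; exact: qunit_conj.
  by apply: triv => //; exact: nm_tp1.
pose Pn n := `[< exists h : QI D, [/\ tp h, qunit h & h.2 = n.+1%:Z] >].
have exP : exists n, Pn n.
  exists `|e.2|.-1; apply/asboolP; exists e; split => //; lia.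
case: (ex_minnP exP) => n /asboolP[e0 [t0 u0 e02]] minn; exists e0 => //.
have n0 := nm_tp1 _ t0 u0.
(* Negative coordinates follow by conjugation, as e0' = e0 (e0')^2. *)
suff main N (h : QI D) : tp h -> qunit h -> h.2 = N%:Z ->
    exists z : QI D, h = z ^+ 2 \/ h = e0 * z ^+ 2.
  move=> h th uh; have [h2|h2] := leP 0 h.2.
    by apply: (main `|h.2|%N) => //; rewrite gez0_abs.
  have [|||z hz] := @main `|h.2|%N (conj h); first by rewrite tp_conj.
  - exact: qunit_conj.
  - by rewrite /=; lia.
  case: hz => /(congr1 (@conj D)); rewrite conjK => ->.
    by exists (conj z); left; rewrite !expr2 conjM.
  exists (conj e0 * conj z); right; rewrite conjM expr2 conjM.
  transitivity (e0 * conj e0 * (conj e0 * (conj z * conj z))); last by ring.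
  by rewrite mul_conj n0 mul1r.
elim/ltn_ind: N h => N IH h th uh h2.
have [N0|N0] := posnP N.
  rewrite N0 in h2; exists 1; left; rewrite expr1n.
  by apply: triv => //; exact: nm_tp1.
have nN : (n < N)%N.
  rewrite -(prednK N0) ltnS; apply: minn; apply/asboolP; exists h; split => //.
  by rewrite prednK.
have nh := nm_tp1 _ th uh.
pose k := h * conj e0.
have tk : tp k by apply: tpM; rewrite ?tp_conj.
have uk : qunit k by apply: qunitM => //; exact: qunit_conj.
have /andP[a1 a2] := th; have /andP[b1 b2] := t0.
have na : emb1 D h * emb2 D h = 1 by rewrite e12_nm nh.
have nb : emb1 D e0 * emb2 D e0 = 1 by rewrite e12_nm n0.
have s0 := sD_gt0 D1.
have hb : emb1 D e0 - emb2 D e0 <= emb1 D h - emb2 D h.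
  by rewrite !e12 e02 h2 ler_pM2r // ler_int; lia.
have hb0 : 0 < emb1 D e0 - emb2 D e0 by rewrite e12 e02 mulr_gt0 // ltr0z.
have k2 : (k.2)%:~R * sD D = emb1 D h * emb2 D e0 - emb2 D h * emb1 D e0.
  by rewrite -e12 /k e1M e2M e1_conj e2_conj.
have hx := e12 h; clear e12 triv; move: hx hb hb0 k2 na nb a1 a2 b1 b2.
move: (emb1 D h) (emb2 D h) (emb1 D e0) (emb2 D e0) => x y a b hx hb hb0 k2 na nb a1 a2 b1 b2.
(* From x y = a b = 1 and a - b <= x - y; then the coordinate of k is nonnegative and below N. *)
have xa : a <= x.
  rewrite leNgt; apply/negP => xa.
  have : b < y.
    rewrite -(ltr_pM2l a1) na -nb ltr_pM2r //.
  lra.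
have yb : y <= b.
  rewrite -(ler_pM2l a1) na -nb ler_pM2r //.
have k0 : 0 <= k.2.
  rewrite -(ler0z R) -(pmulr_lge0 _ s0) k2 subr_ge0 [y * a]mulrC.
  by rewrite ler_pM // ltW.
have bl1 : b < 1 by nra.
have kN : k.2 < N%:Z.
  rewrite -h2 -(ltr_int R) -(ltr_pM2r s0) k2 -hx.
  have a_gt1 : 1 < a by rewrite -(ltr_pM2r b2) mul1r nb.
  have : x * b < x * 1 by rewrite ltr_pM2l.
  have : y * 1 < y * a by rewrite ltr_pM2l.
  by lra.
have [k' kE] : exists k' : nat, k.2 = k'%:Z by exists `|k.2|%N; rewrite gez0_abs.
have [|z hz] := IH k' _ k tk uk kE; first by rewrite -ltz_nat -kE.
have hE : h = e0 * k by rewrite /k mulrCA mul_conj n0 mulr1.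
case: hz => kz; first by exists z; right; rewrite hE kz.
by exists (e0 * z); left; rewrite hE kz exprMn expr2; ring.
Qed.
End Roots.

(** * Good points of a strip *)

Lemma card_union_seq (T : finType) (I : eqType) (s : seq I) (X : {set T}) (F : I -> {set T}) :
  (forall x, x \in X -> exists2 i, i \in s & x \in F i) -> (#|X| <= \sum_(i <- s) #|F i|)%N.
Proof.
elim: s X => [|i s IH] X h.
  rewrite big_nil leqn0 cards_eq0; apply/eqP/setP => x; rewrite inE.
  by apply/negP => /h[].
rewrite big_cons -(cardsID (F i) X) leq_add ?subset_leq_card ?subsetIr //.
apply: IH => x; rewrite inE => /andP[xi /h [j]]; rewrite inE => /orP[/eqP->|js]; last by exists j.
by move=> xi'; rewrite xi' in xi.
Qed.

Section Good.
Variable D : nat.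
Hypothesis D1 : (1 < D)%N.
Hypothesis sqfD : squarefree D.
Let D0 : (0 < D)%N. Proof. exact: ltnW. Qed.

Section Strip.
Variables (g v : QI D) (U : nat).
Hypothesis gv : wd g v = 1.
Hypothesis mv : mp v.
Hypothesis tg : forall r : nat, (r < U)%N -> tp (stp g v r%:Z).
Hypothesis U_ge : disc D <= (U%:Z + 1) ^+ 2 * nm v ^+ 2.
Hypothesis U_lt : U%:Z ^+ 2 * nm v ^+ 2 < disc D.
Local Notation al r := (stp g v r).
Local Notation f r := (nm (al r)).
Local Notation c := `|nm v|%N.

Lemma strip_coef_inj a x y (r s : 'I_U) : al (r : nat)%:Z = a * x ^+ 2 ->
  al (s : nat)%:Z = a * y ^+ 2 -> (0 < nm x) = (0 < nm y) -> r = s.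
Proof.
move=> er es sg.
have tr := tg (ltn_ord r); have ts := tg (ltn_ord s).
have e : al (s : nat)%:Z = al (r : nat)%:Z + ((s : nat)%:Z - (r : nat)%:Z)%:~R * v.
  by rewrite /stp -addrA -mulrDl -intrD subrKC.
have nz w q : tp w -> w = a * q ^+ 2 -> nm q != 0.
  by move=> tw ew; apply: contraTneq (tp_nm tw) => q0; rewrite ew nmM nmX q0 expr0n mulr0 ltxx.
have z0 := nz _ _ tr er; have z1 := nz _ _ ts es.
have : (s : nat)%:Z - (r : nat)%:Z = 0.
  apply: (strip_same_coef D1 (a := a) (x := x) (y := y) (v := v) (g := al (r : nat)%:Z)) => //.
  - by rewrite -e.
  - exact: wd_stp gv _.
  - by rewrite -e.
  by move: sg; case: (ltrP 0 (nm x)) => p1 /esym; [|move/negbT; rewrite -leNgt] => p2; nia.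
by move=> h; apply: val_inj => /=; lia.
Qed.

(** At most 4 tau(A) residues of r occur, and each fixes the coefficient up to a unit. Two classes
    of totally positive units modulo squares and two signs of N x give the factor 16. *)
Lemma coef_card (A : nat) : (0 < A)%N ->
  (#|[set r : 'I_U | `[< exists a x : QI D, (al (r : nat)%:Z = a * x ^+ 2 /\ nm a = A%:Z)%R >]]|
    <= 16 * size (divisors A))%N.
Proof.
move=> A0; have [e0 te0 e0P] := tp_unit_classes D1.
have dec r a x : (r < U)%N -> al r%:Z = a * x ^+ 2 -> tp a.
  move=> rU e; have x0 : x <> 0 by move=> x0; have := tg rU; rewrite e x0 expr0n mulr0 => /tp_neq0.
  by apply: (@tp_divr D (x ^+ 2)); [exact: tp_sqr | rewrite mulrC -e; exact: tg].
pose same (nu : 'I_A) (r : nat) := (r %% A = nu)%N.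
(* If b divides a point of the class nu, it divides all of them, because N b = A divides the
   differences of their indices; two coefficients of norm A are then associates by [div_same_nm]. *)
have /choice [rep repP] : forall nu : 'I_A, exists b : QI D, forall (r : nat) a x, (r < U)%N ->
    same nu r -> al r%:Z = a * x ^+ 2 -> nm a = A%:Z -> exists h, [/\ tp h, qunit h & a = h * b].
  move=> nu; have [[r0 [b [x0 [r0U s0 e0' nb]]]]|no] := pselect (exists (r : nat) (b x : QI D),
      [/\ (r < U)%N, same nu r, al r%:Z = b * x ^+ 2 & nm b = A%:Z]); last first.
    by exists 0 => r a x rU sr e na; case: no; exists r, a, x.
  exists b => r a x rU sr e na.
  have bal : qdvd b (al r%:Z).
    have -> : al r%:Z = al r0%:Z + (r%:Z - r0%:Z)%:~R * v.
      by rewrite /stp -addrA -mulrDl -intrD subrKC.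
    apply: qdvdD; first by rewrite e0'; apply: qdvdMr; apply: qdvdxx.
    apply: qdvdMr; apply: qdvd_int; rewrite nb -eqz_mod_dvd !modz_nat.
    by apply/eqP; congr Posz; rewrite sr s0.
  have ta := dec _ _ _ rU e; have tb := dec _ _ _ r0U e0'.
  have [h uh ab] : assoc a b.
    apply: (@div_same_nm D (al r%:Z)) => //; last by rewrite na nb.
    - exact: prim_stp.
    - by rewrite e; apply: qdvdMr; apply: qdvdxx.
    - by rewrite nb; case: (A) A0.
  by exists h; split => //; apply: (@tp_divr D b) => //; rewrite mulrC -ab.
pose roots := [set r : 'I_A | (A%:Z %| f (r : nat)%:Z)%Z].
apply: (@leq_trans #|finset.setX roots [set: bool * bool]|); last first.
  rewrite cardsX cardsT card_prod card_bool.
  have := roots_mod_card D1 sqfD gv A0; rewrite -/roots; lia.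
pose P (r : 'I_U) (b : 'I_A * (bool * bool)) := same b.1 r /\
  exists x, al (r : nat)%:Z = (if b.2.1 then e0 * rep b.1 else rep b.1) * x ^+ 2 /\ (0 < nm x) = b.2.2.
apply: (card_inj_rel (P := P)).
  move=> r; rewrite inE => /asboolP [a [x [e na]]].
  have ltA : (r %% A < A)%N by rewrite ltn_mod.
  have [h [th uh ah]] := repP (Ordinal ltA) r a x (ltn_ord r) erefl e na.
  have ina b : (Ordinal ltA, b) \in finset.setX roots [set: bool * bool].
    rewrite finset.in_setX !inE andbT /=.
    have : (A%:Z %| f (r : nat)%:Z)%Z by rewrite e nmM na dvdz_mulr.
    move=> h1; have -> : f (r %% A)%N%:Z = f (r : nat)%:Z - (f (r : nat)%:Z - f (r %% A)%N%:Z) by ring.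
    apply: dvdz_sub => //; rewrite nm_stpB dvdz_mulr //.
    by rewrite -eqz_mod_dvd !modz_nat modn_mod.
  have [z [hz|hz]] := e0P h th uh.
    exists (Ordinal ltA, (false, 0 < nm (z * x))) => //; split => //; exists (z * x); split => //.
    by rewrite e ah hz /=; ring.
  exists (Ordinal ltA, (true, 0 < nm (z * x))) => //; split => //; exists (z * x); split => //.
  by rewrite e ah hz /=; ring.
move=> r s [nu [b1 b2]] _ _ [_ [x [er s1]]] [_ [y [es s2]]].
by apply: (strip_coef_inj er es); rewrite s1 s2.
Qed.

Lemma small_coef_card (Y : nat) :
  (#|[set r : 'I_U | `[< exists a x : QI D, (al (r : nat)%:Z = a * x ^+ 2 /\ nm a <= Y%:Z)%R >]]|
    <= 16 * (Y * (trunc_log 2 Y).+1))%N.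
Proof.
apply: (@leq_trans (\sum_(1 <= A < Y.+1)
   #|[set r : 'I_U | `[< exists a x : QI D, (al (r : nat)%:Z = a * x ^+ 2 /\ nm a = A%:Z)%R >]]|)%N).
  apply: card_union_seq => r; rewrite inE => /asboolP [a [x [e na]]].
  have a0 : 0 < nm a.
    have := tp_nm (tg (ltn_ord r)); rewrite e nmM nmX => p.
    by rewrite ltNge; apply/negP => h; have := sqr_ge0 (nm x); nia.
  exists `|nm a|%N; first by rewrite mem_index_iota; lia.
  by rewrite inE; apply/asboolP; exists a, x; split => //; lia.
apply: (@leq_trans (\sum_(1 <= A < Y.+1) 16 * size (divisors A))%N).
  rewrite big_nat [X in (_ <= X)%N]big_nat; apply: leq_sum => A /andP[A0 _]; exact: coef_card.
by rewrite -big_distrr leq_mul2l sum_size_divisors orbT.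
Qed.

(* 983/1000 exceeds 2 (1/4 + 17/72) + 1/100, where 17/72 bounds the sum of
   1/n^2 over the odd n >= 3. *)
Lemma small_sqr_card (Z : nat) : (100 * Z <= U)%N ->
  (1000 * #|[set r : 'I_U | `[< exists p : nat, [/\ prime p, (p <= Z)%N & (p%:Z ^+ 2 %| f (r : nat)%:Z)%Z] >]]|
    <= 983 * U + 2000)%N.
Proof.
move=> ZU; set X := [set _ | _].
pose F n := if prime n then [set r : 'I_U | (n%:Z ^+ 2 %| f (r : nat)%:Z)%Z] else finset.set0.
have cF n : (#|F n| <= 2 * (U %/ n ^ 2 + 1))%N.
  rewrite /F; case: ifP => pn; last by rewrite cards0.
  exact: sqr_roots_card.
have le : (#|X| <= \sum_(n <- 2 :: [seq (2 * k + 1)%N | k <- index_iota 1 (Z./2).+1]) #|F n|)%N.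
  apply: card_union_seq => r; rewrite inE => /asboolP[p [pp pZ pr]].
  exists p; last by rewrite /F pp inE.
  have [->|op] := even_prime pp; first by rewrite mem_head.
  rewrite inE; apply/orP; right; apply/mapP; exists (p./2).
    rewrite mem_index_iota ltnS half_leq // andbT.
    by case: p pp op {pZ pr} => [|[|[|]]].
  by rewrite -[LHS]odd_double_half op -mul2n addnC.
rewrite big_cons big_map in le.
have h : #|X|%:R <= (2 * (U%:R / 4 + 1) + (2 * U%:R * (17 / 72) + 2 * (Z./2)%:R)) :> R.
  have cR n : (0 < n)%N -> #|F n|%:R <= 2 * (U%:R * (n%:R ^+ 2)^-1 + 1) :> R.
    move=> n0; apply: le_trans (_ : (2 * (U %/ n ^ 2 + 1))%N%:R <= _); first by rewrite ler_nat.
    rewrite natrM natrD ler_pM2l // lerD2r ler_pdivlMr ?exprn_gt0 ?ltr0n //.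
    by rewrite -natrX -natrM ler_nat leq_trunc_div.
  apply: le_trans (_ : (#|F 2| + \sum_(1 <= k < (Z./2).+1) #|F (2 * k + 1)|)%N%:R <= _).
    by rewrite ler_nat.
  rewrite natrD lerD //.
    by apply: le_trans (cR 2 isT) _; rewrite -natrX.
  rewrite natr_sum; apply: le_trans (_ : \sum_(1 <= k < (Z./2).+1) (2 * U%:R * ((2 * k + 1)%:R ^+ 2)^-1 + 2) <= _).
    apply: ler_sum => k _; apply: le_trans (cR _ _) _; first by rewrite addn1.
    lra.
  rewrite big_split /= -mulr_sumr sumr_const_nat subn1 /= lerD //.
    by rewrite ler_wpM2l ?mulr_ge0 // sum_odd_inv_sqr.
  by rewrite mulr_natr.
have z2 : 100 * (2 * (Z./2)%:R) <= U%:R :> R.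
  rewrite -!natrM ler_nat; apply: leq_trans ZU.
  by rewrite leq_mul2l /= mul2n -[X in (_ <= X)%N]odd_double_half leq_addl.
rewrite -(ler_nat R) natrM natrD !natrM.
have := ler0n R U; move: h z2; move: (#|X|%:R : R) (U%:R : R) (Z./2%:R : R) => a b d h z2; lra.
Qed.

(** * Sieving the points of a long strip *)

Variables (Z Y : nat).
Hypothesis U_large : (1000 * 1000 <= U)%N.
Hypothesis ZE : Z = (U %/ 100)%N.
Hypothesis Z8 : (4 * D < Z ^ 8)%N.
Hypothesis YP : forall A : nat, (A ^ 2 * Z ^ 8 < D * U ^ 2)%N -> (A <= Y)%N.
Hypothesis YU : (16 * 1000 * (Y * (trunc_log 2 Y).+1) <= U)%N.

Lemma stp_nm_le (r : nat) : (r < U)%N -> 4 * (f r%:Z * - nm v) <= disc D.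
Proof. by move=> rU; apply: strip_nm_bound => //; exact: wd_stp gv _. Qed.

Lemma nm_v_le : (c <= 4 * D)%N.
Proof.
have U1 : 1 <= U%:Z ^+ 2 by rewrite -[1]/(1%N%:Z) -[_ ^+ 2]/((U ^ 2)%N%:Z) lez_nat expn_gt0; lia.
have le := disc_le D0.
have c0 := mp_nm mv.
have h : nm v ^+ 2 < 4 * D%:Z.
  apply: lt_le_trans le; apply: le_lt_trans U_lt; rewrite ler_peMl ?sqr_ge0 //.
have : - nm v <= nm v ^+ 2 by rewrite -sqrrN expr2 ler_peMl; lia.
lia.
Qed.

(** The ends are excluded so that both neighbours of a good point are totally positive, as
    [strip_inj] requires. *)
Definition goodr (r : nat) := [/\ (0 < r)%N, (r.+1 < U)%N & forall x : QI D, qdvd (x ^+ 2) (al r%:Z) ->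
  qunit x \/ [/\ prime `|nm x|, (Z < `|nm x|)%N & ~~ (`|nm x| %| c)%N]].

(** The norm n of the point satisfies 4 n |N v| <= disc, and the length U bounds |N v| from below,
    so n^2 <= D U^2. On the other hand n exceeds N(a) Z^4, which is the situation of [YP]. *)
Lemma composite_small_coef (r : nat) a x : (r < U)%N -> al r%:Z = a * x ^+ 2 ->
  (Z ^ 2 < `|nm x|)%N -> nm a <= Y%:Z.
Proof.
move=> rU e hx; have fr := tp_nm (tg rU).
have c0 := mp_nm mv.
have fE : f r%:Z = nm a * nm x ^+ 2 by rewrite e nmM nmX.
have a0 : 0 < nm a.
  by rewrite ltNge; apply/negP => h; have := sqr_ge0 (nm x); rewrite fE in fr; nia.
have [A AE] : exists A : nat, nm a = A%:Z by exists `|nm a|%N; rewrite gez0_abs // ltW.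
have [C CE] : exists C : nat, nm v = - C%:Z by exists c; lia.
have C0 : (0 < C)%N by lia.
rewrite AE lez_nat; apply: YP.
have [N NE] : exists N : nat, f r%:Z = N%:Z by exists `|f r%:Z|%N; rewrite gez0_abs // ltW.
have [d dE] : exists d : nat, disc D = d%:Z by exists `|disc D|%N; have := disc_gt0 D0; lia.
have h1 : (4 * N * C <= d)%N.
  have := stp_nm_le rU; rewrite NE CE opprK dE; lia.
have h2 : (A * Z ^ 4 < N)%N.
  have NA : N = (A * `|nm x| ^ 2)%N.
    apply/eqP; rewrite -eqz_nat -NE fE AE PoszM; apply/eqP; congr (_ * _).
    by rewrite -[LHS]gez0_abs ?sqr_ge0 // abszX.
  rewrite NA ltn_pmul2l; last by lia.
  by rewrite -[4%N]/(2 * 2)%N expnM ltn_exp2r.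
have h3 : (d <= (U + 1) ^ 2 * C ^ 2)%N.
  by move: U_ge; rewrite dE CE sqrrN -PoszD -[_ ^+ 2 * _]/(((U + 1) ^ 2 * C ^ 2)%N%:Z) lez_nat.
have h4 : (d <= 4 * D)%N by have := disc_le D0; rewrite dE; lia.
have h5 : (A ^ 2 * Z ^ 8 < N ^ 2)%N.
  have -> : (A ^ 2 * Z ^ 8 = (A * Z ^ 4) ^ 2)%N by rewrite expnMn -expnM.
  by rewrite ltn_exp2r.
apply: leq_trans h5 _.
have C2 : (0 < 16 * C ^ 2)%N by rewrite muln_gt0 expn_gt0 C0.
rewrite -(leq_pmul2l C2).
have : (16 * C ^ 2 * N ^ 2 <= d * d)%N.
  have -> : (16 * C ^ 2 * N ^ 2 = (4 * N * C) * (4 * N * C))%N by ring.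
  exact: leq_mul.
move/leq_trans; apply; apply: leq_trans (leq_mul h4 h3) _.
have U2 : ((U + 1) ^ 2 <= 4 * U ^ 2)%N.
  have -> : (4 * U ^ 2 = (2 * U) ^ 2)%N by rewrite expnMn.
  by rewrite leq_exp2r //; lia.
have -> : (16 * C ^ 2 * (D * U ^ 2) = 4 * D * (4 * U ^ 2 * C ^ 2))%N by ring.
by rewrite leq_mul2l leq_mul2r U2 !orbT.
Qed.

(** Bad points are the ends (B0), those whose norm is divisible by the square of a prime up to Z
    (B1) or by a prime above Z dividing N v (B2), and those with a coefficient of norm at most Y
    (B3). Their bounds add up to 984 U / 1000 plus a constant below 1000, leaving U / 100 since U is
    at least 10^6. *)
Lemma good_card : (U <= 100 * #|[set r : 'I_U | `[< goodr r >]]|)%N.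
Proof.
set G := [set _ | _].
pose B1 := [set r : 'I_U | `[< exists p : nat, [/\ prime p, (p <= Z)%N & (p%:Z ^+ 2 %| f (r : nat)%:Z)%Z] >]].
pose ps := big_primes (4 * D) c.
pose B2 := [set r : 'I_U | has (fun p : nat => (p%:Z %| f (r : nat)%:Z)%Z) [seq p <- ps | Z < p]%N].
pose B3 := [set r : 'I_U | `[< exists a x : QI D, (al (r : nat)%:Z = a * x ^+ 2 /\ nm a <= Y%:Z)%R >]].
pose B0 := [set r : 'I_U | (r == 0 :> nat) || (r == U.-1 :> nat)].
have c1 := small_sqr_card (Z := Z); rewrite -/B1 in c1.
have {}c1 : (1000 * #|B1| <= 983 * U + 2000)%N by apply: c1; rewrite ZE mulnC leq_trunc_div.
have c3 : (1000 * #|B3| <= U)%N.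
  by apply: leq_trans YU; have := small_coef_card Y; rewrite -/B3; lia.
have c0 : (#|B0| <= 2)%N.
  have U0 : (0 < U)%N by lia.
  have U1 : (U.-1 < U)%N by lia.
  apply: (@leq_trans #|[set Ordinal U0; Ordinal U1]|); last by rewrite cards2; case: eqP.
  by apply/subset_leq_card/fintype.subsetP => r; rewrite !inE.
have vpos : (0 < c)%N by have := mp_nm mv; lia.
(* Fewer than eight such primes exist by [size_big_primes], and U < 100 p bounds the points of each
   by 101. *)
have c2 : (#|B2| <= 8 * 101)%N.
  apply: (@leq_trans (\sum_(p <- [seq p <- ps | Z < p]%N) #|[set r : 'I_U | (p%:Z %| f (r : nat)%:Z)%Z]|)%N).
    by apply: card_union_seq => r; rewrite inE => /hasP[p ps' pr]; exists p => //; rewrite inE.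
  apply: (@leq_trans (\sum_(p <- [seq p <- ps | Z < p]%N) 101)%N).
    rewrite big_seq [X in (_ <= X)%N]big_seq; apply: leq_sum => p.
    rewrite mem_filter mem_filter mem_primes => /and3P[Zp _ /and3P[pp _ pc]].
    apply: leq_trans (roots_dvd_card D1 sqfD gv _ pp _ _) _.
    - by move: Zp; rewrite ZE; lia.
    - by rewrite dvdzE.
    have : (U < 100 * p)%N by move: Zp; rewrite ZE => Zp; have := divn_eq U 100; have := ltn_pmod U (isT : 0 < 100)%N; lia.
    rewrite addn1 ltnS => h; rewrite -ltnS ltn_divLR ?prime_gt0 //; lia.
  rewrite big_const_seq count_predT iter_addn_0 mulnC leq_mul2r /=.
  rewrite size_filter; apply: leq_trans (count_size _ _) _.
  by apply: ltnW; apply: size_big_primes; rewrite vpos nm_v_le.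
have cov : (U <= #|G| + #|B0| + #|B1| + #|B2| + #|B3|)%N.
  have : (#|[set: 'I_U]| <= \sum_(X <- [:: G; B0; B1; B2; B3]) #|X|)%N.
    apply: (card_union_seq (F := id)) => r _.
    have [b0|b0] := boolP (r \in B0); first by exists B0; [rewrite !in_cons eqxx ?orbT | ].
    have [b1|b1] := boolP (r \in B1); first by exists B1; [rewrite !in_cons eqxx ?orbT | ].
    have [b2|b2] := boolP (r \in B2); first by exists B2; [rewrite !in_cons eqxx ?orbT | ].
    have [b3|b3] := boolP (r \in B3); first by exists B3; [rewrite !in_cons eqxx ?orbT | ].
    exists G; first by rewrite mem_head.
    rewrite inE; apply/asboolP; move: b0; rewrite inE negb_or => /andP[r0 r1].
    have rU := ltn_ord r; split; [lia | lia | ].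
    move=> x [a ea]; have {}ea : al (r : nat)%:Z = a * x ^+ 2 by rewrite ea mulrC.
    have fE : f (r : nat)%:Z = nm a * nm x ^+ 2 by rewrite ea nmM nmX.
    have f0 := tp_nm (tg rU).
    have big p : prime p -> (p %| `|nm x|)%N -> (Z < p)%N.
      move=> pp px; rewrite ltnNge; apply/negP => pZ; case/negP: b1; rewrite inE; apply/asboolP.
      by exists p; split => //; rewrite fE dvdz_mull // dvdz_sqr_prime // dvdzE.
    have [x1|x1] := eqVneq `|nm x|%N 1%N; [by left | right].
    have x0 : (0 < `|nm x|)%N.
      by rewrite absz_gt0; apply: contraTneq f0 => x0; rewrite fE x0 expr0n mulr0 ltxx.
    have x2 : (1 < `|nm x|)%N by lia.
    (* All prime factors of N x exceed Z, so with this bound |N x| is prime. *)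
    have small : (`|nm x| <= Z ^ 2)%N.
      rewrite leqNgt; apply/negP => h; case/negP: b3; rewrite inE; apply/asboolP.
      by exists a, x; split => //; exact: composite_small_coef rU ea h.
    have pd := pdiv_prime x2; have pdd := pdiv_dvd `|nm x|%N.
    have pdZ := big _ pd pdd.
    have px : prime `|nm x|.
      have /dvdnP[q eq] := pdd.
      have [q1|q1] := leqP q 1.
        by move: q1 eq; case: q => [|[|//]] _; rewrite ?mul0n ?mul1n => eq; [rewrite eq in x0 | rewrite eq].
      have qp := pdiv_prime q1; have qd := pdiv_dvd q.
      have qn : (q %| `|nm x|)%N by rewrite {1}eq dvdn_mulr.
      have := big _ qp (dvdn_trans qd qn).
      have := dvdn_leq (ltnW q1) qd => h1 h2; exfalso.
      have : (Z * Z < q * pdiv `|nm x|)%N by apply: ltn_mul => //; apply: leq_trans h2 _.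
      by rewrite -eq mulnn ltnNge small.
    split => //; first exact: big.
    apply/negP => xc; case/negP: b2; rewrite inE; apply/hasP; exists `|nm x|%N; last first.
      by rewrite fE dvdz_mull // expr2 dvdz_mull // dvdzE.
    rewrite mem_filter big //= mem_big_primes // (leq_ltn_trans (n := 4 * D)) //.
    by apply: ltn_trans Z8 _; rewrite ltn_exp2r // big.
  by rewrite cardsT card_ord !big_cons big_nil addn0 !addnA.
lia.
Qed.
End Strip.
End Good.

(** * Good points have distinct coefficients *)

Lemma leq_sqr_percent (U p : nat) : (1000 * 1000 <= U)%N -> (U %/ 100 < p)%N -> (U <= p ^ 2)%N.
Proof.
move=> h h3; have h1 := divn_eq U 100; have h2 := ltn_pmod U (isT : 0 < 100)%N.
move: h1 h2 h3; set z := (U %/ 100)%N; set y := (U %% 100)%N => h1 h2 h3.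
have z4 : (1000 <= z)%N by lia.
have : (z * z <= p ^ 2)%N by rewrite mulnn leq_exp2r // ltnW.
apply: leq_trans; apply: (@leq_trans (1000 * z)); last by rewrite leq_mul2r z4 orbT.
lia.
Qed.

Lemma absz_subr_lt (U r t : nat) : (r < U)%N -> (t < U)%N -> (`|r%:Z - t%:Z| < U)%N.
Proof. lia. Qed.

Section Count.
Variable D : nat.
Hypothesis D1 : (1 < D)%N.
Hypothesis sqfD : squarefree D.
Let D0 : (0 < D)%N. Proof. exact: ltnW. Qed.

Definition sqfree (y : QI D) := forall z : QI D, qdvd (z ^+ 2) y -> qunit z.

Variable m : nat.
Variable a : 'I_m -> QI D.
Hypothesis ua : diag_universal D a.

Section Strip.
Variables (g v : QI D) (Z : nat).
Local Notation al r := (stp g v r).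

(* The type t records which element is a_k up to a unit: the good point itself
   (t = 0), pi' v (t = 1), or the point divided by pi (t = 2) or by pi^2 (t = 3);
   i is the position of the prime p = |N pi|. *)
Definition grel (r : nat) (k : 'I_m) (t : nat) (i : nat) :=
  let p := nth 0%N (big_primes (4 * D) `|nm (a k)|%N) i in
  match t with
  | 0 => assoc (al r%:Z) (a k)
  | 1 => exists2 pi : QI D, `|nm pi|%N = p &
           [/\ prime p, (Z < p)%N, qdvd (pi ^+ 2) (al r%:Z),
               prim (conj pi * v) & assoc (conj pi * v) (a k)]
  | t'.+2 => exists pi : QI D, exists y : QI D,
       [/\ `|nm pi|%N = p, prime p, al r%:Z = y * pi ^+ t'.+1, qdvd pi y & assoc y (a k)]
  end.

Variable U : nat.
Hypothesis gv : wd g v = 1.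
Hypothesis mv : mp v.
Hypothesis tg : forall r : nat, (r < U)%N -> tp (stp g v r%:Z).
Hypothesis Z8 : (4 * D < Z ^ 8)%N.
Hypothesis sv : sqfree v.

(** The norm of the coefficient is at most that of y, which [strip_nm_bound] controls; this brings
    its large primes under [size_big_primes]. *)
Lemma unimodular_coef (y w : QI D) : tp y -> mp w -> wd y w = 1 ->
  exists k x, y = a k * x ^+ 2 /\ (0 < `|nm (a k)| <= 4 * D)%N.
Proof.
move=> ty mw h; have [k [x e]] := single_term D1 sqfD ua ty mw h.
exists k, x; split => //.
have n1 := strip_nm_bound D1 h; have n2 := disc_le D0; have n3 := mp_nm mw; have n4 := tp_nm ty.
have {}n1 : nm y <= D%:Z by nia.
rewrite e nmM nmX in n1 n4.
have x0 : nm x != 0 by apply: contraTneq n4 => ->; rewrite expr0n mulr0 ltxx.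
have x1 : 1 <= nm x ^+ 2 by rewrite -gtz0_ge1 lt0r sqrf_eq0 x0 sqr_ge0.
have a0 : 0 < nm (a k) by rewrite -(pmulr_lgt0 (x := nm x ^+ 2)) // (lt_le_trans _ x1).
have : nm (a k) <= nm (a k) * nm x ^+ 2 by rewrite ler_peMr // ltW.
by move: (nm (a k) * _) n1 => N; clear -a0; lia.
Qed.

Lemma prime_index (k : 'I_m) (p : nat) (y : QI D) : (0 < `|nm (a k)| <= 4 * D)%N -> prime p -> (Z < p)%N ->
  assoc y (a k) -> (p %| `|nm y|)%N ->
  exists2 i : 'I_8, true & nth 0%N (big_primes (4 * D) `|nm (a k)|%N) i = p.
Proof.
move=> nk pp Zp /assoc_nm -> py.
have mem : p \in big_primes (4 * D) `|nm (a k)|%N.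
  apply: mem_big_primes => //; first by case/andP: nk.
  by apply: ltn_trans Z8 _; rewrite ltn_exp2r.
have lt : (index p (big_primes (4 * D) `|nm (a k)|%N) < 8)%N.
  apply: ltn_trans (size_big_primes nk); by rewrite index_mem.
by exists (Ordinal lt) => //=; rewrite nth_index.
Qed.

Lemma assoc_unit_sqr (b x y : QI D) : y = b * x ^+ 2 -> qunit x -> assoc y b.
Proof. by move=> -> ux; exists (x ^+ 2); [apply: qunitM | rewrite mulrC]. Qed.

Lemma qdvd_sqrP (b x y : QI D) : y = b * x ^+ 2 -> qdvd (x ^+ 2) y.
Proof. by move=> ->; exists b; rewrite mulrC. Qed.

Lemma prim_unimodular (y w : QI D) : wd y w = 1 -> prim y.
Proof. by move=> h; exists (- w); rewrite wdNl wdC opprK. Qed.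

(** If p divided N x, then p^2 would divide N(w v) = N w N v, while p is prime to N v. So
    [sqr_gauss] passes x^2 to the square-free v. *)
Lemma qdvd_sqr_coprime (w x : QI D) (p : nat) : `|nm w|%N = p -> prime p -> ~~ (p %| `|nm v|)%N ->
  qdvd (x ^+ 2) (w * v) -> qunit x.
Proof.
move=> nw pp pc h; apply: sv; apply: (@sqr_gauss D x v w); last by rewrite mulrC.
rewrite coprimezE nw coprime_sym prime_coprime //; apply/negP => px; case/negP: pc.
have := qdvd_dvdnm h; rewrite nmX nmM dvdzE abszX abszM nw => {}h.
have h2 : (p * p %| p * `|nm v|)%N by apply: dvdn_trans h; rewrite -mulnn dvdn_mul.
by rewrite dvdn_pmul2l ?prime_gt0 // in h2.
Qed.

(** For a point b pi^2 with N pi negative, [swap_neg] makes pi' v a point on the strip of -(b pi).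
    It is square-free, hence a coefficient up to a unit: type 1. *)
Lemma good_rel_neg (r : nat) (pi : QI D) (p : nat) : (r < U)%N -> mp (conj pi) ->
  `|nm pi|%N = p -> prime p -> (Z < p)%N -> ~~ (p %| `|nm v|)%N -> qdvd (pi ^+ 2) (al r%:Z) ->
  exists k (t : 'I_4) (i : 'I_8), grel r k t i.
Proof.
move=> rU mcp np pp Zp pc pi2; have [b eb] := pi2; rewrite mulrC in eb.
have ta := tg rU; have wa := wd_stp gv r%:Z.
have tb : tp b.
  apply: (@tp_divr D (pi ^+ 2)); last by rewrite mulrC -eb.
  apply: tp_sqr => // z0; have := mp_nm mcp; rewrite nm_conj.
  by rewrite z0 -[0]/(0%:~R) nm_int expr0n ltxx.
rewrite eb in wa; have [ty my wy] := swap_neg tb mcp mv wa.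
have [k [x [e nk]]] := unimodular_coef ty my wy.
have ux : qunit x.
  by apply: (qdvd_sqr_coprime (w := conj pi)) pp pc (qdvd_sqrP e); rewrite nm_conj.
have ay := assoc_unit_sqr e ux.
have [|i _ ip] := prime_index nk pp Zp ay; first by rewrite nmM nm_conj abszM np dvdn_mulr.
exists k, (inord 1), i; rewrite /grel inordK //= ip; exists pi => //; split => //.
exact: prim_unimodular wy.
Qed.

(** The point b pi^2 is divided by pi, or by pi^2 if pi still divides b. Either way pi divides the
    quotient, so that the quotient and p determine pi up to a unit. *)
Lemma good_rel_pos (r : nat) (pi : QI D) (p : nat) : (r < U)%N -> tp pi ->
  `|nm pi|%N = p -> prime p -> (Z < p)%N -> qdvd (pi ^+ 2) (al r%:Z) ->
  (forall x : QI D, qdvd (x ^+ 2) (al r%:Z) -> qunit x \/ prime `|nm x|) ->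
  exists k (t : 'I_4) (i : 'I_8), grel r k t i.
Proof.
move=> rU tpi np pp Zp pi2 gd; have [b eb] := pi2; rewrite mulrC in eb.
have ta := tg rU; have wa := wd_stp gv r%:Z; have pa := prim_stp gv r%:Z.
have npi0 : nm pi != 0 by rewrite -absz_eq0 np -lt0n prime_gt0.
have tb : tp b.
  apply: (@tp_divr D (pi ^+ 2)); last by rewrite mulrC -eb.
  by apply: tp_sqr => // z0; move: npi0; rewrite z0 -[0]/(0%:~R) nm_int expr0n.
(* Then (x pi)^2 divides the point, so N(x pi) is prime up to sign and x is a unit. *)
have comp x : qdvd (x ^+ 2) b -> qunit x.
  move=> [h hx]; have hd : qdvd ((x * pi) ^+ 2) (al r%:Z) by exists h; rewrite eb hx; ring.
  have [/qunitMl//|] := gd _ hd.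
  rewrite nmM abszM np => px.
  have p1 : p != 1%N by apply: contraTneq pp => ->.
  have /(prime_nt_dvdP px p1) := dvdn_mull `|nm x|%N (dvdnn p).
  by rewrite -{1}[p]mul1n => /eqP; rewrite eqn_pmul2r ?prime_gt0 // => /eqP.
have [pib|npib] := pselect (qdvd pi b).
  have tpc : tp (conj pi ^+ 2) by rewrite expr2; apply: tpM; rewrite tp_conj.
  have wb : wd b (conj pi ^+ 2 * v) = 1.
    rewrite -wa eb [b * _]mulrC wd_adj; congr wd; rewrite !expr2 conjM; ring.
  have [k [x [e nk]]] := unimodular_coef tb (tp_mp tpc mv) wb.
  have ab := assoc_unit_sqr e (comp _ (qdvd_sqrP e)).
  have [|i _ ip] := prime_index nk pp Zp ab.
    by rewrite -np -dvdzE; exact: qdvd_dvdnm.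
  exists k, (inord 3), i; rewrite /grel inordK //= ip; exists pi, b; split => //.
have [my wy] := swap_pos tpi mv (etrans (congr1 (fun z => wd z v) (esym eb)) wa).
have ty : tp (b * pi) by exact: tpM.
have [k [x [e nk]]] := unimodular_coef ty my wy.
have x2 := qdvd_sqrP e.
have ea : al r%:Z = b * pi * pi ^+ 1 by rewrite eb; ring.
(* A nonunit x has prime norm. If this differs from p, already b is divisible by x^2; if it is p,
   then x is associated to pi and pi divides b, which is excluded here. *)
have ux : qunit x.
  have [//|px] : qunit x \/ prime `|nm x| by apply: gd; rewrite ea; apply: qdvdMr.
  have [xp|xp] := eqVneq `|nm x|%N p; last first.
    apply: comp; apply: (@sqr_gauss D x b pi) => //.
    by rewrite coprimezE np prime_coprime // dvdn_prime2.
  have py : prim (b * pi) by exact: prim_unimodular wy.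
  have [h uh eh] : assoc pi x.
    apply: (div_same_nm py); rewrite ?np ?xp //; first by exists b; rewrite mulrC.
      by apply: qdvd_trans x2; exists x; rewrite expr2.
    by rewrite -absz_eq0 xp -lt0n prime_gt0.
  have [h' uh' ehh] := qunit_inv uh.
  case: npib; case: x2 => d ed.
  exists (h' * h' * d); apply: (@q_cancel D D1 sqfD pi).
    by move=> z0; move: npi0; rewrite z0 -[0]/(0%:~R) nm_int expr0n.
  rewrite [pi * b]mulrC ed; have -> : x = h' * pi by rewrite eh mulrA ehh mul1r.
  ring.
have ay := assoc_unit_sqr e ux.
have [|i _ ip] := prime_index nk pp Zp ay; first by rewrite nmM abszM np dvdn_mull.
by exists k, (inord 2), i; rewrite /grel inordK //= ip; exists pi, (b * pi); split => //; exists b; rewrite mulrC.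
Qed.

Lemma good_rel (r : nat) : goodr g v U Z r ->
  exists k (t : 'I_4) (i : 'I_8), grel r k t i.
Proof.
case=> r0 rU gd; have {rU}rU := ltnW rU.
have [sf|nsf] := pselect (sqfree (al r%:Z)).
  have [k [x [e nk]]] := unimodular_coef (tg rU) mv (wd_stp gv r%:Z).
  exists k, (inord 0), (inord 0); rewrite /grel !inordK //=.
  by apply: assoc_unit_sqr e (sf _ (qdvd_sqrP e)).
have [pi [pi2 npi]] : exists pi : QI D, qdvd (pi ^+ 2) (al r%:Z) /\ ~ qunit pi.
  apply: contrapT => h; apply: nsf => z hz; apply: contrapT => hn; apply: h.
  by exists z.
have [//|[pp Zp pc]] := gd _ pi2.
have pi2N : qdvd ((- pi) ^+ 2) (al r%:Z) by rewrite sqrrN.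
have n0 : nm pi != 0 by rewrite -absz_eq0 -lt0n; exact: prime_gt0.
have [sgn|sgn|e0] := ltrgtP (nm pi) 0; last by rewrite e0 eqxx in n0.
  have [h|h] : mp (conj pi) \/ mp (- conj pi) by apply: nm_mp; rewrite ?nm_conj.
    exact: (good_rel_neg rU h erefl).
  by apply: (good_rel_neg (pi := - pi) rU) => //; rewrite ?conjN ?nmN.
have gd' x : qdvd (x ^+ 2) (al r%:Z) -> qunit x \/ prime `|nm x|.
  by move=> /gd[|[]]; [left | right].
have [h|h] : tp pi \/ tp (- pi) by exact: nm_tp.
  exact: (good_rel_pos rU h erefl).
by apply: (good_rel_pos (pi := - pi) rU h) => //; rewrite ?nmN.
Qed.
End Strip.

Lemma assoc_cancel (x x' y y' : QI D) : x <> 0 -> assoc x x' -> assoc (x * y) (x' * y') -> assoc y y'.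
Proof.
move=> x0 xx' [k uk e]; have [h uh {}xx'] := assoc_sym xx'.
exists (k * h); first exact: qunitM.
by apply: (q_cancel D1 sqfD x0); rewrite e xx'; ring.
Qed.

Lemma assocX (x y : QI D) n : assoc x y -> assoc (x ^+ n) (y ^+ n).
Proof.
by move=> h; elim: n => [|n IH]; [exact: assoc_refl | rewrite !exprS; exact: assocM].
Qed.

(* An interior point of a strip lies on no other strip. *)
Lemma assoc_unimodular (x x' v v' : QI D) : mp v -> mp v' -> tp x ->
  tp x' -> tp (x' + v') -> tp (x' - v') -> wd x v = 1 -> wd x' v' = 1 ->
  assoc x x' -> exists2 h, qunit h & x = h * x' /\ v' = conj h * v.
Proof.
move=> mv mv' tx tx' tp1 tp2 w w' [h uh e]; exists h => //; split => //.
have th : tp h by apply: (@tp_divr D x') => //; rewrite mulrC -e.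
apply: (strip_inj D1 tp1 tp2) => //; first by apply: tp_mp => //; rewrite tp_conj.
by rewrite -wd_adj -e.
Qed.

(** * A family of strips with pairwise non-associated directions *)

Variable J : finType.
Variables (v g : J -> QI D) (U : J -> nat).
Hypothesis mv : forall j, mp (v j).
Hypothesis gv : forall j, wd (g j) (v j) = 1.
Hypothesis tg : forall j (r : nat), (r < U j)%N -> tp (stp (g j) (v j) r%:Z).
Hypothesis sv : forall j, sqfree (v j).
Hypothesis U_large : forall j, (1000 * 1000 <= U j)%N.
Hypothesis Z8 : forall j, (4 * D < (U j %/ 100) ^ 8)%N.
Hypothesis vJ : forall i j, assoc (v i) (v j) -> i = j.

Local Notation good j := [set r : 'I_(U j) | `[< goodr (g j) (v j) (U j) (U j %/ 100)%N r >]].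
Local Notation al j r := (stp (g j) (v j) r).

Lemma goodr_tp j r : goodr (g j) (v j) (U j) (U j %/ 100)%N r ->
  [/\ tp (al j r%:Z), tp (al j r%:Z + v j) & tp (al j r%:Z - v j)].
Proof.
case=> r0 rU _; split; first by apply: tg; exact: ltnW.
  have -> : al j r%:Z + v j = al j r.+1%:Z by rewrite /stp -addn1 PoszD intrD; ring.
  exact: tg.
have -> : al j r%:Z - v j = al j r.-1%:Z.
  by rewrite /stp -{1}(prednK r0) -addn1 PoszD intrD; ring.
by apply: tg; move: rU; lia.
Qed.

Lemma stp_inj j (r r' : nat) : al j r%:Z = al j r'%:Z -> r = r'.
Proof.
rewrite /stp => /addrI; rewrite ![_ * v j]mulrC => /(q_cancel D1 sqfD (mp_neq0 (mv j))).
by rewrite !qintE => -[].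
Qed.

(** In types 2 and 3, pi is recovered up to a unit as the divisor of norm p of the coefficient, so
    the two points are associated, as in type 0; being interior, they determine the strip. In type 1
    the same argument recovers pi' and hence v. *)
Lemma grel_inj j j' (r r' : nat) k t i :
  goodr (g j) (v j) (U j) (U j %/ 100)%N r -> goodr (g j') (v j') (U j') (U j' %/ 100)%N r' ->
  grel (g j) (v j) (U j %/ 100) r k t i -> grel (g j') (v j') (U j' %/ 100) r' k t i ->
  j = j' /\ r = r'.
Proof.
move=> gr gr'; have [t1 t2 t3] := goodr_tp gr; have [t1' t2' t3'] := goodr_tp gr'.
have base : assoc (al j r%:Z) (al j' r'%:Z) -> j = j' /\ r = r'.
  move=> h; have [h0 uh [e ev]] := assoc_unimodular (mv j) (mv j') t1 t1' t2' t3' (wd_stp (gv j) _) (wd_stp (gv j') _) h.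
  have jj : j = j' by apply/esym/vJ; rewrite ev; exists (conj h0); first exact: qunit_conj.
  split => //; subst j'; apply: (stp_inj (j := j)); rewrite e.
  suff -> : h0 = 1 by rewrite mul1r.
  apply: (can_inj (@conjK D)); apply: (@q_cancel D D1 sqfD (v j)); first exact: mp_neq0.
  by rewrite mulrC -ev -[conj 1]/(conj (1%:~R)) conj_int mulr1.
case: t => [|[|t]] /=.
- by move=> h h'; apply: base; apply: assoc_trans h (assoc_sym h').
- move=> [pi np [pp Zp pi2 py ay]] [pi' np' [_ _ pi2' py' ay']].
  have yy := assoc_trans ay (assoc_sym ay').
  set p := nth _ _ _ in np np' pp Zp.
  have n0 (q : QI D) : `|nm q|%N = p -> nm q != 0 by move=> nq; rewrite -absz_eq0 nq -lt0n prime_gt0.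
  have nn0 (q : QI D) : `|nm q|%N = p -> q <> 0.
    by move=> /n0 nq e; move: nq; rewrite e -[0]/(0%:~R) nm_int expr0n.
  have cc : assoc (conj pi) (conj pi').
    apply: (div_same_nm py); rewrite ?nm_conj ?np ?np' //; last exact: n0.
      by exists (v j).
    by apply: qdvd_trans (assoc_dvd yy); exists (v j').
  have vv : assoc (v j) (v j').
    by apply: assoc_cancel cc yy; apply: nn0; rewrite nm_conj.
  have jj := vJ vv; split => //; subst j'.
  have pp' : assoc (pi ^+ 2) (pi' ^+ 2).
    by apply: assocX; rewrite -[pi]conjK -[pi']conjK; exact: assoc_conj.
  have d' : qdvd (pi ^+ 2) (al j r'%:Z).
    by apply: qdvd_trans pi2'; apply: assoc_dvd; apply: assoc_sym.
  have pa := prim_stp (gv j) r%:Z.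
  (* Since pi^2 divides both points of one strip, p^2 divides r - r', while |r - r'| < U <= p^2. *)
  move/(qdvd_wd (al j r'%:Z) pa pi2): d'.
  have -> : wd (al j r'%:Z) (al j r%:Z) = r%:Z - r'%:Z.
    have -> : al j r%:Z = al j r'%:Z + (r%:Z - r'%:Z)%:~R * v j by rewrite /stp intrB; ring.
    by rewrite wdDr wdxx wdZr wd_stp // add0r mulr1.
  rewrite nmX dvdzE abszX np => pd.
  case: gr gr' => _ rU _ [_ rU' _].
  have pU := leq_sqr_percent (U_large j) Zp.
  apply/eqP; rewrite -eqz_nat -subr_eq0 -absz_eq0 -leqn0 leqNgt; apply/negP => r0.
  have := leq_trans (leq_trans (absz_subr_lt (ltnW rU) (ltnW rU')) pU) (dvdn_leq r0 pd).
  by rewrite ltnn.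
move=> [pi [y [np pp ea py ay]]] [pi' [y' [np' _ ea' py' ay']]].
have yy := assoc_trans ay (assoc_sym ay').
apply: base; rewrite ea ea'; apply: assocM => //; apply: assocX.
set p := nth _ _ _ in np np' pp.
have pry : prim y by apply: prim_dvd (prim_stp (gv j) r%:Z) _; rewrite ea; apply: qdvdMr; exact: qdvdxx.
apply: (div_same_nm pry) => //; last by rewrite np np'.
  exact: qdvd_trans (assoc_dvd yy).
by rewrite -absz_eq0 np' -lt0n prime_gt0.
Qed.

(** Each coefficient has 32 labels: four types times eight positions. The points of all strips are
    counted together as tagged pairs. *)
Lemma sum_good : (\sum_j #|good j| <= 32 * m)%N.
Proof.
pose X := [set q : {j : J & 'I_(U j)} | tagged q \in good (tag q)].
have -> : (\sum_j #|good j| = #|X|)%N.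
  rewrite -sum1dep_card -(sig_big_dep predT (fun j r => r \in good j) (fun _ _ => 1%N)).
  by apply: eq_bigr => j _; rewrite sum1_card.
have -> : (32 * m = #|[set: 'I_m * 'I_4 * 'I_8]|)%N.
  by rewrite cardsT !card_prod !card_ord -mulnA mulnC.
apply: (card_inj_rel (P := fun (q : {j : J & 'I_(U j)}) (b : 'I_m * 'I_4 * 'I_8) => grel (g (tag q)) (v (tag q)) (U (tag q) %/ 100)
   (tagged q) b.1.1 b.1.2 b.2)).
  move=> [j r]; rewrite inE /= inE => /asboolP gr.
  have [k [t [i h]]] := good_rel (gv j) (mv j) (@tg j) (Z8 j) (@sv j) gr.
  by exists (k, t, i); rewrite ?inE.
move=> [j r] [j' r'] [[k t] i]; rewrite inE /= inE => /asboolP gr; rewrite inE /= inE => /asboolP gr' h h'.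
have [jj rr] := grel_inj gr gr' h h'.
by subst j'; congr existT; apply: val_inj.
Qed.

Lemma sum_strips :
  (forall j, disc D <= ((U j)%:Z + 1) ^+ 2 * nm (v j) ^+ 2) ->
  (forall j, (U j)%:Z ^+ 2 * nm (v j) ^+ 2 < disc D) ->
  (forall j, exists2 Y, forall A : nat, (A ^ 2 * (U j %/ 100) ^ 8 < D * U j ^ 2)%N -> (A <= Y)%N &
     (16 * 1000 * (Y * (trunc_log 2 Y).+1) <= U j)%N) ->
  (\sum_j U j <= 3200 * m)%N.
Proof.
move=> U_ge U_lt hY.
apply: (@leq_trans (\sum_j 100 * #|good j|)%N).
  apply: leq_sum => j _; have [Y YP YU] := hY j.
  exact: (good_card D1 sqfD (gv j) (mv j) (@tg j) (U_ge j) (U_lt j) (U_large j) erefl (Z8 j) YP YU).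
rewrite -big_distrr /= (leq_trans (leq_mul (leqnn 100) sum_good)) //.
by rewrite mulnA.
Qed.
End Count.

(** * Grouping the convergents by square-free part *)

Section Reduction.
Variable D : nat.
Hypothesis D1 : (1 < D)%N.
Hypothesis sqfD : squarefree D.
Let D0 : (0 < D)%N. Proof. exact: ltnW. Qed.
Local Notation u := (cf_u D).
Local Notation cc := (@cc D).

(** * Primitive elements of a given norm and square-free parts *)

Lemma wd_om1 : wd (om D) 1 = 1. Proof. by rewrite /wd /=; ring. Qed.

(** Modulo z.2 the norm is z.1^2, so primitivity makes z.2 invertible modulo N z. By [qdvd_wd] the
    residue r then solves a linear congruence with leading coefficient -z.2. *)
Lemma prim_res (z : QI D) : prim z -> nm z != 0 ->
  exists2 r : nat, (r < `|nm z|)%N & qdvd z (stp (om D) 1 r%:Z).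
Proof.
move=> pz nz; have cop : coprimez z.2 (nm z).
  have [y hy] := pz; move: hy; rewrite /wd => hy.
  have c12 : coprimez z.2 z.1.
    apply/coprimezP; exists (- y.1, y.2) => /=; rewrite -hy; ring.
  have c3 : coprimez z.2 (z.1 ^+ 2) by rewrite coprimezXr.
  have /coprimezP [[a b] /= h] := c3.
  apply/coprimezP; exists (a - b * (qt D * z.1 - qn D * z.2), b) => /=; rewrite -h /nm; ring.
have /coprimezP [[a b] /= h] := cop.
pose r0 : int := a * wd (om D) z.
have h0 : qdvd z (stp (om D) 1 r0).
  apply/(qdvd_wd _ pz (qdvdxx z)); apply/dvdzP; exists (b * wd (om D) z).
  rewrite /stp mulr1 wdDl -[r0%:~R]mulr1 wdZl /r0.
  have -> : wd 1 z = - z.2 by rewrite /wd /=; ring.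
  transitivity (wd (om D) z * (a * z.2 + b * nm z) - a * wd (om D) z * z.2); last by ring.
  by rewrite h; ring.
exists `|(r0 %% nm z)%Z|%N.
  by have := modz_ge0 r0 nz; have := ltz_mod r0 nz; lia.
rewrite gez0_abs ?modz_ge0 //.
have -> : stp (om D) 1 (r0 %% nm z)%Z = stp (om D) 1 r0 - ((r0 %/ nm z)%Z * nm z)%:~R.
  have em : (r0 %% nm z)%Z = r0 - (r0 %/ nm z)%Z * nm z by [].
  by rewrite /stp em intrB !mulr1 addrA.
by apply: qdvdB => //; apply: qdvd_int; rewrite dvdz_mull.
Qed.

(* A primitive z is determined up to units by its norm n and the residue of
   omega modulo z, which is minus a root modulo n of the norm form. *)
Lemma prim_classes_card (I : finType) (X : {set I}) (z : I -> QI D) (n : nat) : (0 < n)%N ->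
  {in X, forall k, prim (z k) /\ `|nm (z k)|%N = n} ->
  {in X &, forall k l, assoc (z k) (z l) -> k = l} ->
  (#|X| <= 4 * size (divisors n))%N.
Proof.
move=> n0 hz inj; apply: leq_trans (roots_mod_card D1 sqfD wd_om1 n0).
apply: (card_inj_rel (P := fun k (r : 'I_n) => qdvd (z k) (stp (om D) 1 (r : nat)%:Z))).
  move=> k kX; have [pz nz] := hz k kX.
  have nz0 : nm (z k) != 0 by rewrite -absz_eq0 nz -lt0n.
  have [r rn h] := prim_res pz nz0; rewrite nz in rn.
  exists (Ordinal rn) => //; rewrite inE /=.
  by have := qdvd_dvdnm h; rewrite !dvdzE nz.
move=> k l r kX lX h1 h2; apply: inj => //.
have [pz nz] := hz k kX; have [pz' nz'] := hz l lX.
apply: (div_same_nm (prim_stp wd_om1 (r : nat)%:Z)) => //; last by rewrite nz.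
by rewrite -absz_eq0 nz' -lt0n.
Qed.

Definition sqf_strip (v w z g : QI D) (U : nat) :=
  [/\ v = w * z ^+ 2, sqfree w, mp w & wd g w = 1] /\
  [/\ forall r : nat, (r < U)%N -> tp (stp g w r%:Z),
      disc D <= (U%:Z + 1) ^+ 2 * nm w ^+ 2 & U%:Z ^+ 2 * nm w ^+ 2 < disc D].

(** Choosing z of maximal absolute norm among the square divisors of v leaves a square-free
    cofactor. *)
Lemma sqf_strip_exists (v : QI D) : mp v -> prim v -> exists w z g U, sqf_strip v w z g U.
Proof.
move=> mv pv; have nv := mp_nm mv.
pose P n := `[< exists2 z : QI D, qdvd (z ^+ 2) v & `|nm z|%N = n >].
have exP : exists n, P n.
  by exists 1%N; apply/asboolP; exists 1; [exists v; rewrite expr1n mul1r | rewrite nm1].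
have ubP n : P n -> (n <= `|nm v|)%N.
  move=> /asboolP [z hz <-]; have := qdvd_dvdnm hz; rewrite nmX dvdzE abszX => /dvdn_leq h.
  apply: leq_trans (h _); last by lia.
  by case: (absz _) => // k; rewrite -mulnn leq_pmulr.
case: (ex_maxnP exP ubP) => n /asboolP [z [w e] nz] maxn.
have z0 : z <> 0 by move=> z0; move: nv; rewrite e z0 expr0n mul0r -[0]/(0%:~R) nm_int ltxx.
have tz := tp_sqr D1 sqfD z0; have ew : v = w * z ^+ 2 by rewrite mulrC.
have n0 : (0 < n)%N by rewrite -nz absz_gt0 nm_neq0.
have mw : mp w.
  by move: mv tz => /andP[a b] /andP[c d]; move: a b; rewrite ew e1M e2M /mp pmulr_llt0 // pmulr_lgt0 // => -> ->.
have sw : sqfree w.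
  move=> y [h ey]; have y0 : y <> 0.
    by move=> y0; move: (mp_nm mw); rewrite ey y0 expr0n mul0r -[0]/(0%:~R) nm_int ltxx.
  have : P `|nm (y * z)%R|%N by apply/asboolP; exists (y * z) => //; exists h; rewrite ew ey; ring.
  move=> /maxn; rewrite nmM abszM nz -{2}[n]mul1n leq_pmul2r // /qunit.
  have : (0 < `|nm y|)%N by rewrite absz_gt0 nm_neq0.
  by case: `|nm y|%N => [|[|]].
have [b hb] : prim w by apply: prim_dvd pv _; exists (z ^+ 2).
have [g [U [gw tg h1 h2]]] := strip_exists D1 mw hb.
by exists w, z, g, U.
Qed.

(* With Z = U / 100, the number Y bounds N a for the points a x^2 of a strip of
   length U such that |N x| > Z^2. *)
Definition large_ok (U : nat) := [/\ (1000 * 1000 <= U)%N, (4 * D < (U %/ 100) ^ 8)%N &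
  exists2 Y, forall A : nat, (A ^ 2 * (U %/ 100) ^ 8 < D * U ^ 2)%N -> (A <= Y)%N &
     (16 * 1000 * (Y * (trunc_log 2 Y).+1) <= U)%N].

Lemma sum_by_value (I : finType) (X : {set I}) (f : I -> nat) (N : nat) (h : nat -> R) :
  {in X, forall k, (0 < f k <= N)%N} ->
  \sum_(k in X) h (f k) = \sum_(1 <= n < N.+1) #|[set k in X | f k == n]|%:R * h n.
Proof.
move=> hf.
transitivity (\sum_(1 <= n < N.+1) \sum_(k in X | f k == n) h n); last first.
  apply: eq_bigr => n _; rewrite -sum1dep_card natr_sum mulr_suml.
  by apply: eq_big => k; rewrite ?inE // => _; rewrite mul1r.
rewrite (exchange_big_dep (fun k => k \in X)) //= => [|n k _ /andP[]//].
apply: eq_bigr => k kX.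
rewrite (eq_bigl (fun n => n == f k)); last by move=> n; rewrite kX eq_sym.
by rewrite big_nat1_eq ltnS hf.
Qed.

(** At most 4 tau(n) classes have norm n, and the sum of tau(n) / n^2 is at most 4. *)
Lemma class_sum_le (I : finType) (X : {set I}) (z : I -> QI D) :
  {in X, forall k, prim (z k) /\ nm (z k) != 0} ->
  {in X &, forall k l, assoc (z k) (z l) -> k = l} ->
  \sum_(k in X) (`|nm (z k)|%N%:R ^+ 2)^-1 <= 16 :> R.
Proof.
move=> hz inj; pose N := (\sum_(k in X) `|nm (z k)|)%N.
rewrite (sum_by_value (N := N) (f := fun k => `|nm (z k)|%N) (fun n => (n%:R ^+ 2)^-1)); last first.
  move=> k kX; have [_ nz] := hz k kX; rewrite absz_gt0 nz /= /N (bigD1 k) //=.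
  exact: leq_addr.
apply: (@le_trans _ _ (\sum_(1 <= n < N.+1) 4 * ((size (divisors n))%:R / n%:R ^+ 2))).
  rewrite big_nat [leRHS]big_nat; apply: ler_sum => n /andP[n0 _].
  rewrite mulrA ler_wpM2r ?invr_ge0 ?sqr_ge0 // -natrM ler_nat.
  apply: (prim_classes_card (z := z)) => //.
    by move=> k; rewrite inE => /andP[kX /eqP]; have [] := hz k kX.
  by move=> k l; rewrite !inE => /andP[kX _] /andP[lX _]; apply: inj.
rewrite -mulr_sumr; have := sum_divisors_inv_sqr R N; lra.
Qed.

(** By [strip_width], u_k |N w| N(z)^2 is below the root of the discriminant, which is at most (U +
    1) |N w|. The element w' allows an associate of w. *)
Lemma coef_strip_le (k U : nat) (w w' z : QI D) : odd k -> cc k.+1 = w * z ^+ 2 -> nm z != 0 ->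
  `|nm w|%N = `|nm w'|%N ->
  disc D <= (U%:Z + 1) ^+ 2 * nm w' ^+ 2 -> (u k)%:~R <= U%:R * (`|nm z|%N%:R ^+ 2)^-1 :> R.
Proof.
move=> ok e nz ww h; have u1 := cf_u_ge1 D1 sqfD k.
have mk : mp (cc k.+1) by apply: mp_cc; rewrite //= ok.
have sw : (u k * nm (cc k.+1)) ^+ 2 < disc D.
  apply: (strip_width D1 mk (tp_cc D1 sqfD ok)); last exact: wd_cc_odd.
  by apply: tp_cc_strip => //; rewrite lexx andbT; lia.
have [a ea] : exists a : nat, u k = a%:Z by exists `|u k|%N; rewrite gez0_abs //; lia.
have {}sw := lt_le_trans sw h.
have conv (x : int) : x ^+ 2 = (`|x| ^ 2)%N%:Z by rewrite -[LHS]gez0_abs ?sqr_ge0 // abszX.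
have hn : (a * `|nm z| ^ 2 <= U)%N.
  move: sw; rewrite -exprMn !conv ltz_nat ltn_exp2r // !abszM ea e nmM nmX abszM abszX ww.
  rewrite [(`|nm w'| * _)%N]mulnC mulnA ltn_mul2r -PoszD addn1 ltnS => /andP[_] //.
rewrite ea -[a%:~R]/(a%:R) ler_pdivlMr ?exprn_gt0 ?ltr0n ?absz_gt0 //.
by rewrite -natrX -natrM ler_nat.
Qed.

Theorem sum_large_le s m (a : 'I_m -> QI D) (P : int -> bool) :
  is_min_period D s -> diag_universal D a ->
  (forall b c, b <= c -> P b -> P c) ->
  (forall U : nat, P U -> (U ^ 2 < 4 * D)%N -> large_ok U) ->
  \sum_(0 <= k < evper s | odd k && P (u k)) u k <= (16 * (3200 * m))%N%:Z.
Proof.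
move=> ps ua Pup Pok; set T := evper s.
pose K := [set k : 'I_T | odd k && P (u k)].
have {}K_odd (k : 'I_T) : k \in K -> odd k by rewrite inE => /andP[].
have [w [z [g [U hq]]]] : exists w z g (U : 'I_T -> _), forall k : 'I_T, odd k ->
    sqf_strip (cc k.+1) (w k) (z k) (g k) (U k).
  have : forall k : 'I_T, exists q : QI D * QI D * QI D * nat, odd k ->
      sqf_strip (cc k.+1) q.1.1.1 q.1.1.2 q.1.2 q.2.
    move=> k; case ok : (odd k); last by exists (0, 0, 0, 0%N).
    have mk : mp (cc k.+1) by apply: mp_cc; rewrite //= ok.
    have pk : prim (cc k.+1) by exists (cc k); apply: wd_cc_odd.
    by have [w [z [g [U h]]]] := sqf_strip_exists mk pk; exists (w, z, g, U).
  move=> /choice [q hq].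
  by exists (fun k => (q k).1.1.1), (fun k => (q k).1.1.2), (fun k => (q k).1.2), (fun k => (q k).2).
pose A (k l : 'I_T) := `[< assoc (w k) (w l) >].
have Axx k : A k k by apply/asboolP; exact: assoc_refl.
(* The least index represents each class of square-free parts up to units. *)
pose first k := [forall l : 'I_T, (l \in K) && A l k ==> (k <= l)%N].
pose J : finType := {k : 'I_T | (k \in K) && first k}.
have cover k : k \in K -> exists j : J, A k (val j).
  move=> kK; have h0 : (k \in K) && A k k by rewrite kK Axx.
  case: (@arg_minnP _ k (fun l => (l \in K) && A k l) (fun l => l : nat) h0) => i /andP[iK ki] mini.
  have jP : (i \in K) && first i.
    rewrite iK; apply/forallP => l; apply/implyP => /andP[lK li]; apply: mini.
    rewrite lK; apply/asboolP; apply: assoc_trans (_ : assoc (w i) _).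
      exact/asboolP.
    by apply: assoc_sym; exact/asboolP.
  by exists (exist _ i jP).
have jK (j : J) : val j \in K by case/andP: (valP j).
have nzz (k : 'I_T) : odd k -> nm (z k) != 0.
  move=> ok; have [[e _ _ _] _] := hq k ok.
  have : nm (cc k.+1) < 0 by apply: mp_nm; apply: mp_cc; rewrite //= ok.
  by rewrite e nmM nmX; case: eqP => // ->; rewrite expr0n mulr0 ltxx.
have assoc_abs k (j : J) : A k (val j) -> `|nm (w k)|%N = `|nm (w (val j))|%N.
  by move/asboolP/assoc_nm.
have class (j : J) : \sum_(k in K | A k (val j)) (u k)%:~R <= 16 * (U (val j))%:R :> R.
  pose X := [set k in K | A k (val j)].
  have [[_ _ _ _] [_ Uge _]] := hq _ (K_odd _ (jK j)).
  rewrite (eq_bigl (fun k => k \in X)); last by move=> k; rewrite [RHS]inE.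
  apply: (@le_trans _ _ (\sum_(k in X) (U (val j))%:R * (`|nm (z k)|%N%:R ^+ 2)^-1)).
    apply: ler_sum => k; rewrite inE => /andP[kK kj]; have ok := K_odd _ kK.
    have [[e _ _ _] _] := hq _ ok.
    exact: coef_strip_le ok e (nzz _ ok) (assoc_abs _ _ kj) Uge.
  rewrite -mulr_sumr mulrC ler_wpM2r //; apply: class_sum_le.
    move=> k; rewrite /X inE => /andP[kK _]; have ok := K_odd _ kK; split; last exact: nzz.
    have [[e _ _ _] _] := hq _ ok; have pc : prim (cc k.+1) by exists (cc k); apply: wd_cc_odd.
    by apply: prim_dvd pc _; exists (w k * z k); rewrite e; ring.
  (* Within a class the factors z are pairwise non-associated, for otherwise two convergents of one
     even period would be associated. *)
  move=> k l; rewrite !inE => /andP[/andP[ok _] kj] /andP[/andP[ol _] lj] zz.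
  have [[e _ _ _] _] := hq _ ok; have [[e' _ _ _] _] := hq _ ol.
  have kl : assoc (cc k.+1) (cc l.+1).
    rewrite e e'; apply: assocM; last exact: assocX.
    by apply: (assoc_trans (y := w (val j))); [exact/asboolP | apply/assoc_sym/asboolP].
  apply: val_inj; have [lt|lt|//] := ltngtP k l; exfalso.
    by apply: (cc_nonassoc D1 sqfD ps ok ol lt (ltn_ord l)); exact: assoc_sym.
  by apply: (cc_nonassoc D1 sqfD ps ol ok lt (ltn_ord k)).
(* The strip of w is at least as long as u_k, so it passes the monotone threshold too. *)
have Uok (j : J) : large_ok (U (val j)).
  have ok := K_odd _ (jK j); have [[e _ mw _] [_ Uge Ult]] := hq _ ok.
  apply: Pok.
    apply: Pup (_ : u (val j) <= _) _; last by have := jK j; rewrite inE => /andP[].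
    rewrite -(ler_int R); apply: le_trans (coef_strip_le ok e (nzz _ ok) erefl Uge) _.
    rewrite ler_piMr // invf_le1 ?exprn_gt0 ?ltr0n ?absz_gt0 ?nzz //.
    by rewrite exprn_ege1 // ler1n absz_gt0 nzz.
  rewrite -ltz_nat; apply: lt_le_trans (disc_le D0); apply: le_lt_trans Ult.
  rewrite -[(_ ^ 2)%N%:Z]/((U (val j))%:Z ^+ 2) ler_peMr ?sqr_ge0 //.
  by rewrite -gtz0_ge1 lt0r sqrf_eq0 sqr_ge0 andbT lt_eqF // mp_nm.
have main : (\sum_(j : J) U (val j) <= 3200 * m)%N.
  have hj (j : J) := hq _ (K_odd _ (jK j)).
  apply: (sum_strips D1 sqfD ua (v := fun j : J => w (val j)) (g := fun j : J => g (val j))).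
  - by move=> j; have [[]] := hj j.
  - by move=> j; have [[]] := hj j.
  - by move=> j; have [_ []] := hj j.
  - by move=> j; have [[]] := hj j.
  - by move=> j; have [] := Uok j.
  - by move=> j; have [] := Uok j.
  - move=> i j /asboolP ij; apply: val_inj; apply: val_inj => /=.
    have /andP[_ /forallP fi] := valP i; have /andP[_ /forallP fj] := valP j.
    have h1 := fi (val j); have h2 := fj (val i).
    apply/eqP; rewrite eqn_leq; apply/andP; split.
      apply: (implyP h1); rewrite jK; apply/asboolP/assoc_sym/asboolP; exact: ij.
    by apply: (implyP h2); rewrite jK.
  - by move=> j; have [_ []] := hj j.
  - by move=> j; have [_ []] := hj j.
  - by move=> j; have [] := Uok j.
rewrite big_mkord -(ler_int R) rmorph_sum /=.
rewrite (eq_bigl (fun k => k \in K)); last by move=> k; rewrite inE.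
apply: (@le_trans _ _ (\sum_(j : J) \sum_(k in K | A k (val j)) (u k)%:~R)).
  rewrite (exchange_big_dep (fun k => k \in K)) //= => [|j k _ /andP[]//].
  apply: ler_sum => k kK; have [j kj] := cover k kK.
  rewrite (bigD1 j) ?kK //= lerDl sumr_ge0 // => i _.
  by rewrite ler0z; have := cf_u_ge1 D1 sqfD k; lia.
apply: le_trans (ler_sum _ (fun j _ => class j)) _.
rewrite -mulr_sumr PoszM intrM ler_pM2l // -natr_sum ler_nat; exact: main.
Qed.
End Reduction.

(** * Asymptotics *)

(** With L the binary logarithm of D, the power is at least exp(c L), hence at least (c L)^3 / 6,
    which outgrows any multiple of (L + 1)^2. *)
Lemma powR_grows (K eps : R) : 0 < eps -> exists D0 : nat, forall D : nat, (D0 <= D)%N ->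
  K * (trunc_log 2 D).+1%:R ^+ 2 <= (D%:R : R) `^ (8 * eps).
Proof.
move=> e0; have l2 : 0 < ln (2 : R) by apply: ln_gt0; rewrite ltr1n.
pose c : R := 8 * eps * ln 2; have c0 : 0 < c by rewrite !mulr_gt0.
have [L0 hL0] : exists L0 : nat, 24 * `|K| / c ^+ 3 < L0%:R.
  exists (Num.bound (24 * `|K| / c ^+ 3)); apply: archi_boundP.
  by rewrite divr_ge0 ?mulr_ge0 ?exprn_ge0 // ltW.
exists (2 ^ L0.+1)%N => D hD; set L := trunc_log 2 D.
have D0 : (0 < D)%N by apply: leq_trans hD; rewrite expn_gt0.
have LL : (L0 < L)%N by apply: trunc_log_max.
have lnD : L%:R * ln 2 <= ln (D%:R : R).
  rewrite mulr_natl -lnXn // ler_ln ?posrE ?exprn_gt0 ?ltr0n //.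
  by rewrite -natrX ler_nat trunc_logP.
have -> : (D%:R : R) `^ (8 * eps) = expR (8 * eps * ln D%:R).
  by rewrite /powR gt_eqF ?ltr0n.
have x0 : 0 <= c * L%:R by rewrite mulr_ge0 // ltW.
have h1 : (c * L%:R) ^+ 3 / 6 <= expR (8 * eps * ln D%:R).
  apply: (@le_trans _ _ (expR (c * L%:R))).
    have := expR_ge1Dxn 2 x0; rewrite (_ : 3`!%:R = 6 :> R) //; lra.
  rewrite ler_expR /c -mulrA [_ * L%:R]mulrC ler_wpM2l //; lra.
apply: le_trans h1.
have L1 : 1 <= L%:R :> R by rewrite ler1n; apply: leq_trans LL.
have k1 : 24 * `|K| <= c ^+ 3 * L%:R.
  rewrite [leRHS]mulrC -ler_pdivrMr ?exprn_gt0 //; apply: ltW; apply: lt_trans hL0 _.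
  by rewrite ltr_nat.
have k2 : L.+1%:R ^+ 2 <= 4 * L%:R ^+ 2 :> R.
  have -> : 4 * L%:R ^+ 2 = (2 * L%:R) ^+ 2 :> R by ring.
  rewrite ler_sqr ?nnegrE ?mulr_ge0 // -[L.+1]addn1 natrD; lra.
have -> : (c * L%:R) ^+ 3 / 6 = (c ^+ 3 * L%:R) / 24 * (4 * L%:R ^+ 2) by field.
apply: le_trans (_ : `|K| * L.+1%:R ^+ 2 <= _).
  by rewrite ler_wpM2r ?sqr_ge0 // ler_norm.
apply: ler_pM => //.
by rewrite ler_pdivlMr // mulrC.
Qed.

(** The bound b >= 200 gives U <= b Z, so Z^8 >= c^8 (L + 1)^2 D; c >= 5000 then covers the
    numerical constants of [large_ok]. *)
Lemma large_ok_of_pow (D U b c : nat) : (200 <= b)%N -> (5000 <= c)%N -> (4 <= D)%N ->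
  ((b * c) ^ 8 * ((trunc_log 2 D).+1 ^ 2 * D) <= U ^ 8)%N -> (U ^ 2 < 4 * D)%N -> large_ok D U.
Proof.
move=> hb hc D4 hU U2; set L := trunc_log 2 D in hU.
have D0 : (0 < D)%N by apply: leq_trans D4.
have LD0 : (0 < L.+1 ^ 2 * D)%N by rewrite muln_gt0 expn_gt0.
have Uc : (b * c <= U)%N.
  by rewrite -(leq_exp2r _ _ (isT : 0 < 8)%N); apply: leq_trans hU; rewrite leq_pmulr.
have U6 : (1000 * 1000 <= U)%N by apply: leq_trans Uc; apply: leq_trans (leq_mul hb hc); clear; lia.
set Z := (U %/ 100)%N.
have Z200 : (U <= b * Z)%N.
  apply: (@leq_trans (200 * Z)); last by rewrite leq_mul2r hb orbT.
  have := divn_eq U 100; have := ltn_pmod U (isT : 0 < 100)%N; rewrite -/Z.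
  by clear -U6; lia.
have Z8 : (c ^ 8 * (L.+1 ^ 2 * D) <= Z ^ 8)%N.
  rewrite -(leq_pmul2l (_ : 0 < b ^ 8)%N) ?expn_gt0 ?(leq_trans _ hb) // mulnA -!expnMn.
  by apply: leq_trans hU _; rewrite leq_exp2r.
have c128 : (128 <= c)%N by clear -hc; lia.
have c2 : (16 * 1000 <= c ^ 2)%N.
  by rewrite -mulnn; apply: leq_trans (leq_mul c128 c128); clear; lia.
have c4 : (16 * 1000 <= c ^ 4)%N.
  by apply: leq_trans c2 _; rewrite leq_exp2l //; apply: leq_trans c128.
split => //.
  apply: leq_trans Z8; rewrite mulnA ltn_pmul2r //.
  apply: (@leq_trans (c ^ 4)); first by apply: leq_trans c4.
  apply: (@leq_trans (c ^ 8)); first by rewrite leq_exp2l //; apply: leq_trans c128.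
  by rewrite leq_pmulr // expn_gt0.
have DU : (U <= D)%N.
  rewrite -(leq_exp2r _ _ (isT : 0 < 2)%N); apply: leq_trans (ltnW U2) _.
  by rewrite -mulnn leq_mul2r D4 orbT.
have w0 : (0 < 16 * 1000 * L.+1)%N by [].
(* The logarithm of Y is at most L because U <= D, so this Y meets the second requirement. *)
exists (U %/ (16 * 1000 * L.+1))%N.
  move=> A hA; rewrite leq_divRL // leqNgt; apply/negP => h.
  have h2 : (U ^ 2 < A ^ 2 * (16 * 1000 * L.+1) ^ 2)%N by rewrite -expnMn ltn_exp2r.
  have A0 : (0 < A)%N by move: h; case: (A).
  have h3 : (A ^ 2 * Z ^ 8 < A ^ 2 * ((16 * 1000 * L.+1) ^ 2 * D))%N.
    apply: leq_trans hA _; rewrite mulnA mulnC leq_mul2r (ltnW h2) orbT //.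
  rewrite ltn_pmul2l ?expn_gt0 ?A0 // ltnNge in h3; case/negP: h3.
  apply: leq_trans Z8; rewrite expnMn -mulnA leq_mul2r.
  apply/orP; right; have -> : (c ^ 8 = (c ^ 4) ^ 2)%N by rewrite -expnM.
  rewrite (leq_exp2r _ _ (isT : 0 < 2)%N); exact: c4.
set Y := (U %/ _)%N.
have YL : (trunc_log 2 Y <= L)%N.
  by apply: leq_trunc_log; apply: leq_trans DU; exact: leq_div.
apply: (@leq_trans (Y * (16 * 1000 * L.+1))); last exact: leq_trunc_div.
by rewrite mulnCA leq_mul2l leq_mul2l ltnS YL !orbT.
Qed.

(** The eighth power of D^(1/8 + eps) is D times D^(8 eps), and the second factor absorbs the
    squared logarithm and the constants. The numbers b and c stay abstract so that their powers are
    not evaluated. *)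
Lemma large_ok_eventually (eps : R) : 0 < eps -> exists D0 : nat, forall D U : nat, (D0 <= D)%N ->
  (D%:R : R) `^ (8^-1 + eps) <= U%:R -> (U ^ 2 < 4 * D)%N -> large_ok D U.
Proof.
move=> e0; have [b hb] : exists b, (200 <= b)%N by exists 200%N.
have [c hc] : exists c, (5000 <= c)%N by eexists; exact: leqnn.
have [D0 hD0] := powR_grows ((b * c) ^ 8)%N%:R e0.
exists (maxn D0 4) => D U; rewrite geq_max => /andP[D0D D4] hU U2.
apply: (large_ok_of_pow hb hc D4 _ U2).
have Dp : 0 < D%:R :> R by rewrite ltr0n (leq_trans _ D4).
rewrite -(ler_nat R) natrX; apply: le_trans (_ : ((D%:R : R) `^ (8^-1 + eps)) ^+ 8 <= _); last first.
  by rewrite lerXn2r ?nnegrE ?powR_ge0.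
rewrite -powR_mulrn ?powR_ge0 // -powRrM.
have -> : (8^-1 + eps) * 8%:R = 1 + 8 * eps by field.
rewrite powRD; last by rewrite gt_eqF //= addr_gt0 // mulr_gt0.
rewrite (powRr1 (ltW Dp)) mulnA natrM [leLHS]mulrC; apply: (ler_wpM2l (ltW Dp)).
rewrite natrM [((_ ^ 2)%N)%:R]natrX; exact: hD0.
Qed.

(** Finitely many D remain, each with at most one minimal period, so a minimum of finitely many
    positive constants works. *)
Lemma Mstar_bounded_below (eps : R) (D0 : nat) : exists2 C : R, 0 < C &
  forall D s : nat, (D < D0)%N -> is_min_period D s -> C * (Mstar D s eps)%:~R <= 1.
Proof.
elim: D0 => [|D0 [C C0 IH]]; first by exists 1.
have [[s0 [p0 min0]]|no] := pselect (exists s, is_min_period D0 s); last first.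
  exists C => // D s; rewrite ltnS leq_eqVlt => /orP[/eqP-> ps|]; last exact: IH.
  by case: no; exists s.
pose C' : R := (1 + `|(Mstar D0 s0 eps)%:~R|)^-1.
have C'0 : 0 < C' by rewrite invr_gt0 ltr_wpDr.
exists (Num.min C C') => [|D s]; first by rewrite lt_min C0 C'0.
have le_max (x : R) (b : R) : 0 < b -> b * x <= 1 -> Num.min C C' <= b -> Num.min C C' * x <= 1.
  move=> b0 h hb; have m0 : 0 < Num.min C C' by rewrite lt_min C0 C'0.
  have [x0|x0] := leP 0 x; first by apply: le_trans h; rewrite ler_wpM2r.
  by apply: le_trans (_ : 0 <= 1) => //; rewrite pmulr_rle0 // ltW.
rewrite ltnS leq_eqVlt => /orP[/eqP->|lt] ps; last first.
  by apply: (le_max _ C) => //; [exact: IH | rewrite ge_min lexx].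
have -> : s = s0 by case: ps => p1 min1; apply/eqP; rewrite eqn_leq min1 // min0.
apply: (le_max _ C') => //; last by rewrite ge_min lexx orbT.
rewrite /C' mulrC ler_pdivrMr ?mul1r; last by rewrite ltr_wpDr.
by apply: le_trans (ler_norm _) _; rewrite lerDr.
Qed.

Theorem theorem1 :
  forall eps : Rdefinitions.R, 0 < eps ->
  exists C : Rdefinitions.R, 0 < C /\
  forall (D s : nat), (1 < D)%N -> squarefree D -> is_min_period D s ->
    (exists m, is_mdiag D m) /\
    (forall m : nat, is_mdiag D m ->
       Num.max ((M_D D s)%:~R / (kappa s * s)%:R) (C * (Mstar D s eps)%:~R)
         <= (m%:R : Rdefinitions.R)
       /\ (m%:Z <= 8 * M_D D s)).
Proof.
move=> eps e0; have [D0 hD0] := large_ok_eventually e0.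
have [C1 C10 hC1] := Mstar_bounded_below eps D0.
(* The factor 2 comes from [M_gen_le], 16 from [class_sum_le] and 3200 from [sum_strips]. *)
have [N N0 hN] : exists2 N : nat, (0 < N)%N & (2 * (16 * 3200) <= N)%N by exists (2 * (16 * 3200))%N; lia.
pose C := Num.min C1 (N%:R^-1).
have C0 : 0 < C by rewrite lt_min C10 invr_gt0 ltr0n.
exists C; split => // D s D1 sqfD ps; have [pps _] := ps.
have [n [nM un]] := has_universal_8M D1 sqfD pps.
split.
  pose P k := `[< has_diag_universal D k >].
  have exP : exists k, P k by exists n; apply/asboolP.
  case: (ex_minnP exP) => k /asboolP uk mink; exists k; split => // k' uk'.
  by apply: mink; apply/asboolP.
move=> m [[a ua] minm]; split; last by rewrite -nM lez_nat; exact: minm.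
rewrite ge_max; apply/andP; split.
  have ks0 : (0 < kappa s * s)%N by rewrite evper_kappa; have [] := evper_period pps.
  rewrite ler_pdivrMr ?ltr0n // -natrM evper_kappa mulnC.
  by have := M_le D1 sqfD pps ua; rewrite -(ler_int R).
have m1 : 1 <= m%:R :> R by rewrite ler1n; exact: universal_gt0 ua.
have [M0|M0] := leP 0 ((Mstar D s eps)%:~R : R); last first.
  by apply: le_trans (_ : 0 <= _) => //; rewrite pmulr_rle0 // ltW.
(* For small D the constant was chosen so that the left side is at most 1, and m is at least 1. *)
have [DD|DD] := ltnP D D0.
  apply: le_trans m1; apply: le_trans (hC1 D s DD ps).
  by rewrite ler_wpM2r // ge_min lexx.
apply: (@le_trans _ _ (N%:R^-1 * (Mstar D s eps)%:~R)).
  by rewrite ler_wpM2r // ge_min lexx orbT.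
rewrite mulrC ler_pdivrMr ?ltr0n //.
pose P := fun u : int => (D%:R : R) `^ (8^-1 + eps) <= u%:~R.
have Pup b c : b <= c -> P b -> P c by rewrite /P => bc h; apply: le_trans h _; rewrite ler_int.
have Pok U : P U%:Z -> (U ^ 2 < 4 * D)%N -> large_ok D U by move=> h; exact: hD0.
have h1 := M_gen_le D1 sqfD pps Pup.
have h2 := sum_large_le D1 sqfD ps ua Pup Pok.
have h3 : Mstar D s eps <= (2 * (16 * (3200 * m)))%N%:Z.
  apply: le_trans h1 _; rewrite PoszM; apply: ler_wpM2l => //; exact: h2.
rewrite -natrM; apply: (@le_trans _ _ ((2 * (16 * (3200 * m)))%N%:Z%:~R)).
  by rewrite ler_int.
rewrite ler_nat [(m * N)%N]mulnC; apply: leq_trans (leq_mul hN (leqnn m)).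
by rewrite -!mulnA leqnn.
Qed.
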